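(* Let $n\ge1$, $m\ge0$, $q\in\mathbb K^*$ with $q\ne\pm1$, $\bullet\in\{\mathsf 0,\mathsf s,\mathsf{ss}\}$ and $\underline Q=(Q_1,\dots,Q_m)\in(\mathbb K^* )^m$. Suppose $f=f^{(\bullet)}_{\underline Q}(X_1)$ and $P^{(\bullet)}_n(q^2,\underline Q)\neq0$, and let $\underline\lambda\in\mathscr P^{\bullet,m}_n$. Then the $\mathcal A_n$-module $\mathbb D(\underline\lambda)=\bigoplus_{\tau\in P(\underline\lambda)}\mathbb L(\mathrm{res}(\mathfrak t^{\underline\lambda}))^\tau$ affords an $\mathcal H^f_\Delta(n)$-module via $$T_iz^\tau=\begin{cases}\widetilde\Xi_iz^\tau+\widetilde\Omega_iz^{s_i\tau},&\text{if }s_i\text{ is admissible with respect to }\tau\cdot\mathrm{res}(\mathfrak t^{\underline\lambda}),\\ \widetilde\Xi_iz^\tau,&\text{otherwise,}\end{cases}$$ for any $1\le i\le n-1$, $z\in\mathbb L(\mathrm{res}(\mathfrak t^{\underline\lambda}))$ and $\tau\in P(\underline\lambda)$.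
   Context: **Superalgebra conventions.** $\mathbb K$ is an algebraically closed field of characteristic $\ne2$; for each $a\in\mathbb K$ a square root $\sqrt a$ is fixed. Modules over superalgebras are $\mathbb Z_2$-graded left modules; homomorphisms are linear maps (sums of homogeneous maps of either parity) with $f(av)=(-1)^{\bar f\bar a}af(v)$. $\Pi V$ is $V$ with opposite grading and action $a\cdot v=(-1)^{\bar a}av$. A finite-dimensional irreducible module is of type $\texttt M$ (resp. $\texttt Q$) if its endomorphism algebra has dimension $1$ (resp. $2$). For irreducible $V,W$ over superalgebras $\mathcal A,\mathcal B$, $V\boxtimes W$ is $V\otimes W$ with $(a\otimes b)(v\otimes w)=(-1)^{\bar b\bar v}av\otimes bw$, and $V\circledast W$ is an irreducible component: $V\boxtimes W=(V\circledast W)\oplus\Pi(V\circledast W)$ if both are of type $\texttt Q$, and $V\circledast W=V\boxtimes W$ otherwise. **Algebras.** $\epsilon=q-q^{-1}$, and $q+q^{-1}\neq0$. $\mathcal H_\Delta(n)$ is the superalgebra with even generators $T_1,\dots,T_{n-1},X_1^{\pm1},\dots,X_n^{\pm1}$ and odd generators $C_1,\dots,C_n$ and relations: $T_i^2=\epsilon T_i+1$; $T_iT_j=T_jT_i$ ($|i-j|>1$); $T_iT_{i+1}T_i=T_{i+1}T_iT_{i+1}$; $X_iX_j=X_jX_i$; $X_iX_i^{-1}=X_i^{-1}X_i=1$; $C_i^2=1$; $C_iC_j=-C_jC_i$ ($i\ne j$); $T_iX_i=X_{i+1}T_i-\epsilon(X_{i+1}+C_iC_{i+1}X_i)$; $T_iX_{i+1}=X_iT_i+\epsilon(1-C_iC_{i+1})X_{i+1}$;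 $T_iX_j=X_jT_i$ ($j\ne i,i+1$); $T_iC_i=C_{i+1}T_i$; $T_iC_{i+1}=C_iT_i-\epsilon(C_i-C_{i+1})$; $T_iC_j=C_jT_i$ ($j\neq i,i+1$); $X_iC_i=C_iX_i^{-1}$; $X_iC_j=C_jX_i$ ($i\ne j$). $\mathcal A_n$ is the subalgebra generated by all $X_i^{\pm1},C_i$; $\mathcal A_n\cong\mathcal A_1^{\otimes n}$. For $x\in\mathbb K^*$ put $\mathtt q(x)=2\frac{qx+(qx)^{-1}}{q+q^{-1}}$ and $\mathtt b_\pm(x)=\frac{\mathtt q(x)}2\pm\sqrt{\frac{\mathtt q(x)^2}4-1}$. Let $f^{(\mathsf 0)}_{\underline Q}=\prod_{i=1}^m(X_1+X_1^{-1}-\mathtt q(Q_i))$, $f^{(\mathsf s)}_{\underline Q}=(X_1-1)f^{(\mathsf 0)}_{\underline Q}$, $f^{(\mathsf{ss})}_{\underline Q}=(X_1+1)(X_1-1)f^{(\mathsf 0)}_{\underline Q}$, and $\mathcal H^f_\Delta(n)=\mathcal H_\Delta(n)/\langle f\rangle$. **Combinatorics.** $\mathscr P^{\mathsf 0,m}_n=\mathscr P^m_n$ is the set of $m$-multipartitions $(\lambda^{(1)},\dots,\lambda^{(m)})$ of $n$ (empty if $m=0$, $n\ge1$; one element if $n=0$). $\mathscr P^{\mathsf s}_n$ is the set of strict partitions of $n$. $\mathscr P^{\mathsf s,m}_n=\bigcup_{a=0}^n\mathscr P^{\mathsf s}_a\times\mathscr P^m_{n-a}$, elements written $(\lambda^{(0)},\lambda^{(1)},\dots,\lambda^{(m)})$;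 $\mathscr P^{\mathsf{ss},m}_n=\bigcup_{a+b+c=n}\mathscr P^{\mathsf s}_a\times\mathscr P^{\mathsf s}_b\times\mathscr P^m_c$, elements written $(\lambda^{(0_-)},\lambda^{(0_+)},\lambda^{(1)},\dots,\lambda^{(m)})$. Partitions are identified with Young diagrams and strict partitions (components $0,0_\pm$) with shifted Young diagrams (row $i$ starts in column $i$). $(i,j,l)$ is the box in row $i$, column $j$ of component $l$. $\mathrm{Std}(\underline\lambda)$ is the set of standard tableaux; $\mathfrak t^{\underline\lambda}$ is filled with $1,\dots,n$ consecutively by rows, starting from the first component. $\mathfrak S_n$ (simple transpositions $s_i$) acts on tableaux by permuting entries; $s_l$ is admissible with respect to $\mathfrak t\in\mathrm{Std}(\underline\lambda)$ if $s_l\mathfrak t$ is standard. $P(\underline\lambda)$ is the set of $\tau=s_{k_t}\cdots s_{k_1}$ such that $s_{k_l}$ is admissible with respect to $s_{k_{l-1}}\cdots s_{k_1}\mathfrak t^{\underline\lambda}$ for $l=1,\dots,t$. With $Q_0=Q_{0_+}=1$, $Q_{0_-}=-1$, the residue of $(i,j,l)$ is $Q_lq^{2(j-i)}$; $\mathrm{res}_{\mathfrak t}(k)$ is the residue of the box of $\mathfrak t$ containing $k$, $\mathrm{res}(\mathfrak t)=(\mathrm{res}_{\mathfrak t}(1),\dots,\mathrm{res}_{\mathfrak t}(n))$, $\mathtt q(\mathrm{res}(\mathfrak t))=(\mathtt q(\mathrm{res}_{\mathfrak t}(k)))_{k=1}^n$. One has $\tau\cdot\mathrm{res}(\mathfrak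 t^{\underline\lambda})=\mathrm{res}(\tau\mathfrak t^{\underline\lambda})$, where $\tau\cdot(\iota_1,\dots,\iota_n)=(\iota_{\tau^{-1}(1)},\dots,\iota_{\tau^{-1}(n)})$. The transposition $s_i$ is admissible with respect to $\tau\cdot\mathrm{res}(\mathfrak t^{\underline\lambda})$ if $s_i\cdot\mathtt q(\mathrm{res}(\tau\mathfrak t^{\underline\lambda}))=\mathtt q(\mathrm{res}(\mathfrak u))$ for some $\mathfrak u\in\mathrm{Std}(\underline\lambda)$; under the assumption $P_n^{(\bullet)}(q^2,\underline Q)\neq0$ this is equivalent to $s_i\tau\mathfrak t^{\underline\lambda}$ being standard, so that $s_i\tau\in P(\underline\lambda)$. **Polynomials.** $P^{(\mathsf 0)}_n(q^2,\underline Q)=\prod_{t=1}^n(q^{2t}-1)\cdot R$ and $P^{(\mathsf s)}_n(q^2,\underline Q)=P^{(\mathsf{ss})}_n(q^2,\underline Q)=\prod_{t=1}^n(q^{2t}-1)(q^{2t}+1)\cdot R$, where $$R=\prod_{i=1}^m\Big(\prod_{t=3-n}^{n-1}(Q_i^2-q^{-2t})\prod_{t=1-n}^n(Q_i^2-q^{-4t})\Big)\prod_{1\le i<i'\le m}\prod_{t=1-n}^{n-1}(Q_i-Q_{i'}q^{-2t})(Q_iQ_{i'}-q^{-2(t+1)}),$$ the product over $3-n\le t\le n-1$ being $1$ when $n=1$. **Modules and operators.** For $x\in\mathbb K^*$, $\mathbb L(x)=\mathbb Kv_0\oplus\mathbb Kv_1$ ($v_0$ even, $v_1$ odd) is the $\mathcal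 A_1$-module with $X_1^{\pm1}v_0=\mathtt b_\pm(x)v_0$, $X_1^{\pm1}v_1=\mathtt b_\mp(x)v_1$, $C_1v_0=v_1$, $C_1v_1=v_0$. For $\underline a\in(\mathbb K^* )^n$, $\mathbb L(\underline a)=\mathbb L(a_1)\circledast\cdots\circledast\mathbb L(a_n)$. For $\tau\in\mathfrak S_n$, $\mathbb L(\underline a)^\tau=\{z^\tau\mid z\in\mathbb L(\underline a)\}$ is the $\mathcal A_n$-module with $X_{\tau(k)}^{\pm1}z^\tau=(X_k^{\pm1}z)^\tau$, $C_{\tau(k)}z^\tau=(C_kz)^\tau$. On each summand $\mathbb L(\mathrm{res}(\mathfrak t^{\underline\lambda}))^\tau$ of $\mathbb D(\underline\lambda)$ the following operators are well defined under the assumption $P^{(\bullet)}_n(q^2,\underline Q)\ne0$ (the expression under the root acts as a scalar on each summand): $$\widetilde\Xi_iu=\Big(-\frac{\epsilon}{X_iX_{i+1}^{-1}-1}+\frac{\epsilon}{X_iX_{i+1}-1}C_iC_{i+1}\Big)u,\quad \widetilde\Omega_iu=\sqrt{1-\epsilon^2\Big(\tfrac{X_iX_{i+1}^{-1}}{(X_iX_{i+1}^{-1}-1)^2}+\tfrac{X_i^{-1}X_{i+1}^{-1}}{(X_i^{-1}X_{i+1}^{-1}-1)^2}\Big)}\,u .$$ *)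

(* Defs.v *)
From HB Require Import structures.
From mathcomp Require Import all_boot all_order all_algebra all_fingroup.
From mathcomp Require Import generic_quotient boolp finmap monalg.

Set Implicit Arguments.
Unset Strict Implicit.
Unset Printing Implicit Defensive.

Import GRing.Theory.
Local Open Scope quotient_scope.
Local Open Scope ring_scope.

HB.mixin Record isSuperspace (K : fieldType) V of GRing.Lmodule K V := {
  homog : bool -> V -> Prop;
  homog_lin : forall p c u v, homog p u -> homog p v -> homog p (c *: u + v);
  homog_dec : forall v, exists v0 v1,
    [/\ homog false v0, homog true v1 & v = v0 + v1];
  homog_dir : forall v, homog false v -> homog true v -> v = 0 }.

#[short(type="superVectType")]
HB.structure Definition SuperVector (K : fieldType) :=
  {V of Vector K V & isSuperspace K V}.

(* A K-algebra is given as a ring with a central map [sc] from K, because a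
   quotient of a superalgebra may be zero and [algType] excludes the zero
   ring. *)
HB.mixin Record isSuperalgebra (K : fieldType) A of GRing.PzRing A := {
  sc : K -> A;
  sc_zmod_morphism : zmod_morphism sc;
  sc_monoid_morphism : monoid_morphism sc;
  scC : forall c a, sc c * a = a * sc c;
  ahomog : bool -> A -> Prop;
  ahomog_lin : forall p c a b,
    ahomog p a -> ahomog p b -> ahomog p (sc c * a + b);
  ahomog_dec : forall a, exists a0 a1,
    [/\ ahomog false a0, ahomog true a1 & a = a0 + a1];
  ahomog_dir : forall a, ahomog false a -> ahomog true a -> a = 0;
  ahomog1 : ahomog false 1;
  ahomogM : forall p s a b,
    ahomog p a -> ahomog s b -> ahomog (p (+) s) (a * b) }.

#[short(type="superalgType")]
HB.structure Definition Superalgebra (K : fieldType) :=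
  {A of GRing.PzRing A & isSuperalgebra K A}.

Section SuperalgebraTheory.
Variables (K : fieldType) (A : superalgType K).
Implicit Types (a b : A) (p : bool).

HB.instance Definition _ :=
  GRing.isZmodMorphism.Build K A (@sc K A) sc_zmod_morphism.
HB.instance Definition _ :=
  GRing.isMonoidMorphism.Build K A (@sc K A) sc_monoid_morphism.

Lemma ahomog0 p : ahomog p (0 : A).
Proof.
have [v0 [v1 [h0 h1 _]]] := ahomog_dec (0 : A).
have aux (u : A) : ahomog p u -> ahomog p (0 : A).
  move=> hu; have := ahomog_lin _ (-1) _ _ hu hu.
  by rewrite rmorphN1 mulN1r addNr.
by case: p aux => aux; [apply: aux h1 | apply: aux h0].
Qed.

Lemma ahomogZ p c a : ahomog p a -> ahomog p (sc c * a).
Proof. by move=> ha; rewrite -[_ * _]addr0; apply/ahomog_lin/ahomog0. Qed.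

Lemma ahomogN p a : ahomog p a -> ahomog p (- a).
Proof. by rewrite -mulN1r -(rmorphN1 (@sc K A)); apply: ahomogZ. Qed.

Lemma ahomogD p a b : ahomog p a -> ahomog p b -> ahomog p (a + b).
Proof.
by move=> ha hb; rewrite -[a]mul1r -(rmorph1 (@sc K A)); apply: ahomog_lin.
Qed.

Lemma ahomogB p a b : ahomog p a -> ahomog p b -> ahomog p (a - b).
Proof. by move=> ha hb; apply/ahomogD/ahomogN. Qed.

Lemma ahomog_sc c : ahomog false (sc c : A).
Proof. by rewrite -[sc c]mulr1; apply/ahomogZ/ahomog1. Qed.

Lemma ahomog_sum p I (r : seq I) (P : pred I) (F : I -> A) :
  (forall i, P i -> ahomog p (F i)) -> ahomog p (\sum_(i <- r | P i) F i).
Proof.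
move=> h; apply: (big_ind (fun x => ahomog p x)) => //.
  exact: ahomog0.
by move=> x y; apply: ahomogD.
Qed.

Lemma ahomog_prod I (r : seq I) (P : pred I) (F : I -> A) :
  (forall i, P i -> ahomog false (F i)) ->
  ahomog false (\prod_(i <- r | P i) F i).
Proof.
move=> h; apply: (big_ind (fun x => ahomog false x)) => //.
  exact: ahomog1.
by move=> x y hx hy; apply: (ahomogM _ _ _ _ hx hy).
Qed.

Lemma ahomog_uniq a0 a1 b0 b1 :
    ahomog false a0 -> ahomog true a1 -> ahomog false b0 -> ahomog true b1 ->
  a0 + a1 = b0 + b1 -> a0 = b0 /\ a1 = b1.
Proof.
move=> ha0 ha1 hb0 hb1 e.
have e' : a0 - b0 = b1 - a1.
  by apply/eqP; rewrite subr_eq addrAC eq_sym subr_eq addrC e addrC.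
have z : a0 - b0 = 0 by apply: ahomog_dir; [|rewrite e']; apply: ahomogB.
split; apply/eqP; rewrite -subr_eq0 ?z //.
by rewrite -opprB -e' z oppr0.
Qed.

End SuperalgebraTheory.

Definition free_salg (K : fieldType) (G : choiceType) (par : G -> bool) :=
  {malg K[{fmonom G}]}.

Section FreeSuperalgebra.
Variables (K : fieldType) (G : choiceType) (par : G -> bool).
Local Notation F := (free_salg K par).

HB.instance Definition _ := GRing.Lalgebra.on F.

Definition word_par (w : {fmonom G}) : bool := odd (count par w).

Definition free_homog (p : bool) (x : F) : Prop :=
  forall w, w \in msupp x -> word_par w = p.

Lemma free_homogE p (x : F) :
  free_homog p x <-> forall w, word_par w != p -> x@_w = 0.
Proof.
split=> [h w wp|h w].
  by apply: mcoeff_outdom; apply: contraNN wp => /h ->.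
by rewrite -mcoeff_neq0 => xw; apply/eqP/negPn/negP => /h e; rewrite e eqxx in xw.
Qed.

Lemma free_homog_lin p c (u v : F) :
  free_homog p u -> free_homog p v -> free_homog p (malgC c * u + v).
Proof.
rewrite mul_malgC =>  /free_homogE hu /free_homogE hv; apply/free_homogE => w hw.
by rewrite mcoeffD mcoeffZ hu // hv // mulr0 addr0.
Qed.

Lemma free_homogU (c : K) w : free_homog (word_par w) (<< c *g w >> : F).
Proof.
by move=> w' /(fsubsetP msuppU_le); rewrite inE => /eqP ->.
Qed.

Lemma free_homog_dec (v : F) : exists v0 v1,
  [/\ free_homog false v0, free_homog true v1 & v = v0 + v1].
Proof.
have part p : exists x : F, forall w, x@_w = if word_par w == p then v@_w else 0.
  pose c w := if word_par w == p then v@_w else 0.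
  exists (\sum_(w <- msupp v) << c w *g w >>) => w.
  rewrite raddf_sum /=; under eq_bigr do rewrite mcoeffU.
  rewrite -/(c w); case: (boolP (w \in msupp v)) => wv.
    rewrite (bigD1_seq w) //= ?fset_uniq // eqxx mulr1n big1 ?addr0 // => w'.
    by move=> /negbTE ->.
  rewrite /c (mcoeff_outdom wv) if_same big_seq big1 // => w' w'v.
  by case: (w' =P w) => // e; rewrite -e w'v in wv.
have [v0 h0] := part false; have [v1 h1] := part true.
exists v0, v1; split.
- by apply/free_homogE => w; rewrite h0; case: eqP.
- by apply/free_homogE => w; rewrite h1; case: eqP.
- by apply/malgP => w; rewrite mcoeffD h0 h1; case: (word_par w); rewrite /= ?add0r ?addr0.
Qed.

Lemma free_homog_dir (v : F) : free_homog false v -> free_homog true v -> v = 0.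
Proof.
move=> h0 h1; apply/malgP => w; rewrite mcoeff0; apply/eqP; rewrite mcoeff_eq0.
by apply/negP => wv; move: (h0 w wv); rewrite (h1 w wv).
Qed.

Lemma free_mulUU (x y : K) (w w' : {fmonom G}) :
  (<< x *g w >> : F) * << y *g w' >> = << x * y *g mmul w w' >>.
Proof. exact: fgmulUU. Qed.

Lemma free_scC (c : K) (a : F) : malgC c * a = a * malgC c.
Proof.
rewrite [a]monalgE mulr_suml mulr_sumr; apply: eq_bigr => w _.
by rewrite !free_mulUU mulm1 mul1m mulrC.
Qed.

Lemma free_homog1 : free_homog false (1 : F).
Proof.
have -> : false = word_par (mone : {fmonom G}) by rewrite /word_par fm1.
exact: free_homogU.
Qed.

Lemma free_homogM p s (a b : F) :
  free_homog p a -> free_homog s b -> free_homog (p (+) s) (a * b).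
Proof.
move=> ha hb w /msuppM_le[w1 [w2 [/ha <- /hb <- ->]]].
by rewrite /word_par fmM count_cat oddD.
Qed.

Fact free_sc_monoid_morphism :
  monoid_morphism (@mkmalgU {fmonom G} K mone : K -> F).
Proof. by have [mulC oneC] := malgC_is_multiplicative {fmonom G} K. Qed.

HB.instance Definition _ := isSuperalgebra.Build K F
  (raddfB (@mkmalgU {fmonom G} K mone)) free_sc_monoid_morphism
  free_scC free_homog_lin free_homog_dec free_homog_dir free_homog1 free_homogM.

Definition free_gen (g : G) : F := << fmu g >>.

Lemma homog_free_gen g : ahomog (par g) (free_gen g).
Proof.
have -> : par g = word_par (fmu g) by rewrite /word_par fmU /= addn0 oddb.
exact: free_homogU.
Qed.

End FreeSuperalgebra.

Record homogset (K : fieldType) (A : superalgType K) := HomogSet {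
  hs_pred :> A -> Prop;
  hs_homog : forall a, hs_pred a -> exists p, ahomog p a }.

Inductive tsideal (A : pzRingType) (S : A -> Prop) : A -> Prop :=
| tsideal0 : tsideal S 0
| tsidealD a b : tsideal S a -> tsideal S b -> tsideal S (a + b)
| tsideal_gen a s b : S s -> tsideal S (a * s * b).

Definition tsI (A : pzRingType) (S : A -> Prop) : {pred A} :=
  fun a => `[< tsideal S a >].

Section TwoSidedIdeal.
Variables (A : pzRingType) (S : A -> Prop).

Lemma tsIP a : reflect (tsideal S a) (a \in tsI S).
Proof. exact: asboolP. Qed.

Lemma tsideal_mull a x : tsideal S x -> tsideal S (a * x).
Proof.
elim=> [|y z _ hy _ hz|b s c Ss]; rewrite ?mulr0 ?mulrDr ?mulrA; first exact: tsideal0.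
  exact: tsidealD.
exact: tsideal_gen.
Qed.

Lemma tsideal_mulr a x : tsideal S x -> tsideal S (x * a).
Proof.
elim=> [|y z _ hy _ hz|b s c Ss]; rewrite ?mul0r ?mulrDl -?mulrA; first exact: tsideal0.
  exact: tsidealD.
by rewrite mulrA; apply: tsideal_gen.
Qed.

Lemma tsideal_zmod_closed : zmod_closed (tsI S).
Proof.
split=> [|x y /tsIP hx /tsIP hy]; apply/tsIP; first exact: tsideal0.
by apply: tsidealD => //; rewrite -mulN1r; apply: tsideal_mull.
Qed.

HB.instance Definition _ := GRing.isZmodClosed.Build A (tsI S) tsideal_zmod_closed.

End TwoSidedIdeal.

Definition quot_salg (K : fieldType) (A : superalgType K) (S : homogset A) :=
  Quotient.quot (tsI S).

Section QuotientSuperalgebra.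
Variables (K : fieldType) (A : superalgType K) (S : homogset A).
Local Notation Q := (quot_salg S).

HB.instance Definition _ := GRing.Zmodule.on Q.
HB.instance Definition _ := EqQuotient.on Q.

Definition qpi (a : A) : Q := \pi_Q a.

Lemma qpiE a b : qpi a = qpi b <-> tsideal S (a - b).
Proof.
by split=> [/eqP|h]; [|apply/eqP]; rewrite /qpi -Quotient.idealrBE; [move/tsIP|apply/tsIP].
Qed.

Lemma qpi_surj (x : Q) : exists a, qpi a = x.
Proof. by exists (repr x); rewrite /qpi reprK. Qed.

Lemma qpiD : {morph qpi : a b / a + b}.
Proof. by move=> a b; rewrite /qpi Quotient.pi_add. Qed.
Lemma qpiN : {morph qpi : a / - a}.
Proof. by move=> a; rewrite /qpi Quotient.pi_opp. Qed.
Lemma qpi0 : qpi 0 = 0.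
Proof. by have := qpiD 0 (- 0); rewrite qpiN oppr0 addr0 subrr. Qed.

Definition qone : Q := qpi 1.
Definition qmul (x y : Q) : Q := qpi (repr x * repr y).

Lemma qpi_repr (x : Q) : qpi (repr x) = x.
Proof. exact: reprK. Qed.

Lemma qpi_mul a b : qmul (qpi a) (qpi b) = qpi (a * b).
Proof.
have ha := (qpiE _ _).1 (qpi_repr (qpi a)); have hb := (qpiE _ _).1 (qpi_repr (qpi b)).
apply/qpiE; move: (repr (qpi a)) (repr (qpi b)) ha hb => a' b' ha hb.
have -> : a' * b' - a * b = (a' - a) * b' + a * (b' - b).
  by rewrite mulrBl mulrBr addrA subrK.
by apply: tsidealD; [apply: tsideal_mulr | apply: tsideal_mull].
Qed.

Fact qmulA : associative qmul.
Proof.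
move=> x y z; rewrite -(qpi_repr x) -(qpi_repr y) -(qpi_repr z).
by rewrite !qpi_mul mulrA.
Qed.
Fact qmul1 : left_id qone qmul.
Proof. by move=> x; rewrite -(qpi_repr x) qpi_mul mul1r. Qed.
Fact qmulr1 : right_id qone qmul.
Proof. by move=> x; rewrite -(qpi_repr x) qpi_mul mulr1. Qed.
Fact qmulDl : left_distributive qmul +%R.
Proof.
move=> x y z; rewrite -(qpi_repr x) -(qpi_repr y) -(qpi_repr z).
by rewrite -qpiD !qpi_mul -qpiD mulrDl.
Qed.
Fact qmulDr : right_distributive qmul +%R.
Proof.
move=> x y z; rewrite -(qpi_repr x) -(qpi_repr y) -(qpi_repr z).
by rewrite -qpiD !qpi_mul -qpiD mulrDr.
Qed.

HB.instance Definition _ := GRing.Zmodule_isPzRing.Build Q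
  qmulA qmul1 qmulr1 qmulDl qmulDr.

Lemma qpiM : {morph qpi : a b / a * b}.
Proof. by move=> a b; rewrite -qpi_mul. Qed.

HB.instance Definition _ := GRing.isZmodMorphism.Build A Q qpi
  (fun a b => etrans (qpiD a (- b)) (congr1 (+%R (qpi a)) (qpiN b))).
HB.instance Definition _ := GRing.isMonoidMorphism.Build A Q qpi
  (erefl (qpi 1), qpiM).

Definition qsc (c : K) : Q := qpi (sc c).
Definition qhomog p (x : Q) : Prop := exists2 a, ahomog p a & qpi a = x.

Lemma qpi_homog p a : ahomog p a -> qhomog p (qpi a).
Proof. by exists a. Qed.

Fact qsc_zmod_morphism : zmod_morphism qsc.
Proof. by move=> c d; rewrite /qsc !rmorphB. Qed.
Fact qsc_monoid_morphism : monoid_morphism qsc.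
Proof. by split=> [|c d]; rewrite /qsc ?rmorphM ?rmorph1. Qed.
Fact qscC c x : qsc c * x = x * qsc c.
Proof. by rewrite -(qpi_repr x) -!rmorphM scC. Qed.
Fact qhomog_lin p c x y : qhomog p x -> qhomog p y -> qhomog p (qsc c * x + y).
Proof.
move=> [a ha <-] [b hb <-]; exists (sc c * a + b); first exact: ahomog_lin.
by rewrite rmorphD rmorphM.
Qed.
Fact qhomog_dec x : exists x0 x1,
  [/\ qhomog false x0, qhomog true x1 & x = x0 + x1].
Proof.
rewrite -(qpi_repr x); have [a0 [a1 [h0 h1 ->]]] := ahomog_dec (repr x).
by exists (qpi a0), (qpi a1); rewrite rmorphD; split=> //; apply: qpi_homog.
Qed.
Fact qhomog1 : qhomog false 1.
Proof. exact/qpi_homog/ahomog1. Qed.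
Fact qhomogM p s x y : qhomog p x -> qhomog s y -> qhomog (p (+) s) (x * y).
Proof.
move=> [a ha <-] [b hb <-]; rewrite -rmorphM.
exact/qpi_homog/ahomogM.
Qed.

Lemma tsideal_homog_dec a : tsideal S a -> exists a0 a1,
  [/\ ahomog false a0 /\ tsideal S a0, ahomog true a1 /\ tsideal S a1
     & a = a0 + a1].
Proof.
elim=> {a} [|a b _ [a0 [a1 [[ha0 sa0] [ha1 sa1] ->]]] _ [b0 [b1 [[hb0 sb0] [hb1 sb1] ->]]]|a s b Ss].
- by exists 0, 0; rewrite addr0; split=> //; split; try exact: ahomog0; exact: tsideal0.
- exists (a0 + b0), (a1 + b1); rewrite addrACA.
  by split=> //; split; try exact: ahomogD; exact: tsidealD.
have [a0 [a1 [ha0 ha1 ->]]] := ahomog_dec a.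
have [b0 [b1 [hb0 hb1 ->]]] := ahomog_dec b.
have [p hs] := hs_homog Ss.
have hM x y px py : ahomog px x -> ahomog py y -> ahomog (px (+) p (+) py) (x * s * y).
  by move=> hx hy; apply/ahomogM => //; apply/ahomogM.
pose u := a0 * s * b0 + a1 * s * b1; pose v := a0 * s * b1 + a1 * s * b0.
have E : (a0 + a1) * s * (b0 + b1) = u + v.
  by rewrite mulrDl mulrDl !mulrDr [a1 * s * b0 + _]addrC addrACA.
have hu : ahomog p u.
  apply: ahomogD; first by have := hM _ _ _ _ ha0 hb0; rewrite addbF.
  by have := hM _ _ _ _ ha1 hb1; rewrite addbT /= negbK.
have hv : ahomog (~~ p) v.
  apply: ahomogD; first by have := hM _ _ _ _ ha0 hb1; rewrite addbT.
  by have := hM _ _ _ _ ha1 hb0; rewrite addbF.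
have Su : tsideal S u by apply: tsidealD; apply: tsideal_gen.
have Sv : tsideal S v by apply: tsidealD; apply: tsideal_gen.
case: p hu hv {hs hM} => hu hv; [exists v, u|exists u, v]; split=> //.
by rewrite E addrC.
Qed.

Fact qhomog_dir x : qhomog false x -> qhomog true x -> x = 0.
Proof.
move=> [a ha <-] [b hb /esym/qpiE/tsideal_homog_dec].
case=> [c0 [c1 [[hc0 sc0] [hc1 sc1] e]]].
have [e0 _] := ahomog_uniq ha (ahomogN hb) hc0 hc1 e.
by rewrite -qpi0; apply/qpiE; rewrite subr0 e0.
Qed.

HB.instance Definition _ := isSuperalgebra.Build K Q
  qsc_zmod_morphism qsc_monoid_morphism qscC qhomog_lin qhomog_dec qhomog_dir
  qhomog1 qhomogM.

End QuotientSuperalgebra.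

Record sahom (K : fieldType) (A B : superalgType K) := SAHom {
  sahom_fun :> A -> B;
  sahomD : {morph sahom_fun : a b / a + b};
  sahomM : {morph sahom_fun : a b / a * b};
  sahom_sc : forall c, sahom_fun (sc c) = sc c;
  sahom_homog : forall p a, ahomog p a -> ahomog p (sahom_fun a) }.

Section SAHomTheory.
Variables (K : fieldType) (A B : superalgType K) (phi : sahom A B).

Lemma sahom1 : phi 1 = 1.
Proof. by rewrite -(rmorph1 (@sc K A)) sahom_sc rmorph1. Qed.
Lemma sahom0 : phi 0 = 0.
Proof. by rewrite -(rmorph0 (@sc K A)) sahom_sc rmorph0. Qed.
Lemma sahomN : {morph phi : a / - a}.
Proof.
by move=> a; apply/eqP; rewrite -addr_eq0 -sahomD addNr sahom0.
Qed.
Lemma sahomB : {morph phi : a b / a - b}.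
Proof. by move=> a b; rewrite sahomD sahomN. Qed.

End SAHomTheory.

Section FreeLift.
Variables (K : fieldType) (G : choiceType) (par : G -> bool).
Variables (B : superalgType K) (h : G -> B).
Hypothesis h_par : forall g, ahomog (par g) (h g).
Local Notation F := (free_salg K par).

Definition word_val (w : {fmonom G}) : B := \prod_(g <- (w : seq G)) h g.
Definition free_lift_fun (x : F) : B := \sum_(w <- msupp x) sc (x@_w) * word_val w.

Lemma free_lift_funE (d : {fset {fmonom G}}) (x : F) :
  (msupp x `<=` d)%fset -> free_lift_fun x = \sum_(w <- d) sc (x@_w) * word_val w.
Proof.
move=> xd; rewrite /free_lift_fun (big_fset_incl _ xd) //= => w _ /mcoeff_outdom ->.
by rewrite rmorph0 mul0r.
Qed.

Lemma free_lift_funD : {morph free_lift_fun : x y / x + y}.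
Proof.
move=> x y; rewrite (free_lift_funE (msuppD_le _ _)).
rewrite (free_lift_funE (fsubsetUl (msupp x) (msupp y))).
rewrite (free_lift_funE (fsubsetUr (msupp x) (msupp y))) -big_split /=.
by apply: eq_bigr => w _; rewrite mcoeffD rmorphD mulrDl.
Qed.

Lemma free_lift_funU c w : free_lift_fun << c *g w >> = sc c * word_val w.
Proof. by rewrite (free_lift_funE msuppU_le) big_seq_fset1 mcoeffUU. Qed.

Lemma free_lift_fun0 : free_lift_fun 0 = 0.
Proof. by rewrite /free_lift_fun msupp0 big_seq_fset0. Qed.

Lemma free_lift_fun_sum I (r : seq I) (E : I -> F) :
  free_lift_fun (\sum_(i <- r) E i) = \sum_(i <- r) free_lift_fun (E i).
Proof. exact: (big_morph _ free_lift_funD free_lift_fun0). Qed.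

Lemma word_valM w w' : word_val (mmul w w') = word_val w * word_val w'.
Proof. by rewrite /word_val fmM big_cat. Qed.

Lemma free_lift_funM : {morph free_lift_fun : x y / x * y}.
Proof.
have mE (z : F) : z = \sum_(w <- msupp z) (<< z@_w *g w >> : F) := monalgE z.
move=> x y; rewrite [x]mE [y]mE. rewrite [in RHS]free_lift_fun_sum. rewrite [in RHS]free_lift_fun_sum.
rewrite !mulr_suml free_lift_fun_sum; apply: eq_bigr => w _.
rewrite !mulr_sumr free_lift_fun_sum; apply: eq_bigr => w' _.
rewrite free_mulUU !free_lift_funU word_valM rmorphM -!mulrA; congr (_ * _).
by rewrite !mulrA; congr (_ * _); rewrite scC.
Qed.

Lemma free_lift_fun_sc c : free_lift_fun (sc c) = sc c.
Proof. by rewrite free_lift_funU /word_val fm1 big_nil mulr1. Qed.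

Lemma word_val_homog w : ahomog (word_par par w) (word_val w).
Proof.
rewrite /word_par /word_val; elim: (w : seq G) => [|g s IHs] /=.
  by rewrite big_nil; apply: ahomog1.
by rewrite big_cons oddD oddb; apply: ahomogM.
Qed.

Lemma free_lift_fun_homog p (x : F) : ahomog p x -> ahomog p (free_lift_fun x).
Proof.
move=> hx; rewrite /free_lift_fun big_seq; apply: ahomog_sum => w wx.
by rewrite -(hx w wx); apply/ahomogZ/word_val_homog.
Qed.

Definition free_lift : sahom F B := SAHom free_lift_funD free_lift_funM
  free_lift_fun_sc free_lift_fun_homog.

Lemma free_lift_gen g : free_lift (free_gen K par g) = h g.
Proof.
by rewrite /= free_lift_funU rmorph1 mul1r /word_val fmU big_seq1.
Qed.

End FreeLift.

Section QuotientLift.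
Variables (K : fieldType) (A B : superalgType K) (S : homogset A).

Fact qpi_sahom_sc c : qpi S (sc c) = sc c. Proof. by []. Qed.

Definition qpi_hom : sahom A (quot_salg S) :=
  SAHom (@qpiD _ _ S) (@qpiM _ _ S) qpi_sahom_sc (@qpi_homog _ _ S).

Variables (phi : sahom A B) (phiS : forall s, S s -> phi s = 0).

Lemma phi_tsideal a : tsideal S a -> phi a = 0.
Proof.
elim=> [|x y _ hx _ hy|x s y Ss]; first exact: sahom0.
  by rewrite sahomD hx hy addr0.
by rewrite !sahomM (phiS Ss) mulr0 mul0r.
Qed.

Definition quot_lift_fun (x : quot_salg S) : B := phi (repr x).

Lemma quot_lift_qpi a : quot_lift_fun (qpi S a) = phi a.
Proof.
apply/eqP; rewrite -subr_eq0 /quot_lift_fun -sahomB; apply/eqP/phi_tsideal.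
exact/qpiE/qpi_repr.
Qed.

Fact quot_liftD : {morph quot_lift_fun : x y / x + y}.
Proof.
move=> x y; rewrite -(qpi_repr x) -(qpi_repr y) -qpiD !quot_lift_qpi.
exact: sahomD.
Qed.
Fact quot_liftM : {morph quot_lift_fun : x y / x * y}.
Proof.
move=> x y; rewrite -(qpi_repr x) -(qpi_repr y) -qpiM !quot_lift_qpi.
exact: sahomM.
Qed.
Fact quot_lift_sc c : quot_lift_fun (sc c) = sc c.
Proof. by rewrite [LHS]quot_lift_qpi sahom_sc. Qed.
Fact quot_lift_homog p x : ahomog p x -> ahomog p (quot_lift_fun x).
Proof. by move=> [a ha <-]; rewrite quot_lift_qpi; apply: sahom_homog. Qed.

Definition quot_lift : sahom (quot_salg S) B :=
  SAHom quot_liftD quot_liftM quot_lift_sc quot_lift_homog.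

End QuotientLift.

Section PresentedSuperalgebra.
Variables (K : fieldType) (G : choiceType) (par : G -> bool).
Local Notation F := (free_salg K par).
Variable rel : F -> F -> Prop.
Hypothesis rel_homog : forall l r, rel l r -> exists p, ahomog p (l - r).

Definition rel_diff (x : F) : Prop := exists l r, rel l r /\ x = l - r.

Fact rel_diff_homog x : rel_diff x -> exists p, ahomog p x.
Proof. by move=> [l [r [/rel_homog hlr ->]]]. Qed.

Definition rel_set : homogset F := HomogSet rel_diff_homog.

Lemma qpi_rel l r : rel l r -> qpi rel_set l = qpi rel_set r.
Proof.
move=> hlr; apply/qpiE; rewrite -[_ - _]mulr1 -[_ - _]mul1r.
by apply: tsideal_gen; exists l, r.
Qed.

Variables (B : superalgType K) (h : G -> B).
Hypothesis h_par : forall g, ahomog (par g) (h g).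
Hypothesis h_rel : forall l r, rel l r -> free_lift h_par l = free_lift h_par r.

Fact free_lift_rel x : rel_set x -> free_lift h_par x = 0.
Proof. by move=> [l [r [/h_rel hlr ->]]]; rewrite sahomB hlr subrr. Qed.

Definition pres_lift : sahom (quot_salg rel_set) B := quot_lift free_lift_rel.

Lemma pres_lift_gen g : pres_lift (qpi rel_set (free_gen K par g)) = h g.
Proof. by rewrite [LHS](quot_lift_qpi free_lift_rel); apply: free_lift_gen. Qed.

End PresentedSuperalgebra.

(* Indices are 0-based: the paper's X_k is [X i] with [i = k - 1], and T_k is
   [T i] with [i : 'I_n.-1], whose two strands are [lo i] and [hi i]. *)

Fact lo_subproof n (i : 'I_n.-1) : (i < n)%N.
Proof. by rewrite (leq_trans (ltn_ord i)) ?leq_pred. Qed.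
Fact hi_subproof n (i : 'I_n.-1) : (i.+1 < n)%N.
Proof. by rewrite -ltn_predRL. Qed.
Definition lo n (i : 'I_n.-1) : 'I_n := Ordinal (lo_subproof i).
Definition hi n (i : 'I_n.-1) : 'I_n := Ordinal (hi_subproof i).

(* [V i] stands for X_i^{-1}, a generator of its own. *)
Inductive relA (A : pzRingType) n (X V C : 'I_n -> A) : A -> A -> Prop :=
| relXX i j : relA X V C (X i * X j) (X j * X i)
| relXV i : relA X V C (X i * V i) 1
| relVX i : relA X V C (V i * X i) 1
| relCC i : relA X V C (C i ^+ 2) 1
| relCCN (i j : 'I_n) : i != j -> relA X V C (C i * C j) (- (C j * C i))
| relXC i : relA X V C (X i * C i) (C i * V i)
| relXCj (i j : 'I_n) : i != j -> relA X V C (X i * C j) (C j * X i).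

Inductive relH (K : fieldType) (A : superalgType K) n (e : K)
    (T : 'I_n.-1 -> A) (X V C : 'I_n -> A) : A -> A -> Prop :=
| relHA l r : relA X V C l r -> relH e T X V C l r
| relTT i : relH e T X V C (T i ^+ 2) (sc e * T i + 1)
| relTTj (i j : 'I_n.-1) : (i.+1 < j)%N || (j.+1 < i)%N -> relH e T X V C (T i * T j) (T j * T i)
| relTTT (i j : 'I_n.-1) : j = i.+1 :> nat ->
    relH e T X V C (T i * T j * T i) (T j * T i * T j)
| relTX i : relH e T X V C (T i * X (lo i))
    (X (hi i) * T i - sc e * (X (hi i) + C (lo i) * C (hi i) * X (lo i)))
| relTXS i : relH e T X V C (T i * X (hi i))
    (X (lo i) * T i + sc e * ((1 - C (lo i) * C (hi i)) * X (hi i)))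
| relTXj (i : 'I_n.-1) (j : 'I_n) : j != lo i -> j != hi i -> relH e T X V C (T i * X j) (X j * T i)
| relTC i : relH e T X V C (T i * C (lo i)) (C (hi i) * T i)
| relTCS i : relH e T X V C (T i * C (hi i))
    (C (lo i) * T i - sc e * (C (lo i) - C (hi i)))
| relTCj (i : 'I_n.-1) (j : 'I_n) : j != lo i -> j != hi i -> relH e T X V C (T i * C j) (C j * T i).

Section RelationsTheory.
Variables (K : fieldType) (A : superalgType K) (n : nat) (e : K).
Variables (T : 'I_n.-1 -> A) (X V C : 'I_n -> A).
Hypotheses (hT : forall i, ahomog false (T i)) (hX : forall i, ahomog false (X i)).
Hypotheses (hV : forall i, ahomog false (V i)) (hC : forall i, ahomog true (C i)).

Let hM p s (a b : A) := @ahomogM K A p s a b.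

Lemma relA_homog l r : relA X V C l r -> exists p, ahomog p (l - r).
Proof.
case=> [i j|i|i|i|i j _|i|i j _]; [exists false..|exists true|exists true];
  rewrite ?expr2; apply: ahomogB; try exact: ahomog1; try apply: ahomogN;
  by [apply: (hM (hX _) (hX _)) | apply: (hM (hX _) (hV _))
     |apply: (hM (hV _) (hX _)) | apply: (hM (hC _) (hC _))
     |apply: (hM (hX _) (hC _)) | apply: (hM (hC _) (hV _))
     |apply: (hM (hC _) (hX _))].
Qed.

Lemma relH_homog l r : relH e T X V C l r -> exists p, ahomog p (l - r).
Proof.
have hCC i j : ahomog false (C i * C j) by apply: (hM (hC i) (hC j)).
case=> [{}l {}r /relA_homog//|i|i j _|i j _|i|i|i j _ _|i|i|i j _ _];
  [exists false..|exists true|exists true|exists true].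
- apply: ahomogB; first exact: (hM (hT _) (hT _)).
  by apply: ahomogD; [apply: ahomogZ | apply: ahomog1].
- by apply: ahomogB; apply: (hM (hT _) (hT _)).
- by apply: ahomogB; apply: (hM (hM (hT _) (hT _)) (hT _)).
- apply: ahomogB; first exact: (hM (hT _) (hX _)).
  apply: ahomogB; first exact: (hM (hX _) (hT _)).
  by apply/ahomogZ/ahomogD => //; apply: (hM (hCC _ _) (hX _)).
- apply: ahomogB; first exact: (hM (hT _) (hX _)).
  apply: ahomogD; first exact: (hM (hX _) (hT _)).
  have h1C j k : ahomog false (1 - C j * C k) by apply: ahomogB => //; apply: ahomog1.
  by apply/ahomogZ; apply: (hM (h1C _ _) (hX _)).
- by apply: ahomogB; [apply: (hM (hT _) (hX _)) | apply: (hM (hX _) (hT _))].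
- by apply: ahomogB; [apply: (hM (hT _) (hC _)) | apply: (hM (hC _) (hT _))].
- apply: ahomogB; first exact: (hM (hT _) (hC _)).
  apply: ahomogB; first exact: (hM (hC _) (hT _)).
  exact/ahomogZ/ahomogB.
- by apply: ahomogB; [apply: (hM (hT _) (hC _)) | apply: (hM (hC _) (hT _))].
Qed.

End RelationsTheory.

Inductive genA n := GX of 'I_n | GV of 'I_n | GC of 'I_n.

Definition genA_sum n (g : genA n) : 'I_n + 'I_n + 'I_n :=
  match g with GX i => inl (inl i) | GV i => inl (inr i) | GC i => inr i end.
Definition sum_genA n (s : 'I_n + 'I_n + 'I_n) : genA n :=
  match s with inl (inl i) => GX i | inl (inr i) => GV i | inr i => GC i end.
Lemma genA_sumK n : cancel (@genA_sum n) (@sum_genA n).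
Proof. by case. Qed.
HB.instance Definition _ n := Choice.copy (genA n) (can_type (@genA_sumK n)).

Definition genA_par n (g : genA n) : bool := if g is GC _ then true else false.

Inductive genH n := GT of 'I_n.-1 | GA of genA n.

Definition genH_sum n (g : genH n) : 'I_n.-1 + genA n :=
  match g with GT i => inl i | GA g => inr g end.
Definition sum_genH n (s : 'I_n.-1 + genA n) : genH n :=
  match s with inl i => GT i | inr g => GA g end.
Lemma genH_sumK n : cancel (@genH_sum n) (@sum_genH n).
Proof. by case. Qed.
HB.instance Definition _ n := Choice.copy (genH n) (can_type (@genH_sumK n)).

Definition genH_par n (g : genH n) : bool := if g is GA g then genA_par g else false.

Lemma sahom_relA (K : fieldType) (A B : superalgType K) (phi : sahom A B) k (X V C : 'I_k -> A) l r :
  relA X V C l r -> relA (phi \o X) (phi \o V) (phi \o C) (phi l) (phi r).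
Proof.
case=> [i j|i|i|i|i j ij|i|i j ij]; rewrite ?sahomN ?expr2 ?sahomM ?sahom1 -?expr2.
- exact: (relXX (phi \o X)).
- exact: (relXV (phi \o X)).
- exact: (relVX (phi \o X)).
- exact: (relCC (phi \o X) _ (phi \o C)).
- exact: (relCCN (phi \o X) _ (phi \o C)).
- exact: (relXC (phi \o X)).
- exact: (relXCj (phi \o X)).
Qed.

Lemma relA_reindex (A : pzRingType) k n (f : 'I_k -> 'I_n) (X V C : 'I_n -> A) l r :
  injective f -> relA (X \o f) (V \o f) (C \o f) l r -> relA X V C l r.
Proof.
move=> fI; have fN (i j : 'I_k) : i != j -> f i != f j by rewrite (inj_eq fI).
by case=> [i j|i|i|i|i j /fN ij|i|i j /fN ij]; constructor.
Qed.

Lemma relA_qpi (K : fieldType) (A : superalgType K) (S : homogset A) n (X V C : 'I_n -> A) :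
  (forall l r, relA X V C l r -> qpi S l = qpi S r) ->
  forall l r, relA (qpi S \o X) (qpi S \o V) (qpi S \o C) l r -> l = r.
Proof.
move=> q l r; case=> [i j|i|i|i|i j ij|i|i j ij]; rewrite /= ?expr2 -!qpiM.
- exact/q/relXX.
- exact/q/relXV.
- exact/q/relVX.
- exact/q/relCC.
- by rewrite -qpiN; apply/q/relCCN.
- exact/q/relXC.
- exact/q/relXCj.
Qed.

Section CliffordLaurent.
Variables (K : fieldType) (n : nat).

Let fA (g : genA n) := free_gen K (@genA_par n) g.

Definition relA_free := relA (fA \o @GX n) (fA \o @GV n) (fA \o @GC n).

Fact relA_free_homog l r : relA_free l r -> exists p, ahomog p (l - r).
Proof.
have h g : ahomog (genA_par g) (fA g) by apply: homog_free_gen.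
by apply: relA_homog => i; [exact (h (GX i)) | exact (h (GV i)) | exact (h (GC i))].
Qed.

(* A_n, presented by the relations among the X_i^{+-1} and C_i. [A_to_H] below
   is the map into H_Delta(n) sending generators to generators. *)
Definition Aff := quot_salg (rel_set relA_free_homog).
Definition Agen (g : genA n) : Aff := qpi _ (fA g).

Lemma Agen_homog g : ahomog (genA_par g) (Agen g).
Proof. exact/qpi_homog/homog_free_gen. Qed.

Lemma Agen_rel l r : relA (Agen \o @GX n) (Agen \o @GV n) (Agen \o @GC n) l r -> l = r.
Proof. by apply: relA_qpi; apply: qpi_rel. Qed.

End CliffordLaurent.

(* The even morphism A_k -> A_n sending X_i^{+-1}, C_i to X_(f i)^{+-1}, C_(f i). *)
Section Relabel.
Variables (K : fieldType) (k n : nat) (f : 'I_k -> 'I_n) (f_inj : injective f).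

Definition relabel_gen (g : genA k) : genA n :=
  match g with GX i => GX (f i) | GV i => GV (f i) | GC i => GC (f i) end.

Fact relabel_par g : ahomog (genA_par g) (Agen K (relabel_gen g)).
Proof. by case: g => i; [exact: (Agen_homog K (GX (f i)))
  | exact: (Agen_homog K (GV (f i))) | exact: (Agen_homog K (GC (f i)))]. Qed.

Fact relabel_rel l r : relA_free l r ->
  free_lift relabel_par l = free_lift relabel_par r.
Proof.
move=> /(sahom_relA (free_lift relabel_par)) h; apply/Agen_rel/(relA_reindex f_inj).
have E (D : 'I_k -> genA k) : free_lift relabel_par \o (free_gen K (@genA_par k) \o D)
    = @Agen K n \o relabel_gen \o D.
  apply: funext => i; exact: (free_lift_gen _ (D i)).
by rewrite !E in h.
Qed.

Definition relabel : sahom (Aff K k) (Aff K n) := pres_lift (@relA_free_homog K k) relabel_rel.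

Lemma relabel_Agen g : relabel (Agen K g) = Agen K (relabel_gen g).
Proof. exact: pres_lift_gen. Qed.

End Relabel.

Section HeckeClifford.
Variables (K : fieldType) (n : nat) (q : K).

Let fH (g : genH n) := free_gen K (@genH_par n) g.

Definition relH_free := relH (q - q^-1) (fH \o @GT n)
  (fH \o @GA n \o @GX n) (fH \o @GA n \o @GV n) (fH \o @GA n \o @GC n).

Fact relH_free_homog l r : relH_free l r -> exists p, ahomog p (l - r).
Proof.
have h g : ahomog (genH_par g) (fH g) by apply: homog_free_gen.
by apply: relH_homog => i; [exact (h (GT i)) | exact (h (GA (GX i)))
  | exact (h (GA (GV i))) | exact (h (GA (GC i)))].
Qed.

Definition HDelta := quot_salg (rel_set relH_free_homog).
Definition Hgen (g : genH n) : HDelta := qpi _ (fH g).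

Lemma Hgen_homog g : ahomog (genH_par g) (Hgen g).
Proof. exact/qpi_homog/homog_free_gen. Qed.

Let A_par (g : genA n) : ahomog (genA_par g) (Hgen (GA g)).
Proof. exact: (Hgen_homog (GA g)). Qed.

Fact A_to_H_rel l r : relA_free l r -> free_lift A_par l = free_lift A_par r.
Proof.
move=> /(sahom_relA (free_lift A_par)) h.
have E (D : 'I_n -> genA n) : free_lift A_par \o (free_gen K (@genA_par n) \o D)
    = qpi_hom (rel_set relH_free_homog) \o (fH \o @GA n \o D).
  apply: funext => i; exact: (free_lift_gen _ (D i)).
rewrite !E in h; move: h; apply: relA_qpi => {}l {}r hA.
by apply: qpi_rel; apply: relHA.
Qed.

Definition A_to_H : sahom (Aff K n) HDelta := pres_lift (@relA_free_homog K n) A_to_H_rel.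

Lemma A_to_H_Agen g : A_to_H (Agen K g) = Hgen (GA g).
Proof. exact: pres_lift_gen. Qed.

End HeckeClifford.

Section Scalars.
Variables (K : fieldType) (rt : K -> K) (q : K).

Definition qfun (x : K) : K := 2 * (q * x + (q * x)^-1) / (q + q^-1).
(* [bpm false] is b_+ and [bpm true] is b_-; [rt] is the chosen square root. *)
Definition bpm (s : bool) (x : K) : K :=
  qfun x / 2 + (-1) ^+ s * rt (qfun x ^+ 2 / 4 - 1).

End Scalars.

Inductive cyc := cyc0 | cycs | cycss.

Section Cyclotomic.
Variables (K : fieldType) (n : nat) (n_gt0 : (0 < n)%N) (q : K).
Variables (b : cyc) (m : nat) (Q : 'I_m -> K).

Let X1 : HDelta n q := Hgen q (GA (GX (Ordinal n_gt0))).
Let V1 : HDelta n q := Hgen q (GA (GV (Ordinal n_gt0))).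

Definition fcyc0 : HDelta n q := \prod_(i < m) (X1 + V1 - sc (qfun q (Q i))).
Definition fcyc : HDelta n q :=
  match b with
  | cyc0 => fcyc0
  | cycs => (X1 - 1) * fcyc0
  | cycss => (X1 + 1) * (X1 - 1) * fcyc0
  end.

Fact fcyc_homog a : a = fcyc -> exists p, ahomog p a.
Proof.
move=> ->; exists false.
have hX : ahomog false X1 by exact: (Hgen_homog q (GA (GX _))).
have hV : ahomog false V1 by exact: (Hgen_homog q (GA (GV _))).
have h1 : ahomog false (1 : HDelta n q) by exact: ahomog1.
have h0 : ahomog false fcyc0.
  by apply: ahomog_prod => i _; apply: ahomogB; [exact: ahomogD | exact: ahomog_sc].
have hB : ahomog false (X1 - 1) by exact: ahomogB.
have hD : ahomog false (X1 + 1) by exact: ahomogD.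
rewrite /fcyc; case: b => //; first exact: (ahomogM _ _ _ _ hB h0).
exact: (ahomogM _ _ _ _ (ahomogM _ _ _ _ hD hB) h0).
Qed.

Definition Hcyc := quot_salg (HomogSet fcyc_homog).
Definition H_to_Hcyc : sahom (HDelta n q) Hcyc := qpi_hom (HomogSet fcyc_homog).

End Cyclotomic.

Record smod (K : fieldType) (A : superalgType K) (V : superVectType K) := SMod {
  act :> A -> 'End(V);
  actD : {morph act : a b / a + b};
  actM : forall a b, act (a * b) = (act a \o act b)%VF;
  act_sc : forall c, act (sc c) = c *: \1%VF;
  act_homog : forall p s a v,
    ahomog p a -> homog s v -> homog (p (+) s) (act a v) }.

Section Pull.
Variables (K : fieldType) (A B : superalgType K) (phi : sahom A B).
Variables (V : superVectType K) (r : smod B V).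

Definition pull_act (a : A) : 'End(V) := r (phi a).

Fact pullD : {morph pull_act : a b / a + b}.
Proof. by move=> a b; rewrite /pull_act sahomD actD. Qed.
Fact pullM a b : pull_act (a * b) = (pull_act a \o pull_act b)%VF.
Proof. by rewrite /pull_act sahomM actM. Qed.
Fact pull_sc c : pull_act (sc c) = c *: \1%VF.
Proof. by rewrite /pull_act sahom_sc act_sc. Qed.
Fact pull_homog p s a v :
  ahomog p a -> homog s v -> homog (p (+) s) (pull_act a v).
Proof. by move=> ha hv; apply: act_homog => //; apply: sahom_homog. Qed.

Definition pull : smod A V := SMod pullD pullM pull_sc pull_homog.

End Pull.

Section DirectSum.
Variables (K : fieldType) (I : finType) (V : superVectType K).

Definition ffun_homog p (u : {ffun I -> V}) : Prop := forall i, homog p (u i).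

Fact ffun_homog_lin p c (u v : {ffun I -> V}) :
  ffun_homog p u -> ffun_homog p v -> ffun_homog p (c *: u + v).
Proof. by move=> hu hv i; rewrite !ffunE; apply: homog_lin. Qed.

Fact ffun_homog_dec (u : {ffun I -> V}) : exists u0 u1,
  [/\ ffun_homog false u0, ffun_homog true u1 & u = u0 + u1].
Proof.
have h i : exists w : V * V,
    [/\ homog false w.1, homog true w.2 & u i = w.1 + w.2].
  by have [w0 [w1 hw]] := homog_dec (u i); exists (w0, w1).
have [w hw] := choice h.
exists [ffun i => (w i).1], [ffun i => (w i).2]; split=> [i|i|].
- by rewrite ffunE; case: (hw i).
- by rewrite ffunE; case: (hw i).
- by apply/ffunP => i; rewrite !ffunE; case: (hw i).
Qed.

Fact ffun_homog_dir (u : {ffun I -> V}) :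
  ffun_homog false u -> ffun_homog true u -> u = 0.
Proof. by move=> h0 h1; apply/ffunP => i; rewrite ffunE; apply: homog_dir. Qed.

HB.instance Definition _ := isSuperspace.Build K {ffun I -> V}
  ffun_homog_lin ffun_homog_dec ffun_homog_dir.

Variables (A : superalgType K) (r : I -> smod A V).

Definition dsum_fun (a : A) (u : {ffun I -> V}) : {ffun I -> V} :=
  [ffun i => r i a (u i)].

Fact dsum_is_linear a : linear (dsum_fun a).
Proof. by move=> c u v; apply/ffunP => i; rewrite !ffunE linearP. Qed.
HB.instance Definition _ a := GRing.isLinear.Build K _ _ _ (dsum_fun a) (dsum_is_linear a).

Definition dsum_act (a : A) : 'End({ffun I -> V}) := linfun (dsum_fun a).

Fact dsumD : {morph dsum_act : a b / a + b}.
Proof.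
move=> a b; apply/lfunP => u; rewrite add_lfunE !lfunE /=.
by apply/ffunP => i; rewrite !ffunE actD add_lfunE.
Qed.
Fact dsumM a b : dsum_act (a * b) = (dsum_act a \o dsum_act b)%VF.
Proof.
apply/lfunP => u; rewrite comp_lfunE !lfunE /=.
by apply/ffunP => i; rewrite !ffunE actM comp_lfunE.
Qed.
Fact dsum_sc c : dsum_act (sc c) = c *: \1%VF.
Proof.
apply/lfunP => u; rewrite scale_lfunE id_lfunE lfunE /=.
by apply/ffunP => i; rewrite !ffunE act_sc scale_lfunE id_lfunE.
Qed.
Fact dsum_homog p s a u :
  ahomog p a -> homog s u -> homog (p (+) s) (dsum_act a u).
Proof. by move=> ha hu i; rewrite lfunE ffunE; apply: act_homog. Qed.

Definition dsum : smod A {ffun I -> V} := SMod dsumD dsumM dsum_sc dsum_homog.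

End DirectSum.

Definition Pi (K : fieldType) (V : superVectType K) : Type := V.

Section ParityShift.
Variables (K : fieldType) (V : superVectType K).

HB.instance Definition _ := Vector.on (Pi V).

Definition Pi_homog p (v : Pi V) : Prop := homog (~~ p) (v : V).

Fact Pi_homog_lin p c (u v : Pi V) :
  Pi_homog p u -> Pi_homog p v -> Pi_homog p (c *: u + v).
Proof. exact: homog_lin. Qed.
Fact Pi_homog_dec (v : Pi V) : exists v0 v1,
  [/\ Pi_homog false v0, Pi_homog true v1 & v = v0 + v1].
Proof.
have [v0 [v1 [h0 h1 ->]]] := homog_dec (v : V).
by exists v1, v0; split=> //; apply: addrC.
Qed.
Fact Pi_homog_dir (v : Pi V) : Pi_homog false v -> Pi_homog true v -> v = 0.
Proof. by move=> h1 h0; apply: (@homog_dir K V). Qed.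

HB.instance Definition _ := isSuperspace.Build K (Pi V)
  Pi_homog_lin Pi_homog_dec Pi_homog_dir.

Definition is_Pi (A : superalgType K) (r : smod A V) (r' : smod A (Pi V)) : Prop :=
  forall p a (v : V), ahomog p a -> r' a v = (-1) ^+ p *: r a v.

End ParityShift.

Section Irreducible.
Variables (K : fieldType) (A : superalgType K).
Implicit Types (V W U : superVectType K).

(* f is a homomorphism of parity p *)
Definition is_hom V W (r : smod A V) (s : smod A W) p (f : 'Hom(V, W)) : Prop :=
  (forall e v, homog e v -> homog (p (+) e) (f v)) /\
  (forall e a v, ahomog e a -> f (r a v) = (-1) ^+ (p && e) *: s a (f v)).

Definition is_endo V (r : smod A V) (f : 'End(V)) : Prop :=
  exists f0 f1, [/\ is_hom r r false f0, is_hom r r true f1 & f = f0 + f1].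

Definition endo_dim V (r : smod A V) (d : nat) : Prop :=
  exists2 E : {vspace 'End(V)}, (forall f, f \in E <-> is_endo r f) & \dim E = d.

Definition is_submod V (r : smod A V) (S : {vspace V}) : Prop :=
  (forall a v, v \in S -> r a v \in S) /\
  (forall v, v \in S -> exists v0 v1,
     [/\ v0 \in S, v1 \in S, homog false v0, homog true v1 & v = v0 + v1]).

Definition irreducible V (r : smod A V) : Prop :=
  (exists v : V, v != 0) /\
  (forall S, is_submod r S -> S = 0%VS \/ S = fullv).

Definition typeM V (r : smod A V) : Prop := irreducible r /\ endo_dim r 1.
Definition typeQ V (r : smod A V) : Prop := irreducible r /\ endo_dim r 2.

(* t is the direct sum of r and s, through even embeddings *)
Definition is_dsum2 V W U (r : smod A V) (s : smod A W) (t : smod A U) : Prop :=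
  exists (i : 'Hom(V, U)) (j : 'Hom(W, U)),
    [/\ is_hom r t false i, is_hom s t false j, lker i = 0%VS, lker j = 0%VS &
        (limg i :&: limg j = 0)%VS /\ (limg i + limg j = fullv)%VS].

End Irreducible.

Section Tensor.
Variable K : fieldType.

Definition bilin (V W U : vectType K) (t : V -> W -> U) : Prop :=
  (forall w, linear (t^~ w)) /\ (forall v, linear (t v)).

(* universal property of the tensor product, [t v w] being v (x) w *)
Definition is_tensor (V W U : vectType K) (t : V -> W -> U) : Prop :=
  bilin t /\
  forall (Z : vectType K) (f : V -> W -> Z), bilin f ->
    exists! g : 'Hom(U, Z), forall v w, g (t v w) = f v w.

Variables (A B E : superalgType K) (iA : sahom A E) (iB : sahom B E).
Variables (V W U : superVectType K).
Variables (r : smod A V) (s : smod B W) (u : smod E U).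

(* E plays the role of the tensor product of A and B, with [iA a * iB b]
   for a (x) b. *)
Definition is_boxtimes (t : V -> W -> U) : Prop :=
  [/\ is_tensor t,
      (forall e d v w, homog e v -> homog d w -> homog (e (+) d) (t v w)) &
      (forall d e a b v w, ahomog d b -> homog e v ->
         u (iA a * iB b) (t v w) = (-1) ^+ (d && e) *: t (r a v) (s b w))].

End Tensor.

Definition is_circledast (K : fieldType) (A B E : superalgType K)
    (iA : sahom A E) (iB : sahom B E) (V W U : superVectType K)
    (r : smod A V) (s : smod B W) (u : smod E U) : Prop :=
  [/\ irreducible u,
      typeQ r /\ typeQ s ->
        exists (X : superVectType K) (x : smod E X) (t : V -> W -> X)
               (u' : smod E (Pi U)),
          [/\ is_boxtimes iA iB r s x t, is_Pi u u' & is_dsum2 u u' x] &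
      ~ (typeQ r /\ typeQ s) ->
        exists t : V -> W -> U, is_boxtimes iA iB r s u t].

Section ModulesL.
Variables (K : fieldType) (rt : K -> K) (q : K).

Definition is_L1 (x : K) (V : superVectType K) (r : smod (Aff K 1) V) : Prop :=
  exists v0 v1 : V,
    [/\ basis_of fullv [:: v0; v1], homog false v0, homog true v1,
        r (Agen K (GC ord0)) v0 = v1 /\ r (Agen K (GC ord0)) v1 = v0 &
        [/\ r (Agen K (GX ord0)) v0 = bpm rt q false x *: v0,
            r (Agen K (GV ord0)) v0 = bpm rt q true x *: v0,
            r (Agen K (GX ord0)) v1 = bpm rt q true x *: v1 &
            r (Agen K (GV ord0)) v1 = bpm rt q false x *: v1]].

Fact init_inj k : injective (widen_ord (leqnSn k)).
Proof. by move=> i j /(congr1 val) /= /val_inj. Qed.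
Fact last_inj k : injective (fun _ : 'I_1 => @ord_max k).
Proof. by move=> i j _; rewrite !ord1. Qed.

(* [is_L a r]: r is a module L(a_1), .., L(a_n) combined from the left, where A_(k+1) is
   A_k (x) A_1 with A_1 on the last strand. The constructor [LS] is only
   usable with k > 0. *)
Inductive is_L :
    forall n, ('I_n -> K) -> forall V : superVectType K, smod (Aff K n) V -> Prop :=
| L1 (a : 'I_1 -> K) V (r : smod (Aff K 1) V) : is_L1 (a ord0) r -> is_L a r
| LS k (a : 'I_k.+1 -> K) V W U (r : smod (Aff K k) V) (s : smod (Aff K 1) W)
     (u : smod (Aff K k.+1) U) :
   is_L (fun i => a (widen_ord (leqnSn k) i)) r -> is_L1 (a ord_max) s ->
   is_circledast (relabel K (@init_inj k)) (relabel K (@last_inj k)) r s u ->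
   is_L a u.

End ModulesL.

Section Operators.
Variables (K : fieldType) (rt : K -> K) (q : K) (n : nat) (V : superVectType K).

(* L^tau has the underlying space of L; X_(tau k), C_(tau k) act on z^tau as X_k,
   C_k act on z, see [twist_gen]. *)
Definition twist (tau : 'S_n) (r : smod (Aff K n) V) : smod (Aff K n) V :=
  pull (relabel K (@perm_inj _ tau^-1)) r.

Lemma twist_gen (tau : 'S_n) r (g : genA n) :
  twist tau r (Agen K (relabel_gen tau g)) = r (Agen K g).
Proof.
rewrite /= /pull_act relabel_Agen; congr (r (Agen K _)).
by case: g => i /=; rewrite permK.
Qed.

Variables (r : smod (Aff K n) V) (i : 'I_n.-1).
Let e : K := q - q^-1.
Let Xi : 'End(V) := r (Agen K (GX (lo i))).
Let Xj : 'End(V) := r (Agen K (GX (hi i))).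
Let Vi : 'End(V) := r (Agen K (GV (lo i))).
Let Vj : 'End(V) := r (Agen K (GV (hi i))).
Let Ci : 'End(V) := r (Agen K (GC (lo i))).
Let Cj : 'End(V) := r (Agen K (GC (hi i))).

(* [f^-1%VF] is the inverse of f when f is bijective. *)
Local Notation id := (\1%VF : 'End(V)).
Local Notation "f ** g" := (f \o g)%VF (at level 40, left associativity).
Local Notation inv f := (f^-1)%VF.

Definition Xi_op : 'End(V) :=
  - (e *: inv (Xi ** Vj - id)) + e *: (inv (Xi ** Xj - id) ** (Ci ** Cj)).

Definition Omega_radicand : 'End(V) :=
  let frac (Y : 'End(V)) := Y ** inv ((Y - id) ** (Y - id)) in
  id - e ^+ 2 *: (frac (Xi ** Vj) + frac (Vi ** Vj)).

(* the scalar c with f = c id, if there is one *)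
Definition scalar_of (f : 'End(V)) : K :=
  match pselect (exists c, f == c *: \1%VF) with
  | left ex => xchoose ex
  | right _ => 0
  end.

(* the scalar by which the operator Omega~_i acts *)
Definition Omega : K := rt (scalar_of Omega_radicand).

End Operators.

Definition is_part (s : seq nat) : bool := sorted geq s && (0%N \notin s).
Definition is_strict_part (s : seq nat) : bool := sorted gtn s && (0%N \notin s).

Definition nstrict (b : cyc) : nat :=
  match b with cyc0 => 0%N | cycs => 1%N | cycss => 2%N end.

(* Labels of the components: [inl] for the strict ones (0, resp. 0_-, 0_+, in
   this order), [inr] for the ordinary ones. *)
Definition label (b : cyc) (m : nat) : Type := ('I_(nstrict b) + 'I_m)%type.

Section Tableaux.
Variables (b : cyc) (m n : nat).
Local Notation label := (label b m).

Definition labels : seq label :=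
  [seq inl k | k <- enum 'I_(nstrict b)] ++ [seq inr k | k <- enum 'I_m].

Definition is_mpart (lam : label -> seq nat) : bool :=
  [&& [forall k, is_strict_part (lam (inl k))],
      [forall k, is_part (lam (inr k))]
    & (\sum_(c <- labels) sumn (lam c))%N == n].

Definition box : Type := (nat * nat * label)%type.

Record mpart := MPart {
  mpart_val :> label -> seq nat;
  mpart_ok : is_mpart mpart_val }.

Variable lam : mpart.

Definition row_start (c : label) (i : nat) : nat := if c is inl _ then i else 0%N.

(* boxes (i, j, c) in reading order, rows and columns counted from 0 *)
Definition boxes : seq box :=
  flatten [seq flatten [seq [seq (i, j, c)
                            | j <- iota (row_start c i) (nth 0%N (lam c) i)]
                       | i <- iota 0 (size (lam c))]
          | c <- labels].

Lemma size_boxes : size boxes = n.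
Proof.
have /and3P[_ _ /eqP e] := mpart_ok lam; rewrite -[RHS]e.
rewrite size_flatten /shape -map_comp sumnE big_map; apply: eq_bigr => c _ /=.
rewrite size_flatten /shape -map_comp sumnE big_map sumnE.
rewrite [RHS](big_nth 0%N) /index_iota subn0; apply: eq_bigr => i _ /=.
by rewrite size_map size_iota.
Qed.

(* A tableau is given by the box containing each entry. *)
Definition tableau : Type := 'I_n -> box.

Definition is_std (t : tableau) : Prop :=
  [/\ injective t,
      forall x : box, x \in boxes <-> exists k, t k = x &
      forall k l : 'I_n, (t k).2 = (t l).2 ->
        ((t k).1.1 = (t l).1.1 /\ ((t k).1.2 < (t l).1.2)%N) \/
        ((t k).1.2 = (t l).1.2 /\ ((t k).1.1 < (t l).1.1)%N) ->
        (k < l)%N].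

(* Place permutation: entry k of [pact tau s] is entry tau^-1(k) of s; on a
   tableau this replaces every entry k by tau(k). *)
Definition pact (T : Type) (tau : 'S_n) (s : 'I_n -> T) : 'I_n -> T :=
  fun k => s (tau^-1 k)%g.

Definition s_ (i : 'I_n.-1) : 'S_n := tperm (lo i) (hi i).

(* Permutations are multiplied from left to right in the library:
   [(s * t)%g k = t (s k)]. *)
Definition pmul (s t : 'S_n) : 'S_n := (t * s)%g.

Definition t_lam : tableau :=
  fun k => tnth (Tuple (introT eqP size_boxes)) k.

Inductive in_P : 'S_n -> Prop :=
| in_P1 : in_P 1%g
| in_PS (tau : 'S_n) (i : 'I_n.-1) :
    in_P tau -> is_std (pact (s_ i) (pact tau t_lam)) -> in_P (pmul (s_ i) tau).

Definition P_set : {set 'S_n} := [set tau | `[< in_P tau >]].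

Section Residues.
Variables (K : fieldType) (q : K) (Q : 'I_m -> K).

Definition Q_label (c : label) : K :=
  match c with
  | inl k => match b with cycss => if (k : nat) == 0%N then -1 else 1 | _ => 1 end
  | inr k => Q k
  end.

Definition box_res (x : box) : K :=
  Q_label x.2 * q ^ (2 * (x.1.2%:Z - x.1.1%:Z)).

Definition res (t : tableau) : 'I_n -> K := fun k => box_res (t k).

Definition admissible (tau : 'S_n) (i : 'I_n.-1) : Prop :=
  exists2 u : tableau, is_std u &
    forall k, pact (s_ i) (fun j => qfun q (res (pact tau t_lam) j)) k
              = qfun q (res u k).

End Residues.

End Tableaux.

(* a, a + 1, .., c (empty if c < a) *)
Definition zrange (a c : int) : seq int :=
  if (a <= c)%R then [seq a + k%:Z | k <- iota 0 `|c - a|.+1] else [::].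

Section PolynomialP.
Variables (K : fieldType) (n : nat) (q : K) (m : nat) (Q : 'I_m -> K).

Definition Rpoly : K :=
  (\prod_(i < m)
     ((\prod_(t <- zrange (3 - n%:Z) (n%:Z - 1)) (Q i ^+ 2 - q ^ (- 2 * t))) *
      (\prod_(t <- zrange (1 - n%:Z) n%:Z) (Q i ^+ 2 - q ^ (- 4 * t))))) *
  (\prod_(i < m) \prod_(i' < m | (i < i')%N)
     \prod_(t <- zrange (1 - n%:Z) (n%:Z - 1))
       ((Q i - Q i' * q ^ (- 2 * t)) * (Q i * Q i' - q ^ (- 2 * (t + 1))))).

Definition Ppoly (b : cyc) : K :=
  match b with
  | cyc0 => (\prod_(1 <= t < n.+1) (q ^+ (2 * t) - 1)) * Rpoly
  | _ => (\prod_(1 <= t < n.+1) ((q ^+ (2 * t) - 1) * (q ^+ (2 * t) + 1))) * Rpoly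
  end.

End PolynomialP.

Section ModuleD.
Variables (K : fieldType) (b : cyc) (m n : nat) (lam : mpart b m n).
Variables (V : superVectType K) (L : smod (Aff K n) V).

Definition P_index : finType := {tau : 'S_n | tau \in P_set lam}.

Definition D_space : superVectType K := {ffun P_index -> V}.

Definition D_mod : smod (Aff K n) D_space :=
  dsum (fun tau : P_index => twist (val tau) L).

(* z^tau, as an element of the summand of index tau *)
Definition in_summand (tau : 'S_n) (z : V) : D_space :=
  [ffun sigma : P_index => if val sigma == tau then z else 0].

End ModuleD.

(* Main.v *)
(** The operators are packaged as T_i z^tau = xi_pq z^tau + om_pq z^(s_i tau), where
    p = tau^-1(i), q = tau^-1(i+1) and xi_pq, om_pq live on the single A_n-module L, so
    that every relation becomes an identity in End(L) between a few strands.  On L the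
    element X_k + X_k^-1 is a scalar a_k, and xi_pq = eps / (a_p - a_q) N_pq with
    N_pq = X_p^-1 - X_q + (X_q^-1 - X_p^-1) C_p C_q polynomial in the generators; the
    identities between the N_pq hold unconditionally and are checked on joint eigenvectors
    of the X_k.  Since om_pq^2 = 1 - eps^2 (a_p a_q - 4) / (a_p - a_q)^2 vanishes when the
    boxes of i and i+1 are adjacent, the formula needs no case distinction.  In the braid
    relation the strands 1 and 3 may have a_1 = a_3; then both steps are inadmissible and
    what remains is (a_2^3 - a_1 a_2 a_3 + 4 (a_1 + a_3) - 8 a_2) N_13 = 0: the scalar
    vanishes for three boxes in a row or column, and N_13 = 0 at the diagonal of a shifted
    diagram, where X_1 = X_3 = +-1.  The non-vanishing of P_n(q^2, Q) enters through the
    separation of the values q(res) of two boxes in different components, of adjacent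
    boxes, and of boxes strictly north-east of each other. *)

(* The irreducible component in [is_circledast] is never made explicit: what passes to it without
   choices is the action of even elements by scalars, and [L_spec] collects the two such facts that
   suffice. The denominators come from (x/y - 1)(y - 1/x) = (xy - 1)(1/y - 1/x) = (x + 1/x) - (y +
   1/y), so that a_p <> a_q makes both inverses in [Xi_op] exist. Relations are checked on z^tau for
   tau in P(lambda), but an intermediate s_k tau may leave P(lambda). Since om vanishes across the
   boundary of P(lambda), T_k obeys one formula for all permutations tau, with z^tau = 0 outside
   P(lambda). Admissibility is stated through residues and has to be turned into standardness of s_i
   tau t^lambda; this rests on the fact that the values q(res) determine a standard tableau. *)
From HB Require Import structures.
From mathcomp Require Import all_boot all_order all_algebra all_fingroup.
From mathcomp Require Import ring zify.
From mathcomp Require Import generic_quotient boolp monalg.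
Require Import Defs.

Set Implicit Arguments.
Unset Strict Implicit.
Unset Printing Implicit Defensive.

Import GRing.Theory.
Local Open Scope ring_scope.

(** * The superalgebra of endomorphisms *)

(* An alias carrying a ring structure that does not require [V] to be nonzero. *)
Definition endo (K : fieldType) (V : superVectType K) : Type := 'End(V).

Section EndoSuperalgebra.
Variables (K : fieldType) (V : superVectType K).
Local Notation E := (endo V).

HB.instance Definition _ := GRing.Zmodule.on E.

Definition endo_mul (f g : E) : E := (f \o g)%VF.

Fact endo_mulA : associative endo_mul.
Proof. by move=> f g h; apply: comp_lfunA. Qed.
Fact endo_mul1 : left_id (\1%VF : E) endo_mul.
Proof. by move=> f; apply: comp_lfun1l. Qed.
Fact endo_mulr1 : right_id (\1%VF : E) endo_mul.
Proof. by move=> f; apply: comp_lfun1r. Qed.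
Fact endo_mulDl : left_distributive endo_mul +%R.
Proof. by move=> f g h; apply: comp_lfunDl. Qed.
Fact endo_mulDr : right_distributive endo_mul +%R.
Proof. by move=> f g h; apply: comp_lfunDr. Qed.

HB.instance Definition _ := GRing.Zmodule_isPzRing.Build E
  endo_mulA endo_mul1 endo_mulr1 endo_mulDl endo_mulDr.

Lemma endoME (f g : E) (v : V) : (f * g) v = f (g v).
Proof. exact: comp_lfunE. Qed.
Lemma endo1E (v : V) : (1 : E) v = v.
Proof. exact: id_lfunE. Qed.
Lemma endoDE (f g : E) (v : V) : (f + g) v = f v + g v.
Proof. exact: add_lfunE. Qed.
Lemma endoNE (f : E) (v : V) : (- f) v = - f v.
Proof. exact: opp_lfunE. Qed.
Lemma endo0E (v : V) : (0 : E) v = 0.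
Proof. exact: zero_lfunE. Qed.

Lemma endoP (f g : E) : (forall v : V, f v = g v) -> f = g.
Proof. by move=> h; apply/lfunP. Qed.

Definition endo_sc (c : K) : E := c *: (\1%VF : 'End(V)).
Lemma endo_scE c (v : V) : endo_sc c v = c *: v.
Proof. by rewrite /endo_sc scale_lfunE id_lfunE. Qed.

Fact endo_sc_zmod : zmod_morphism endo_sc.
Proof. by move=> c d; apply: endoP => v; rewrite endoDE endoNE !endo_scE scalerBl. Qed.
Fact endo_sc_monoid : monoid_morphism endo_sc.
Proof.
split=> [|c d]; apply: endoP => v; rewrite ?endoME ?endo_scE ?endo1E ?scale1r //.
by rewrite scalerA.
Qed.
Fact endo_scC c f : endo_sc c * f = f * endo_sc c.
Proof. by apply: endoP => v; rewrite !endoME !endo_scE linearZ. Qed.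

Definition endo_homog p (f : E) : Prop :=
  forall e (v : V), homog e v -> homog (p (+) e) (f v).

Lemma homog_uniq (u0 u1 w0 w1 : V) :
  homog false u0 -> homog true u1 -> homog false w0 -> homog true w1 ->
  u0 + u1 = w0 + w1 -> u0 = w0 /\ u1 = w1.
Proof.
have hB p (x y : V) : homog p x -> homog p y -> homog p (x - y).
  by move=> hx hy; rewrite addrC -scaleN1r; apply: homog_lin.
move=> hu0 hu1 hw0 hw1 e.
have e' : u0 - w0 = w1 - u1.
  by apply/eqP; rewrite subr_eq addrAC eq_sym subr_eq addrC e addrC.
have z : u0 - w0 = 0 by apply: homog_dir; [|rewrite e']; apply: hB.
split; apply/eqP; rewrite -subr_eq0 ?z //.
by rewrite -opprB -e' z oppr0.
Qed.

Lemma homog0 p : homog p (0 : V).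
Proof.
have [v0 [v1 [h0 h1 _]]] := homog_dec (0 : V).
by case: p; [have := homog_lin _ (-1) _ _ h1 h1 | have := homog_lin _ (-1) _ _ h0 h0];
   rewrite scaleN1r addNr.
Qed.

Lemma homogZ p c (v : V) : homog p v -> homog p (c *: v).
Proof. by move=> h; rewrite -[_ *: _]addr0; apply/homog_lin/homog0. Qed.

Lemma homogD p (u v : V) : homog p u -> homog p v -> homog p (u + v).
Proof. by move=> hu hv; rewrite -[u]scale1r; apply: homog_lin. Qed.

(** By uniqueness of the decomposition, the components picked by choice depend linearly on the
    vector. *)
Lemma homog_proj : exists P : bool -> E,
  (forall p v, homog p (P p v)) /\ forall v : V, v = P false v + P true v.
Proof.
have h (v : V) : exists w : bool -> V,
    (forall p, homog p (w p)) /\ v = w false + w true.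
  have [v0 [v1 [h0 h1 e]]] := homog_dec v.
  by exists (fun p => if p then v1 else v0); split=> // -[].
have [w hw] := choice h.
have wlin p : linear (fun v => w v p).
  move=> c u v.
  have [[hu eu] [hv ev]] := (hw u, hw v); have [huv euv] := hw (c *: u + v).
  suff [h0 h1] : w (c *: u + v) false = c *: w u false + w v false /\
      w (c *: u + v) true = c *: w u true + w v true.
    by case: p.
  apply: homog_uniq => //; try exact: homog_lin.
  by rewrite -euv {1}eu {1}ev scalerDr addrACA.
pose L p := GRing.isLinear.Build K V V _ (fun v => w v p) (wlin p).
pose P p : {linear V -> V} := HB.pack (fun v => w v p) (L p).
exists (fun p => linfun (P p)); split=> [p v|v]; rewrite !lfunE /=.
  by case: (hw v).
by case: (hw v).
Qed.

Fact endo_homog_lin p c (f g : E) :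
  endo_homog p f -> endo_homog p g -> endo_homog p (endo_sc c * f + g).
Proof.
move=> hf hg e v hv; rewrite endoDE endoME endo_scE.
by apply: homog_lin; [apply: hf | apply: hg].
Qed.

(** With P_0, P_1 the projections, the even part is P_0 f P_0 + P_1 f P_1 and the odd part is P_1 f
    P_0 + P_0 f P_1. *)
Fact endo_homog_dec (f : E) : exists f0 f1,
  [/\ endo_homog false f0, endo_homog true f1 & f = f0 + f1].
Proof.
have [P [hP eP]] := homog_proj.
have Pe e v : homog e v -> P e v = v /\ P (~~ e) v = 0.
  move=> hv; have := eP v; case: e hv => hv ev.
    have [] := homog_uniq (homog0 false) hv (hP false v) (hP true v) _.
      by rewrite add0r.
    by move=> e0 e1; split.
  have [] := homog_uniq hv (homog0 true) (hP false v) (hP true v) _.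
    by rewrite addr0.
  by move=> e0 e1; split.
exists (P false * f * P false + P true * f * P true : E).
exists (P true * f * P false + P false * f * P true : E); split.
- move=> e v /Pe[h1 h0]; rewrite endoDE !endoME.
  by case: e h1 h0 => /= -> ->; rewrite !linear0 ?add0r ?addr0.
- move=> e v /Pe[h1 h0]; rewrite endoDE !endoME.
  by case: e h1 h0 => /= -> ->; rewrite !linear0 ?add0r ?addr0.
- apply: endoP => v; rewrite !endoDE !endoME.
  rewrite addrACA -addrA [X in _ = _ + (_ + X)]addrC -!eP addrA -eP.
  by rewrite -linearD -eP.
Qed.

Fact endo_homog_dir f : endo_homog false f -> endo_homog true f -> f = 0.
Proof.
move=> h0 h1; apply: endoP => v; rewrite endo0E.
have [v0 [v1 [hv0 hv1 ->]]] := homog_dec v.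
rewrite linearD /= (homog_dir _ (h0 _ _ hv0) (h1 _ _ hv0)).
by rewrite (homog_dir _ (h1 _ _ hv1) (h0 _ _ hv1)) addr0.
Qed.

Fact endo_homog1 : endo_homog false (1 : E).
Proof. by move=> e v; rewrite endo1E. Qed.

Fact endo_homogM p s f g :
  endo_homog p f -> endo_homog s g -> endo_homog (p (+) s) (f * g).
Proof. by move=> hf hg e v hv; rewrite endoME -addbA; apply/hf/hg. Qed.

HB.instance Definition _ := isSuperalgebra.Build K E
  endo_sc_zmod endo_sc_monoid endo_scC endo_homog_lin endo_homog_dec
  endo_homog_dir endo_homog1 endo_homogM.

Section SmodOfHom.
Variables (A : superalgType K) (phi : sahom A E).

Fact smod_of_homM a b : phi (a * b) = ((phi a : 'End(V)) \o phi b)%VF.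
Proof. exact: sahomM. Qed.
Fact smod_of_hom_sc c : phi (sc c) = c *: (\1%VF : 'End(V)).
Proof. exact: sahom_sc. Qed.
Fact smod_of_hom_homog p s a (v : V) :
  ahomog p a -> homog s v -> homog (p (+) s) ((phi a : 'End(V)) v).
Proof. by move=> ha; apply: (sahom_homog phi ha). Qed.

Definition smod_of_hom : smod A V :=
  @SMod K A V phi (sahomD phi) smod_of_homM smod_of_hom_sc smod_of_hom_homog.

End SmodOfHom.

Section HomOfSmod.
Variables (A : superalgType K) (r : smod A V).
Fact hom_of_smod_homog p a : ahomog p a -> ahomog p (r a : E).
Proof. by move=> ha s v; apply: act_homog. Qed.
Definition hom_of_smod : sahom A E :=
  @SAHom K A E r (actD r) (actM r) (act_sc r) hom_of_smod_homog.
End HomOfSmod.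

End EndoSuperalgebra.

(** * Morphisms determined by their values on generators *)

Section HomUniqueness.
Variables (K : fieldType).

Lemma sahom_sum (A B : superalgType K) (phi : sahom A B) I (r : seq I) (F : I -> A) :
  phi (\sum_(i <- r) F i) = \sum_(i <- r) phi (F i).
Proof. exact: (big_morph _ (sahomD phi) (sahom0 phi)). Qed.

Lemma sahom_prod (A B : superalgType K) (phi : sahom A B) I (r : seq I) (F : I -> A) :
  phi (\prod_(i <- r) F i) = \prod_(i <- r) phi (F i).
Proof. exact: (big_morph _ (sahomM phi) (sahom1 phi)). Qed.

Lemma free_salg_ext (G : choiceType) (par : G -> bool) (B : superalgType K)
    (phi psi : sahom (free_salg K par) B) :
  (forall g, phi (free_gen K par g) = psi (free_gen K par g)) ->
  forall x, phi x = psi x.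
Proof.
move=> h x; rewrite [x](monalgE x) !sahom_sum; apply: eq_bigr => w _.
have -> : (<< x@_w *g w >> : free_salg K par) =
    sc (x@_w) * \prod_(g <- (w : seq G)) free_gen K par g.
  have -> : << x@_w *g w >> = (sc (x@_w) : free_salg K par) * << 1 *g w >>.
    by rewrite free_mulUU mulr1 mul1m.
  congr (_ * _); move: w => [s] /=.
  elim: s => [|g s IHs]; first by rewrite big_nil -fmoneE.
  rewrite big_cons -IHs free_mulUU mulr1.
  by congr << _ *g _ >>; rewrite [mmul _ _]fmmulE fmuE.
rewrite !sahomM !sahom_sc !sahom_prod; congr (_ * _).
by apply: eq_bigr => g _.
Qed.

(** Serves to compare, on all of A_n, the restriction of the action of H_Delta(n) with [D_mod], once
    they agree on generators. *)
Lemma Aff_ext n (B : superalgType K) (phi psi : sahom (Aff K n) B) :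
  (forall g, phi (Agen K g) = psi (Agen K g)) -> forall x, phi x = psi x.
Proof.
move=> h x; rewrite -(qpi_repr x); move: (repr x) => y.
pose comp (f : sahom (Aff K n) B) : sahom (free_salg K (@genA_par n)) B :=
  @SAHom K _ _ (f \o qpi _)
   (fun a b => etrans (congr1 f (qpiD _ a b)) (sahomD f _ _))
   (fun a b => etrans (congr1 f (qpiM _ a b)) (sahomM f _ _))
   (fun c => sahom_sc f c)
   (fun p a ha => sahom_homog f (qpi_homog _ ha)).
exact: (@free_salg_ext _ _ B (comp phi) (comp psi) h).
Qed.

End HomUniqueness.

(** * Scalars acting on L *)

Section Scalars.
Variables (K : fieldType).

Lemma act1 (A : superalgType K) (V : superVectType K) (r : smod A V) v : r 1 v = v.
Proof. by rewrite -(rmorph1 (@sc K A)) act_sc scale1r id_lfunE. Qed.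

Definition acts_by (A : superalgType K) (V : superVectType K) (r : smod A V) a c :=
  forall v, r a v = c *: v.

(** The first embedding is even, hence introduces no sign, and injective, hence reflects the
    scalar. *)
Lemma dsum2_actl (A : superalgType K) (V W U : superVectType K)
    (r : smod A V) (s : smod A W) (x : smod A U) a c :
  is_dsum2 r s x -> ahomog false a -> acts_by x a c -> acts_by r a c.
Proof.
move=> [i [j [[_ hi] _ /eqP/lker0P inji _ _]]] ha hx v.
apply: inji; have := hi false a v ha; rewrite /= expr0 scale1r => ->.
by rewrite hx linearZ.
Qed.

Variables (A B E : superalgType K) (iA : sahom A E) (iB : sahom B E).
Variables (V W U : superVectType K).

Lemma linear_fun (X Y : lmodType K) (f : X -> Y) : linear f ->
  (forall c x, f (c *: x) = c *: f x) /\ {morph f : x y / x + y}.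
Proof.
move=> lf; have fD : {morph f : x y / x + y}.
  by move=> x y; have := lf 1 x y; rewrite !scale1r.
split=> // c x; have := lf c x 0; rewrite !addr0 => ->.
have := fD 0 0; rewrite addr0 => /eqP; rewrite -[X in X == _]addr0.
by rewrite (inj_eq (addrI _)) eq_sym => /eqP ->; rewrite addr0.
Qed.

Lemma tensor_ext (X : superVectType K) (t : V -> W -> X) (f g : 'End(X)) :
  is_tensor t -> (forall v w, f (t v w) = g (t v w)) -> f = g.
Proof.
move=> [[tl tr] tu] fg.
have gt : bilin (fun v w => g (t v w)).
  by split=> [w|v] c x y; [rewrite tl | rewrite tr]; rewrite linearP.
by have [h [_ hu]] := tu X _ gt; rewrite -(hu f fg) -(hu g).
Qed.

(** Taking b = 1 in the tensor action removes the sign; that action is given for homogeneous v only,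
    whence the splitting of v. *)
Lemma boxtimes_actl (r : smod A V) (s : smod B W) (x : smod E U) t a c :
  is_boxtimes iA iB r s x t -> acts_by r a c -> acts_by x (iA a) c.
Proof.
move=> [tt _ tx] ra.
suff e : x (iA a) = c *: \1%VF by move=> v; rewrite e scale_lfunE id_lfunE.
apply: (tensor_ext tt) => v w; rewrite scale_lfunE id_lfunE.
have [[tl _] _] := tt.
have h e v' : homog e v' -> x (iA a) (t v' w) = c *: t v' w.
  move=> hv; have := tx false e a 1 v' w ahomog1 hv.
  rewrite expr0 scale1r act1 (sahom1 iB) mulr1 => ->.
  by rewrite ra (linear_fun (tl w)).1.
have [v0 [v1 [h0 h1 ->]]] := homog_dec v.
have -> : t (v0 + v1) w = t v0 w + t v1 w by exact: (linear_fun (tl w)).2.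
by rewrite linearD /= (h _ _ h0) (h _ _ h1) scalerDr.
Qed.

(** Here the sign involves the parity of b, and evenness makes it trivial. *)
Lemma boxtimes_actr (r : smod A V) (s : smod B W) (x : smod E U) t b c :
  ahomog false b ->
  is_boxtimes iA iB r s x t -> acts_by s b c -> acts_by x (iB b) c.
Proof.
move=> hb [tt _ tx] sb.
suff e : x (iB b) = c *: \1%VF by move=> v; rewrite e scale_lfunE id_lfunE.
apply: (tensor_ext tt) => v w; rewrite scale_lfunE id_lfunE.
have [[tl tr] _] := tt.
have h e v' : homog e v' -> x (iB b) (t v' w) = c *: t v' w.
  move=> hv; have := tx false e 1 b v' w hb hv.
  rewrite expr0 scale1r act1 (sahom1 iA) mul1r => ->.
  by rewrite sb (linear_fun (tr v')).1.
have [v0 [v1 [h0 h1 ->]]] := homog_dec v.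
have -> : t (v0 + v1) w = t v0 w + t v1 w by exact: (linear_fun (tl w)).2.
by rewrite linearD /= (h _ _ h0) (h _ _ h1) scalerDr.
Qed.

End Scalars.

Section Circledast.
Variables (K : fieldType) (A B E : superalgType K).
Variables (iA : sahom A E) (iB : sahom B E) (V W U : superVectType K).

Lemma circledast_actl (r : smod A V) (s : smod B W) (u : smod E U) a c :
  is_circledast iA iB r s u -> ahomog false a -> acts_by r a c ->
  acts_by u (iA a) c.
Proof.
move=> [_ hQ hM] ha ra; case: (pselect (typeQ r /\ typeQ s)) => h.
  have [X [x [t [u' [hx _ hd]]]]] := hQ h.
  exact: (dsum2_actl hd (sahom_homog iA ha) (boxtimes_actl hx ra)).
by have [t ht] := hM h; apply: (boxtimes_actl ht).
Qed.

Lemma circledast_actr (r : smod A V) (s : smod B W) (u : smod E U) b c :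
  is_circledast iA iB r s u -> ahomog false b -> acts_by s b c ->
  acts_by u (iB b) c.
Proof.
move=> [_ hQ hM] hb sb; case: (pselect (typeQ r /\ typeQ s)) => h.
  have [X [x [t [u' [hx _ hd]]]]] := hQ h.
  exact: (dsum2_actl hd (sahom_homog iB hb) (boxtimes_actr hb hx sb)).
by have [t ht] := hM h; apply: (boxtimes_actr hb ht).
Qed.

End Circledast.

Lemma rt0 (K : fieldType) (rt : K -> K) : (forall a, rt a ^+ 2 = a) -> rt 0 = 0.
Proof. by move=> rtP; apply/eqP; rewrite -sqrf_eq0 rtP. Qed.

Section ModuleL.
Variables (K : fieldType) (two_neq0 : 2 != 0 :> K).
Variables (rt : K -> K) (rtP : forall a : K, rt a ^+ 2 = a) (q : K).

(** All that is retained of L(a). The first clause alone would allow (X_i - s)^2 = 0 with X_i <> s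
    when b_+ and b_- coincide; the second rules this out. *)
Definition L_spec n (a : 'I_n -> K) (V : superVectType K) (r : smod (Aff K n) V) :=
  forall i, acts_by r (Agen K (GX i) + Agen K (GV i)) (qfun q (a i)) /\
    (forall s, s ^+ 2 = 1 -> qfun q (a i) = 2 * s -> acts_by r (Agen K (GX i)) s).

Lemma lfun_comb (U W : vectType K) (f : 'Hom(U, W)) c d u v :
  f (c *: u + d *: v) = c *: f u + d *: f v.
Proof. by rewrite linearP linearZ. Qed.

Lemma bpmD x : bpm rt q false x + bpm rt q true x = qfun q x.
Proof.
rewrite /bpm expr0 expr1 mul1r mulN1r addrACA subrr addr0.
by rewrite -mulrDl -mulr2n -(mulr_natr (qfun q x)) mulfK // two_neq0.
Qed.

Lemma is_L1_spec (a : 'I_1 -> K) V (r : smod (Aff K 1) V) :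
  is_L1 rt q (a ord0) r -> L_spec a r /\ exists v : V, v != 0.
Proof.
move=> [v0 [v1 [bas _ _ _ [X0 V0 X1 V1]]]].
have span v : exists c0 c1, v = c0 *: v0 + c1 *: v1.
  have : v \in <<[:: v0; v1]>>%VS by rewrite (span_basis bas) memvf.
  rewrite span_cons span_seq1 => /memv_addP[_ /vlineP[c ->] [_ /vlineP[d ->] ->]].
  by exists c, d.
split; last first.
  by exists v0; apply: free_not0 (basis_free bas) (mem_head v0 [:: v1]).
move=> i; rewrite (ord1 i); split=> [v|s s1 qs v].
  have [c [d ->]] := span v; rewrite actD add_lfunE !lfun_comb.
  rewrite X0 V0 X1 V1 scalerDr !scalerA addrACA -!scalerDl.
  by congr (_ *: _ + _ *: _); rewrite -mulrDr 1?(addrC (bpm _ _ true _)) bpmD mulrC.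
(* The radicand q(x)^2 / 4 - 1 vanishes, so b_+ = b_- = s. *)
have bs p : bpm rt q p (a ord0) = s.
  rewrite /bpm qs; have -> : (2 * s) ^+ 2 / 4 - 1 = 0.
    have -> : (2 * s) ^+ 2 / 4 = s ^+ 2.
      rewrite (_ : 4 = 2 ^+ 2) ?exprMn 1?mulrC ?mulKf ?expf_eq0 //.
      by rewrite -natrX.
    by rewrite s1 subrr.
  by rewrite (rt0 rtP) mulr0 addr0 mulrC mulKf.
have [c [d ->]] := span v; rewrite lfun_comb X0 X1 !bs.
by rewrite scalerDr !scalerA !(mulrC s).
Qed.

(** Scalars on a factor survive [is_circledast], whether all or half of the tensor product is kept;
    in the inductive step the nonzero vector comes from irreducibility. *)
Lemma is_L_spec n (a : 'I_n -> K) V (r : smod (Aff K n) V) :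
  is_L rt q a r -> L_spec a r /\ exists v : V, v != 0.
Proof.
elim=> {n a V r} [a V r|k a V W U r s u _ [IH _] h circ].
  exact: is_L1_spec.
have [{}h _] := is_L1_spec (a := fun=> a ord_max) h.
split; last by case: circ => [[]].
have XV n i : ahomog false (Agen K (@GX n i) + Agen K (GV i)).
  by apply: ahomogD; [exact: (Agen_homog K (GX i)) | exact: (Agen_homog K (GV i))].
have XX n i : ahomog false (Agen K (@GX n i)) by exact: (Agen_homog K (GX i)).
move=> i; case: (unliftP ord_max i) => [j ->|->].
  have -> : lift ord_max j = widen_ord (leqnSn k) j.
    by apply: val_inj; rewrite /= /bump leqNgt ltn_ord.
  have [h1 h2] := IH j; split.
    have := circledast_actl circ (XV _ j) h1.
    by rewrite sahomD !relabel_Agen.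
  move=> c c1 qc; have := circledast_actl circ (XX _ j) (h2 c c1 qc).
  by rewrite relabel_Agen.
have [h1 h2] := h ord0; split.
  have := circledast_actr circ (XV _ ord0) h1.
  by rewrite sahomD !relabel_Agen.
move=> c c1 qc; have := circledast_actr circ (XX _ ord0) (h2 c c1 qc).
by rewrite relabel_Agen.
Qed.

End ModuleL.

(** * Identities between strands *)

Section Strands.
Variables (K : fieldType) (two_neq0 : 2 != 0 :> K).
Variables (rt : K -> K) (rtP : forall a : K, rt a ^+ 2 = a).
Variables (n : nat) (V : vectType K) (X Y C : 'I_n -> 'End(V)) (a : 'I_n -> K).
Implicit Types (i j k l : 'I_n) (v w : V) (x : 'I_n -> K).

(* [Y] stands for the inverses of [X]; the last field makes [X i] semisimple also when the
   two roots of [t + t^-1 = a i] coincide. *)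
Record strand_rel : Prop := StrandRel {
  sXX : forall i j v, X i (X j v) = X j (X i v);
  sYX : forall i v, Y i (X i v) = v;
  sCC : forall i v, C i (C i v) = v;
  sCCN : forall i j v, i != j -> C i (C j v) = - C j (C i v);
  sXC : forall i v, X i (C i v) = C i (Y i v);
  sXCj : forall i j v, i != j -> X i (C j v) = C j (X i v);
  sXaY : forall i v, X i v + Y i v = a i *: v;
  sXa : forall i s v, s ^+ 2 = 1 -> a i = 2 * s -> X i v = s *: v }.

Hypothesis rel : strand_rel.
Let XX := sXX rel.
Let YX := sYX rel.
Let CC := sCC rel.
Let CCN := sCCN rel.
Let XC := sXC rel.
Let XCj := sXCj rel.
Let XaY := sXaY rel.
Let Xa := sXa rel.

(** The last conjunct expresses [a i] through the eigenvalue, so that identities between strands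
    become identities of rational functions. The vector may be 0. *)
Definition eig1 i (c : K) v := [/\ c != 0, X i v = c *: v & a i = c + c^-1].
Definition eig x v := forall i, eig1 i (x i) v.

Lemma eig_Y x v i : eig x v -> Y i v = (x i)^-1 *: v.
Proof.
move=> /(_ i)[h e _]; have := YX i v; rewrite e linearZ /=.
by move/(congr1 ( *:%R (x i)^-1)); rewrite scalerA mulVf // scale1r.
Qed.

(** X_i is a root of t^2 - a_i t + 1 = (t - c)(t - d). If c <> d, the components are (X_i - d) v /
    (c - d) and (X_i - c) v / (d - c), and the other eigenvalues persist because the X_j commute; if
    c = d, [sXa] makes v itself an eigenvector. *)
Lemma eig_split i v : exists c d v0 v1,
  [/\ eig1 i c v0, eig1 i d v1, v = v0 + v1 &
      forall j e, eig1 j e v -> eig1 j e v0 /\ eig1 j e v1].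
Proof.
pose r := rt (a i ^+ 2 / 4 - 1); pose c := a i / 2 + r; pose d := a i / 2 - r.
have four : 4 != 0 :> K by rewrite (_ : 4 = 2 ^+ 2) ?expf_neq0 // -natrX.
have cd : c * d = 1.
  have -> : c * d = a i ^+ 2 / 4 - r ^+ 2 by rewrite /c /d; field; exact/andP.
  by rewrite rtP opprB addrC subrK.
have cda : a i = c + d by rewrite /c /d addrACA subrr addr0; field.
clearbody c d.
have c0 : c != 0 by apply: contraTneq isT => e; move/eqP: cd; rewrite e mul0r eq_sym oner_eq0.
have d0 : d != 0 by apply: contraTneq isT => e; move/eqP: cd; rewrite e mulr0 eq_sym oner_eq0.
have dc : d = c^-1 by apply: (mulfI c0); rewrite cd divff.
have cdi : c = d^-1 by rewrite dc invrK.
have [e|ncd] := eqVneq c d.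
  exists c, c, 0, v.
  have hX w : X i w = c *: w.
    by apply: Xa; [rewrite expr2 {2}e | rewrite cda -e mulrDl mul1r].
  split=> [|||j f [h1 h2 h3]]; rewrite ?add0r //; try by split; rewrite // cda dc.
  by split; split; rewrite // linear0 scaler0.
have X2 w : X i (X i w) = a i *: X i w - w.
  by rewrite -(XaY i (X i w)) YX addrK.
have cd0 : c - d != 0 by rewrite subr_eq0.
exists c, d, ((c - d)^-1 *: (X i v - d *: v)), ((d - c)^-1 *: (X i v - c *: v)).
have comm j e f g : eig1 j e v -> eig1 j e (f *: (X i v - g *: v)).
  move=> [h1 h2 h3]; split=> //.
  by rewrite linearZ linearB /= linearZ /= XX h2 linearZ /= !scalerBr !scalerA !(mulrC e) mulrAC.
split.
- split=> //; last by rewrite -dc.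
  rewrite linearZ linearB /= X2 linearZ /= !scalerA [c * _]mulrC -scalerA.
  congr (_ *: _); rewrite scalerBr scalerA cd scale1r addrAC -scalerBl.
  by rewrite cda addrK.
- split=> //; last by rewrite -cdi addrC.
  rewrite linearZ linearB /= X2 linearZ /= !scalerA [d * _]mulrC -scalerA.
  congr (_ *: _); rewrite scalerBr scalerA [d * c]mulrC cd scale1r addrAC -scalerBl.
  by rewrite cda [c + d]addrC addrK.
- rewrite -(opprB c d) invrN scaleNr -scalerBr opprB.
  rewrite [X in _ *: X]addrC addrA subrK.
  by rewrite -scalerBl scalerA mulVf // scale1r.
by move=> j e he; split; apply: comm.
Qed.

(** The list in [key] holds the strands not yet diagonalised; each step splits w along one of them,
    until w is a joint eigenvector. *)
Lemma eig_ext (f g : 'End(V)) : (forall x v, eig x v -> f v = g v) -> f = g.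
Proof.
move=> h; apply/lfunP => v.
suff key (s : seq 'I_n) w x : (forall i, i \notin s -> eig1 i (x i) w) -> f w = g w.
  by apply: (key (enum 'I_n) v (fun _ => 0)) => i; rewrite mem_enum.
elim: s w x => [|i s IH] w x hx; first by apply: (h x) => i; apply: hx.
have [c [d [w0 [w1 [e0 e1 ew hj]]]]] := eig_split i w.
rewrite ew !linearD; congr (_ + _).
  apply: (IH w0 (fun j => if j == i then c else x j)) => j js.
  case: eqP => [->//|/eqP ji]; apply: (hj _ _ _).1; apply: hx.
  by rewrite inE negb_or ji.
apply: (IH w1 (fun j => if j == i then d else x j)) => j js.
case: eqP => [->//|/eqP ji]; apply: (hj _ _ _).2; apply: hx.
by rewrite inE negb_or ji.
Qed.

Definition flip i x k := if k == i then (x i)^-1 else x k.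

Lemma eigC i x v : eig x v -> eig (flip i x) (C i v).
Proof.
move=> hx k; have [h e ea] := hx k; rewrite /flip; case: eqP => [ki|/eqP ki].
  subst k; split; rewrite ?invr_eq0 ?invrK //; last by rewrite addrC.
  by rewrite XC (eig_Y _ hx) linearZ.
by split=> //; rewrite XCj // e linearZ.
Qed.

(* Locked, to keep the linear-function rewrite rules from unfolding it. *)
Definition N i j : 'End(V) :=
  locked (Y i - X j + (Y j \o (C i \o C j))%VF - (Y i \o (C i \o C j))%VF).

Lemma NE i j v : N i j v = Y i v - X j v + Y j (C i (C j v)) - Y i (C i (C j v)).
Proof. by rewrite /N -lock !(add_lfunE, opp_lfunE, comp_lfunE). Qed.

Lemma N_eig i j x v : i != j -> eig x v ->
  N i j v = ((x i)^-1 - x j) *: v + (x j - x i) *: C i (C j v).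
Proof.
move=> ij hx; rewrite NE.
rewrite (eig_Y i hx) (eig_Y i (eigC i (eigC j hx))) (eig_Y j (eigC i (eigC j hx))).
have [_ -> _] := hx j; rewrite -scalerBl -addrA -scalerBl; congr (_ + _ *: _).
by rewrite /flip !eqxx (negPf ij) eq_sym (negPf ij) !invrK.
Qed.

(** Here X_i and X_j are both the scalar s = s^-1, so the terms of N_ij cancel in pairs. *)
Lemma N_unit i j s v : s ^+ 2 = 1 -> a i = 2 * s -> a j = 2 * s -> N i j v = 0.
Proof.
move=> s2 ai aj; have XY k w : a k = 2 * s -> (X k w = s *: w) * (Y k w = s *: w).
  move=> ak; have Xk := Xa w s2 ak; split=> //.
  have := XaY k w; rewrite ak Xk mulrDl mul1r scalerDl => /addrI; exact.
by rewrite NE !(XY i _ ai) !(XY j _ aj) subrr add0r subrr.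
Qed.

Lemma CCCC i j v : i != j -> C i (C j (C i (C j v))) = - v.
Proof. by move=> ij; rewrite CCN // !CC. Qed.

(** * The operators N on three strands *)

Section Triple.
Variables (i j k : 'I_n) (x : 'I_n -> K) (v : V).
Hypotheses (ij : i != j) (ik : i != k) (jk : j != k) (hx : eig x v).
Let ji : j != i. Proof. by rewrite eq_sym. Qed.
Let ki : k != i. Proof. by rewrite eq_sym. Qed.
Let kj : k != j. Proof. by rewrite eq_sym. Qed.

(** Coordinates on v, C_i C_j v, C_i C_k v, C_j C_k v, a span stable under the three N; products of
    N on it become computations with quadruples of scalars. *)
Definition comb c0 c1 c2 c3 : V :=
  c0 *: v + c1 *: C i (C j v) + c2 *: C i (C k v) + c3 *: C j (C k v).

Lemma combE : v = comb 1 0 0 0.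
Proof. by rewrite /comb !scale0r !addr0 scale1r. Qed.

Lemma combZ c c0 c1 c2 c3 :
  c *: comb c0 c1 c2 c3 = comb (c * c0) (c * c1) (c * c2) (c * c3).
Proof. by rewrite /comb !scalerDr !scalerA. Qed.

Lemma combD c0 c1 c2 c3 d0 d1 d2 d3 :
  comb c0 c1 c2 c3 + comb d0 d1 d2 d3 = comb (c0 + d0) (c1 + d1) (c2 + d2) (c3 + d3).
Proof.
rewrite /comb !scalerDl addrACA; congr (_ + _); rewrite addrACA; congr (_ + _).
by rewrite addrACA.
Qed.

Let w12 := C i (C j v).
Let w13 := C i (C k v).
Let w23 := C j (C k v).

Lemma comb0 c : c *: v = comb c 0 0 0.
Proof. by rewrite /comb !scale0r !addr0. Qed.
Lemma comb12 c : c *: w12 = comb 0 c 0 0.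
Proof. by rewrite /comb !scale0r !addr0 add0r. Qed.
Lemma comb13 c : c *: w13 = comb 0 0 c 0.
Proof. by rewrite /comb !scale0r !addr0 !add0r. Qed.
Lemma comb23 c : c *: w23 = comb 0 0 0 c.
Proof. by rewrite /comb !scale0r !add0r. Qed.

Let flips := (eqxx, negPf ij, negPf ik, negPf jk, negPf ji, negPf ki, negPf kj, @invrK K).

Lemma comb_lin (f : 'End(V)) c0 c1 c2 c3 : f (comb c0 c1 c2 c3) =
  c0 *: f v + c1 *: f w12 + c2 *: f w13 + c3 *: f w23.
Proof. by rewrite /comb !linearD /= !linearZ. Qed.

Let xi := x i. Let xj := x j. Let xk := x k.

(** The four vectors are joint eigenvectors, with x inverted at the two strands of the Clifford
    factor; [N_eig] applies to each, and C_i C_j permutes them up to sign. *)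
Lemma N12_comb c0 c1 c2 c3 : N i j (comb c0 c1 c2 c3) =
  comb (c0 * (xi^-1 - xj) - c1 * (xj^-1 - xi^-1))
       (c0 * (xj - xi) + c1 * (xi - xj^-1))
       (c2 * (xi - xj) + c3 * (xj^-1 - xi))
       (c3 * (xi^-1 - xj^-1) - c2 * (xj - xi^-1)).
Proof.
rewrite comb_lin (N_eig ij hx) (N_eig ij (eigC i (eigC j hx)))
  (N_eig ij (eigC i (eigC k hx))) (N_eig ij (eigC j (eigC k hx))).
rewrite /flip !flips CCCC //.
have -> : C i (C j (C i (C k v))) = - w23 by rewrite CCN // CC.
have -> : C i (C j (C j (C k v))) = w13 by rewrite CC.
rewrite !scalerDr !scalerA !scalerN -/w12 -/w13 -/w23 -!scaleNr.
rewrite !(comb0, comb12, comb13, comb23) !combD.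
by rewrite /xi /xj /xk; congr comb; ring.
Qed.

Lemma N13_comb c0 c1 c2 c3 : N i k (comb c0 c1 c2 c3) =
  comb (c0 * (xi^-1 - xk) - c2 * (xk^-1 - xi^-1))
       (c1 * (xi - xk) - c3 * (xk^-1 - xi))
       (c0 * (xk - xi) + c2 * (xi - xk^-1))
       (c1 * (xk - xi^-1) + c3 * (xi^-1 - xk^-1)).
Proof.
rewrite comb_lin (N_eig ik hx) (N_eig ik (eigC i (eigC j hx)))
  (N_eig ik (eigC i (eigC k hx))) (N_eig ik (eigC j (eigC k hx))).
rewrite /flip !flips CCCC //.
have -> : C i (C k (C i (C j v))) = w23.
  by rewrite CCN // CC CCN // opprK.
have -> : C i (C k (C j (C k v))) = - w12.
  by rewrite [C k _]CCN // linearN /= CC.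
rewrite !scalerDr !scalerA !scalerN -/w12 -/w13 -/w23 -!scaleNr.
rewrite !(comb0, comb12, comb13, comb23) !combD.
by rewrite /xi /xj /xk; congr comb; ring.
Qed.

Lemma N23_comb c0 c1 c2 c3 : N j k (comb c0 c1 c2 c3) =
  comb (c0 * (xj^-1 - xk) - c3 * (xk^-1 - xj^-1))
       (c1 * (xj - xk) + c2 * (xk^-1 - xj))
       (c2 * (xj^-1 - xk^-1) - c1 * (xk - xj^-1))
       (c0 * (xk - xj) + c3 * (xj - xk^-1)).
Proof.
rewrite comb_lin (N_eig jk hx) (N_eig jk (eigC i (eigC j hx)))
  (N_eig jk (eigC i (eigC k hx))) (N_eig jk (eigC j (eigC k hx))).
rewrite /flip !flips CCCC //.
have -> : C j (C k (C i (C j v))) = - w13.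
  rewrite [C i (C j _)]CCN // !linearN /= [C k (C j _)]CCN // linearN /=.
  by rewrite opprK CC CCN.
have -> : C j (C k (C i (C k v))) = w12.
  by rewrite [C k _]CCN // linearN /= CC CCN // opprK.
rewrite !scalerDr !scalerA !scalerN -/w12 -/w13 -/w23 -!scaleNr.
rewrite !(comb0, comb12, comb13, comb23) !combD.
by rewrite /xi /xj /xk; congr comb; ring.
Qed.

End Triple.


Section Braid.
Variables (i j k : 'I_n).
Hypotheses (ij : i != j) (ik : i != k) (jk : j != k).

Local Notation combE v := (combE i j k v).
Local Ltac eval_comb hx :=
  rewrite !(N12_comb ij ik jk hx, N13_comb ij ik jk hx, N23_comb ij ik jk hx).

(** This is [xi_YB1] with denominators cleared and N_ji replaced by N_ij - (a_i - a_j), as [N_anti]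
    allows. *)
Lemma N_YB1 v : (a i - a k) *: N j k (N i j v) =
  (a j - a k) *: N i j (N i k v) + (a i - a j) *: N i k (N j k v)
  - ((a i - a j) * (a j - a k)) *: N i k v.
Proof.
suff : (a i - a k) *: (N j k \o N i j)%VF =
  (a j - a k) *: (N i j \o N i k)%VF + (a i - a j) *: (N i k \o N j k)%VF
  - ((a i - a j) * (a j - a k)) *: N i k.
  by move/lfunP/(_ v); rewrite !(add_lfunE, opp_lfunE, scale_lfunE, comp_lfunE).
apply: eig_ext => x {}v hx; rewrite !(add_lfunE, opp_lfunE, scale_lfunE, comp_lfunE).
rewrite [v](combE v); eval_comb hx.
have [[hi _ ->] [hj _ ->] [hk _ ->]] := And3 (hx i) (hx j) (hx k).
rewrite -scaleNr !combZ !combD.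
by congr comb; field; rewrite hi hj hk.
Qed.

(** The same products as in [N_YB1], each with its factors in the opposite order. *)
Lemma N_YB2 v : (a i - a k) *: N i j (N j k v) =
  (a j - a k) *: N i k (N i j v) + (a i - a j) *: N j k (N i k v)
  - ((a i - a j) * (a j - a k)) *: N i k v.
Proof.
suff : (a i - a k) *: (N i j \o N j k)%VF =
  (a j - a k) *: (N i k \o N i j)%VF + (a i - a j) *: (N j k \o N i k)%VF
  - ((a i - a j) * (a j - a k)) *: N i k.
  by move/lfunP/(_ v); rewrite !(add_lfunE, opp_lfunE, scale_lfunE, comp_lfunE).
apply: eig_ext => x {}v hx; rewrite !(add_lfunE, opp_lfunE, scale_lfunE, comp_lfunE).
rewrite [v](combE v); eval_comb hx.
have [[hi _ ->] [hj _ ->] [hk _ ->]] := And3 (hx i) (hx j) (hx k).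
rewrite -scaleNr !combZ !combD.
by congr comb; field; rewrite hi hj hk.
Qed.

Definition braid_defect : K := a j ^+ 3 - a i * a j * a k + 4 * (a i + a k) - 8 * a j.

(* Obtained by clearing the denominators [a i - a k] in the braid relation for [xi]; it
   remains meaningful when [a i = a k]. *)
Lemma N_braid v :
  (a j - a k) *: N i j (N j k (N i j v)) - (a i - a j) *: N j k (N i j (N j k v)) =
  braid_defect *: N i k v.
Proof.
suff : (a j - a k) *: (N i j \o (N j k \o N i j))%VF
    - (a i - a j) *: (N j k \o (N i j \o N j k))%VF = braid_defect *: N i k.
  by move/lfunP/(_ v); rewrite !(add_lfunE, opp_lfunE, scale_lfunE, comp_lfunE).
apply: eig_ext => x {}v hx; rewrite !(add_lfunE, opp_lfunE, scale_lfunE, comp_lfunE).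
rewrite [v](combE v); eval_comb hx; rewrite /braid_defect.
have [[hi _ ->] [hj _ ->] [hk _ ->]] := And3 (hx i) (hx j) (hx k).
rewrite -scaleNr !combZ !combD.
by congr comb; field; rewrite hi hj hk.
Qed.

(** For distinct a_i, a_k this expresses the coefficient of N_ik in [N_braid] through the two values
    of om^2 that the braid relation brings in at z^tau. *)
Lemma braid_defect_mul : (a i - a k) * braid_defect =
  (a i * a j - 4) * (a j - a k) ^+ 2 - (a j * a k - 4) * (a i - a j) ^+ 2.
Proof. by rewrite /braid_defect; ring. Qed.

End Braid.

(** * Exchange of N with X and C *)

Section Exchange.
Variables (i j : 'I_n).
Hypothesis ij : i != j.

Lemma YE k v : Y k v = a k *: v - X k v.
Proof. by rewrite -XaY addrAC subrr add0r. Qed.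

Lemma YXC k l v : Y k (X l v) = X l (Y k v).
Proof. by rewrite !YE linearB linearZ /= XX. Qed.

Lemma YCC k l v : k != l -> Y k (C l v) = C l (Y k v).
Proof. by move=> kl; rewrite !YE linearB linearZ /= XCj. Qed.

(** Equal coordinates give equal vectors whether or not u and w are independent; only this direction
    is used. *)
Definition lc u w c d : V := c *: u + d *: w.
Lemma lcl u w c : c *: u = lc u w c 0.
Proof. by rewrite /lc scale0r addr0. Qed.
Lemma lcr u w c : c *: w = lc u w 0 c.
Proof. by rewrite /lc scale0r add0r. Qed.
Lemma lcZ u w b c d : b *: lc u w c d = lc u w (b * c) (b * d).
Proof. by rewrite /lc scalerDr !scalerA. Qed.
Lemma lcN u w c d : - lc u w c d = lc u w (- c) (- d).
Proof. by rewrite /lc opprD !scaleNr. Qed.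
Lemma lcD u w c d c' d' : lc u w c d + lc u w c' d' = lc u w (c + c') (d + d').
Proof. by rewrite /lc !scalerDl addrACA. Qed.

Local Notation lcE := (lcZ, lcN, lcD).
Local Notation evalE := (add_lfunE, opp_lfunE, scale_lfunE, comp_lfunE, id_lfunE).
Let ji : j != i. Proof. by rewrite eq_sym. Qed.

Lemma N_anti v : N i j v - N j i v = (a i - a j) *: v.
Proof.
suff : N i j - N j i = (a i - a j) *: \1%VF by move/lfunP/(_ v); rewrite !evalE.
apply: eig_ext => x {}v hx; rewrite !evalE.
rewrite (N_eig ij hx) (N_eig ji hx) [C j (C i v)]CCN // scalerN -scaleNr.
rewrite !(lcl v (C i (C j v)), lcr v (C i (C j v))) !lcE.
have [[hi _ ->] [hj _ ->]] := conj (hx i) (hx j).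
by congr lc; ring.
Qed.

(** The origin of om: the quadratic relation at z^tau asks xi^2 + om^2 = eps xi + 1, and the
    constant term here fixes om^2. *)
Lemma N_sq v : N i j (N i j v) = (a i - a j) *: N i j v + (a i * a j - 4) *: v.
Proof.
suff : (N i j \o N i j)%VF = (a i - a j) *: N i j + (a i * a j - 4) *: \1%VF.
  by move/lfunP/(_ v); rewrite !evalE.
apply: eig_ext => x {}v hx; rewrite !evalE.
rewrite (N_eig ij hx) linearD !linearZ /= (N_eig ij hx) (N_eig ij (eigC i (eigC j hx))).
rewrite /flip !eqxx (negPf ij) (negPf ji) !invrK CCCC // scalerN -scaleNr.
rewrite !(lcl v (C i (C j v)), lcr v (C i (C j v))) !lcE.
have [[hi _ ->] [hj _ ->]] := conj (hx i) (hx j).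
by congr lc; field; rewrite hi hj.
Qed.

(** After multiplication by eps / (a_i - a_j), this and the next three give the relations of T with
    X and C on the summand of tau. *)
Lemma N_X1 v : N i j (X i v) =
  X j (N i j v) - (a i - a j) *: (X j v + C i (C j (X i v))).
Proof.
suff : (N i j \o X i)%VF = (X j \o N i j)%VF -
    (a i - a j) *: (X j + (C i \o (C j \o X i))%VF).
  by move/lfunP/(_ v); rewrite !evalE.
apply: eig_ext => x {}v hx; rewrite !evalE.
have [[hi -> ->] [hj ej ->]] := conj (hx i) (hx j).
have [_ ew _] := eigC i (eigC j hx) j.
rewrite !linearZ /= (N_eig ij hx) !linearD !linearZ /= ej ew /flip eqxx (negPf ji).
rewrite !scalerN -!scaleNr.
rewrite !(lcl v (C i (C j v)), lcr v (C i (C j v))) !lcE.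
by congr lc; field; rewrite ?hi hj.
Qed.

Lemma N_X2 v : N i j (X j v) =
  X i (N i j v) + (a i - a j) *: (X j v - C i (C j (X j v))).
Proof.
suff : (N i j \o X j)%VF = (X i \o N i j)%VF +
    (a i - a j) *: (X j - (C i \o (C j \o X j))%VF).
  by move/lfunP/(_ v); rewrite !evalE.
apply: eig_ext => x {}v hx; rewrite !evalE.
have [[hi ei ->] [hj -> ->]] := conj (hx i) (hx j).
have [_ ew _] := eigC i (eigC j hx) i.
rewrite !linearZ /= (N_eig ij hx) !linearD !linearZ /= ei ew /flip eqxx (negPf ij).
rewrite !scalerN -!scaleNr.
rewrite !(lcl v (C i (C j v)), lcr v (C i (C j v))) !lcE.
by congr lc; field; rewrite ?hi ?hj.
Qed.

Lemma N_C1 v : N i j (C i v) = C j (N i j v).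
Proof.
suff : (N i j \o C i)%VF = (C j \o N i j)%VF.
  by move/lfunP/(_ v); rewrite !evalE.
apply: eig_ext => x {}v hx; rewrite !evalE.
rewrite (N_eig ij hx) (N_eig ij (eigC i hx)) linearD !linearZ /=.
rewrite [C j (C i v)]CCN // linearN /= CC [C j (C i _)]CCN // CC.
rewrite !scalerN -!scaleNr /flip eqxx (negPf ji) invrK.
rewrite !(lcl (C i v) (C j v), lcr (C i v) (C j v)) !lcE.
by congr lc; ring.
Qed.

Lemma N_C2 v : N i j (C j v) = C i (N i j v) - (a i - a j) *: (C i v - C j v).
Proof.
suff : (N i j \o C j)%VF = (C i \o N i j)%VF - (a i - a j) *: (C i - C j).
  by move/lfunP/(_ v); rewrite !evalE.
apply: eig_ext => x {}v hx; rewrite !evalE.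
rewrite (N_eig ij hx) (N_eig ij (eigC j hx)) linearD !linearZ /= !CC.
rewrite /flip eqxx (negPf ij) scalerN scalerBr.
rewrite !(lcl (C i v) (C j v), lcr (C i v) (C j v)) !lcE.
have [[hi _ ->] [hj _ ->]] := conj (hx i) (hx j).
by congr lc; ring.
Qed.

End Exchange.

Section Far.
Variables (i j k : 'I_n).
Hypotheses (ij : i != j) (ki : k != i) (kj : k != j).

Lemma N_Xfar v : N i j (X k v) = X k (N i j v).
Proof.
rewrite !NE -!XCj // !YXC XX -!linearB -!linearD.
by rewrite -linearB.
Qed.

Lemma N_Yfar v : N i j (Y k v) = Y k (N i j v).
Proof. by rewrite !YE linearB linearZ /= N_Xfar. Qed.

(** C_k anticommutes with C_i and with C_j, hence commutes with their product. *)
Lemma N_Cfar v : N i j (C k v) = C k (N i j v).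
Proof.
have CCC w : C i (C j (C k w)) = C k (C i (C j w)).
  by rewrite (@CCN j k w) 1?eq_sym // linearN /= (@CCN i k) 1?eq_sym // opprK.
have [ik jk] : i != k /\ j != k by rewrite ![_ == k]eq_sym.
by rewrite !NE CCC (XCj _ jk) !(YCC _ ik) !(YCC _ jk) linearB linearD linearB.
Qed.

End Far.

Lemma N_comm i j k l v : i != j -> k != i -> k != j -> l != i -> l != j ->
  N i j (N k l v) = N k l (N i j v).
Proof.
move=> ij ki kj li lj.
rewrite [N k l v]NE [N k l (N i j v)]NE !linearB linearD linearB /=.
by rewrite !N_Yfar // !N_Xfar // !N_Cfar.
Qed.

(** * Closed forms of the operators Xi and Omega *)

Section Inverses.
Variables (i j : 'I_n) (e : K).
Hypotheses (ij : i != j) (aij : a i != a j).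
Let ji : j != i. Proof. by rewrite eq_sym. Qed.
Let d := (a i - a j)^-1.

Local Notation evalE := (add_lfunE, opp_lfunE, scale_lfunE, comp_lfunE, id_lfunE).

Lemma inv_lfunP (f g : 'End(V)) : (forall v, f (g v) = v) -> (forall v, g (f v) = v) ->
  (f^-1)%VF = g.
Proof.
move=> fg gf; apply/lfunP => v; rewrite -{1}(fg v) lker0_lfunK //.
by apply/lker0P => u w e'; rewrite -(gf u) e' gf.
Qed.

(** Functions of X_i and X_j are handled by their values on joint eigenvectors, so that an equation
    between such operators, in particular the verification of an inverse, is an equation in two
    scalars y, z. *)
Definition diag_on (f : 'End(V)) (phi : K -> K -> K) :=
  forall x v, eig x v -> f v = phi (x i) (x j) *: v.

Lemma diagX1 : diag_on (X i) (fun y _ => y).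
Proof. by move=> x v /(_ i)[]. Qed.
Lemma diagX2 : diag_on (X j) (fun _ z => z).
Proof. by move=> x v /(_ j)[]. Qed.
Lemma diagY1 : diag_on (Y i) (fun y _ => y^-1).
Proof. by move=> x v hx; rewrite (eig_Y i hx). Qed.
Lemma diagY2 : diag_on (Y j) (fun _ z => z^-1).
Proof. by move=> x v hx; rewrite (eig_Y j hx). Qed.
Lemma diag1 : diag_on \1%VF (fun _ _ => 1).
Proof. by move=> x v hx; rewrite id_lfunE scale1r. Qed.
Lemma diagM f g p r : diag_on f p -> diag_on g r ->
  diag_on (f \o g)%VF (fun y z => p y z * r y z).
Proof.
by move=> hf hg x v hx; rewrite comp_lfunE (hg _ _ hx) linearZ /= (hf _ _ hx) scalerA mulrC.
Qed.
Lemma diagD f g p r : diag_on f p -> diag_on g r ->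
  diag_on (f + g) (fun y z => p y z + r y z).
Proof. by move=> hf hg x v hx; rewrite add_lfunE (hf _ _ hx) (hg _ _ hx) scalerDl. Qed.
Lemma diagN f p : diag_on f p -> diag_on (- f) (fun y z => - p y z).
Proof. by move=> hf x v hx; rewrite opp_lfunE (hf _ _ hx) scaleNr. Qed.
Lemma diagZ c f p : diag_on f p -> diag_on (c *: f) (fun y z => c * p y z).
Proof. by move=> hf x v hx; rewrite scale_lfunE (hf _ _ hx) scalerA. Qed.

Lemma diag_eq f g p r : diag_on f p -> diag_on g r ->
  (forall y z, y != 0 -> z != 0 -> a i = y + y^-1 -> a j = z + z^-1 -> p y z = r y z) ->
  f = g.
Proof.
move=> hf hg h; apply: eig_ext => x v hx; rewrite (hf _ _ hx) (hg _ _ hx).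
by have [[i0 _ ai] [j0 _ aj]] := conj (hx i) (hx j); rewrite h.
Qed.

Lemma diag_inv f g p r : diag_on f p -> diag_on g r ->
  (forall y z, y != 0 -> z != 0 -> a i = y + y^-1 -> a j = z + z^-1 -> p y z * r y z = 1) ->
  (f^-1)%VF = g.
Proof.
move=> hf hg h.
have h1 : (f \o g)%VF = \1%VF by apply: (diag_eq (diagM hf hg) diag1).
have h2 : (g \o f)%VF = \1%VF.
  by apply: (diag_eq (diagM hg hf) diag1) => y z *; rewrite mulrC h.
by apply: inv_lfunP => v; rewrite -comp_lfunE ?h1 ?h2 id_lfunE.
Qed.

Lemma mul_dV (c : K) : c = a i - a j -> d * c = 1.
Proof. by move=> ->; rewrite mulVf // subr_eq0. Qed.

Lemma inv_XY : ((X i \o Y j - \1)^-1)%VF = d *: (X j - Y i).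
Proof.
apply: (diag_inv (diagD (diagM diagX1 diagY2) (diagN diag1))
  (diagZ d (diagD diagX2 (diagN diagY1)))) => y z y0 z0 ai aj.
by rewrite mulrCA mul_dV // ai aj; field; rewrite y0 z0.
Qed.

Lemma inv_XX : ((X i \o X j - \1)^-1)%VF = d *: (Y j - Y i).
Proof.
apply: (diag_inv (diagD (diagM diagX1 diagX2) (diagN diag1))
  (diagZ d (diagD diagY2 (diagN diagY1)))) => y z y0 z0 ai aj.
by rewrite mulrCA mul_dV // ai aj; field; rewrite y0 z0.
Qed.

Local Notation "f ** g" := (f \o g)%VF (at level 40, left associativity).
Local Notation inv f := (f^-1)%VF.

Lemma Xi_formula :
  - (e *: inv (X i ** Y j - \1%VF)) + e *: (inv (X i ** X j - \1%VF) ** (C i ** C j)) =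
  (e * d) *: N i j :> 'End(V).
Proof.
rewrite inv_XY inv_XX; apply/lfunP => v.
rewrite !evalE NE -!scalerA -scalerN -scalerDr -scalerN -scalerDr.
by rewrite opprB -!addrA.
Qed.

Lemma inv_sq1 : (((X i \o Y j - \1) \o (X i \o Y j - \1))^-1)%VF =
  (d *: (X j - Y i) \o (d *: (X j - Y i)))%VF.
Proof.
have h := diagD (diagM diagX1 diagY2) (diagN diag1).
have k := diagZ d (diagD diagX2 (diagN diagY1)).
apply: (diag_inv (diagM h h) (diagM k k)) => y z y0 z0 ai aj.
rewrite mulrACA -expr2 mulrCA mul_dV ?expr1n //.
by rewrite ai aj; field; rewrite y0 z0.
Qed.

Lemma inv_sq2 : (((Y i \o Y j - \1) \o (Y i \o Y j - \1))^-1)%VF =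
  (d *: (X j - X i) \o (d *: (X j - X i)))%VF.
Proof.
have h := diagD (diagM diagY1 diagY2) (diagN diag1).
have k := diagZ d (diagD diagX2 (diagN diagX1)).
apply: (diag_inv (diagM h h) (diagM k k)) => y z y0 z0 ai aj.
rewrite mulrACA -expr2 mulrCA mul_dV ?expr1n //.
by rewrite ai aj; field; rewrite y0 z0.
Qed.

(** With D = a_i - a_j, the two fractions are (yz - 2 + 1/(yz)) / D^2 and (z/y - 2 + y/z) / D^2;
    their sum has numerator (y + 1/y)(z + 1/z) - 4. *)
Lemma radicand_formula :
  \1%VF - e ^+ 2 *: (X i ** Y j ** inv ((X i ** Y j - \1%VF) ** (X i ** Y j - \1%VF))
    + Y i ** Y j ** inv ((Y i ** Y j - \1%VF) ** (Y i ** Y j - \1%VF))) =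
  (1 - e ^+ 2 * ((a i * a j - 4) / (a i - a j) ^+ 2)) *: \1%VF :> 'End(V).
Proof.
rewrite inv_sq1 inv_sq2.
have k1 := diagZ d (diagD diagX2 (diagN diagY1)).
have k2 := diagZ d (diagD diagX2 (diagN diagX1)).
apply: (diag_eq (diagD diag1 (diagN (diagZ (e ^+ 2) (diagD
   (diagM (diagM diagX1 diagY2) (diagM k1 k1)) (diagM (diagM diagY1 diagY2) (diagM k2 k2))))))
  (diagZ _ diag1)) => y z y0 z0 ai aj.
rewrite mulr1; congr (1 - _ * _); rewrite -exprVn -/d [in RHS]ai [in RHS]aj.
by field; rewrite y0 z0.
Qed.

End Inverses.

End Strands.

Lemma lo_neq_hi m (k : 'I_m.-1) : lo k != hi k.
Proof. by rewrite -val_eqE /= neq_ltn leqnn. Qed.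

(** * The relations of the Hecke-Clifford superalgebra *)

Section SeminormalForm.
Variables (K : fieldType) (two_neq0 : 2 != 0 :> K).
Variables (rt : K -> K) (rtP : forall a : K, rt a ^+ 2 = a).
Variables (n : nat) (V D : superVectType K).
Variables (X Y C : 'I_n -> 'End(V)) (a : 'I_n -> K).
Hypothesis rel : strand_rel X Y C a.
Variable e : K.
Local Notation N := (N X Y C).

Definition xi i j : 'End(V) := (e / (a i - a j)) *: N i j.
Definition om2 (x y : K) : K := 1 - e ^+ 2 * ((x * y - 4) / (x - y) ^+ 2).
Definition om i j : K := rt (om2 (a i) (a j)).

Lemma xiE i j v : xi i j v = (e / (a i - a j)) *: N i j v.
Proof. exact: scale_lfunE. Qed.

Lemma omC i j : om i j = om j i.
Proof. by rewrite /om /om2 [a j * _]mulrC -[a j - _]opprB sqrrN. Qed.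

Lemma om_sq i j : om i j * om i j = om2 (a i) (a j).
Proof. by rewrite -expr2 rtP. Qed.

Section Pair.
Variables (i j : 'I_n).
Hypotheses (ij : i != j) (aij : a i != a j).
Let d0 : a i - a j != 0. Proof. by rewrite subr_eq0. Qed.

Lemma xi_anti v : xi i j v + xi j i v = e *: v.
Proof.
rewrite !xiE -[a j - _]opprB invrN mulrN scaleNr -scalerBr.
by rewrite (N_anti two_neq0 rtP rel ij) scalerA divfK.
Qed.

Lemma xi_sq v : xi i j (xi i j v) = e *: xi i j v + (1 - om2 (a i) (a j)) *: v.
Proof.
rewrite !xiE linearZ /= (N_sq two_neq0 rtP rel ij) !scalerDr !scalerA /om2.
by congr (_ *: _ + _ *: _); field.
Qed.

Lemma xi_X1 v : xi i j (X i v) = X j (xi i j v) - e *: (X j v + C i (C j (X i v))).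
Proof.
rewrite !xiE (N_X1 two_neq0 rtP rel ij) scalerBr [X _ (_ *: _)]linearZ /= scalerA.
by rewrite divfK.
Qed.

Lemma xi_X2 v : xi i j (X j v) = X i (xi i j v) + e *: (X j v - C i (C j (X j v))).
Proof.
rewrite !xiE (N_X2 two_neq0 rtP rel ij) scalerDr [X _ (_ *: _)]linearZ /= scalerA.
by rewrite divfK.
Qed.

Lemma xi_C1 v : xi i j (C i v) = C j (xi i j v).
Proof. by rewrite !xiE (N_C1 two_neq0 rtP rel ij) linearZ. Qed.

Lemma xi_C2 v : xi i j (C j v) = C i (xi i j v) - e *: (C i v - C j v).
Proof.
rewrite !xiE (N_C2 two_neq0 rtP rel ij) scalerBr [C _ (_ *: _)]linearZ /= scalerA.
by rewrite divfK.
Qed.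

End Pair.

Lemma xi_Xfar i j k v : i != j -> k != i -> k != j -> xi i j (X k v) = X k (xi i j v).
Proof. by move=> ij ki kj; rewrite !xiE (N_Xfar rel) // linearZ. Qed.

Lemma xi_Cfar i j k v : i != j -> k != i -> k != j -> xi i j (C k v) = C k (xi i j v).
Proof. by move=> ij ki kj; rewrite !xiE (N_Cfar rel) // linearZ. Qed.

Lemma xi_comm i j k l v : i != j -> k != i -> k != j -> l != i -> l != j ->
  xi i j (xi k l v) = xi k l (xi i j v).
Proof.
move=> ij ki kj li lj; rewrite !xiE !linearZ /= (N_comm rel) // !scalerA.
by rewrite mulrC.
Qed.


Section Comb3.
Variables (u w z : V).
Definition lc3 p r s : V := p *: u + r *: w + s *: z.
Lemma lc3Z c p r s : c *: lc3 p r s = lc3 (c * p) (c * r) (c * s).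
Proof. by rewrite /lc3 !scalerDr !scalerA. Qed.
Lemma lc3N p r s : - lc3 p r s = lc3 (- p) (- r) (- s).
Proof. by rewrite /lc3 !opprD !scaleNr. Qed.
Lemma lc3D p r s p' r' s' : lc3 p r s + lc3 p' r' s' = lc3 (p + p') (r + r') (s + s').
Proof. by rewrite /lc3 !scalerDl addrACA; congr (_ + _); rewrite addrACA. Qed.
Lemma lc3u p : p *: u = lc3 p 0 0.
Proof. by rewrite /lc3 !scale0r !addr0. Qed.
Lemma lc3w p : p *: w = lc3 0 p 0.
Proof. by rewrite /lc3 !scale0r add0r addr0. Qed.
Lemma lc3z p : p *: z = lc3 0 0 p.
Proof. by rewrite /lc3 !scale0r !add0r. Qed.
Definition lc3E := (lc3u, lc3w, lc3z, lc3Z, lc3N, lc3D).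
End Comb3.

Section Triple.
Variables (i j k : 'I_n).
Hypotheses (ij : i != j) (ik : i != k) (jk : j != k).
Hypotheses (aij : a i != a j) (ajk : a j != a k).
Let d1 : a i - a j != 0. Proof. by rewrite subr_eq0. Qed.
Let d2 : a j - a k != 0. Proof. by rewrite subr_eq0. Qed.

Lemma xi_YB1 v : a i != a k ->
  xi j k (xi i j v) + xi j i (xi i k v) = xi i k (xi j k v).
Proof.
move=> aik; have d3 : a i - a k != 0 by rewrite subr_eq0.
have -> : xi j i (xi i k v) = e *: xi i k v - xi i j (xi i k v).
  by rewrite -(xi_anti ij aij) addrAC subrr add0r.
rewrite !xiE !linearZ /=.
have -> : N j k (N i j v) = (a i - a k)^-1 *: ((a i - a k) *: N j k (N i j v)).
  by rewrite scalerA mulVf // scale1r.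
rewrite (N_YB1 two_neq0 rtP rel ij ik jk).
set u := N i j (N i k v); set w := N i k (N j k v); set z := N i k v.
rewrite ?scalerN !(lc3E u w z); congr lc3; field; by rewrite ?d1 ?d2 ?d3.
Qed.

Lemma xi_YB2 v : a i != a k ->
  xi i j (xi j k v) + xi k j (xi i k v) = xi i k (xi i j v).
Proof.
move=> aik; have d3 : a i - a k != 0 by rewrite subr_eq0.
have -> : xi k j (xi i k v) = e *: xi i k v - xi j k (xi i k v).
  by rewrite -(xi_anti jk ajk) addrAC subrr add0r.
rewrite !xiE !linearZ /=.
have -> : N i j (N j k v) = (a i - a k)^-1 *: ((a i - a k) *: N i j (N j k v)).
  by rewrite scalerA mulVf // scale1r.
rewrite (N_YB2 two_neq0 rtP rel ij ik jk).
set u := N j k (N i k v); set w := N i k (N i j v); set z := N i k v.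
rewrite ?scalerN !(lc3E u w z); congr lc3; field; by rewrite ?d1 ?d2 ?d3.
Qed.

(** If a_i = a_k, the hypothesis removes both om2 terms, and what remains is [N_braid] with right
    side 0. Otherwise [braid_defect_mul] matches that right side with the om2 terms. *)
Lemma xi_braid v : (a i = a k -> [/\ om2 (a i) (a j) = 0, om2 (a j) (a k) = 0 &
      forall v, braid_defect a i j k *: N i k v = 0]) ->
  xi i j (xi j k (xi i j v)) + om2 (a i) (a j) *: xi i k v =
  xi j k (xi i j (xi j k v)) + om2 (a j) (a k) *: xi i k v.
Proof.
move=> h; have br := N_braid two_neq0 rtP rel ij ik jk v.
rewrite !xiE !linearZ /=.
set u := N i j (N j k _) in br *; set w := N j k (N i j _) in br *; set z := N i k v in br *.
have [aik|aik] := eqVneq (a i) (a k).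
  have [-> -> hz] := h aik; rewrite !scale0r ?scaler0 !addr0 !scalerA.
  move: br; rewrite hz => /eqP; rewrite subr_eq0 => /eqP br.
  have -> : u = (a j - a k)^-1 *: ((a j - a k) *: u).
    by rewrite scalerA mulVf // scale1r.
  by rewrite br !scalerA; congr (_ *: _); field; rewrite d1 d2.
have d3 : a i - a k != 0 by rewrite subr_eq0.
have -> : u = (a j - a k)^-1 *: (braid_defect a i j k *: z + (a i - a j) *: w).
  by rewrite -br subrK scalerA mulVf // scale1r.
have -> : braid_defect a i j k = ((a i * a j - 4) * (a j - a k) ^+ 2 -
    (a j * a k - 4) * (a i - a j) ^+ 2) / (a i - a k).
  by rewrite -braid_defect_mul mulrAC mulfV // mul1r.
rewrite !(lc3E u w z) /om2; congr lc3; field; by rewrite ?d1 ?d2 ?d3.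
Qed.

End Triple.

(** * The relations, for an abstract family of summands *)

Section Relations.
Variables (P : {set 'S_n}) (m : 'S_n -> V -> D) (T : 'I_n.-1 -> endo D).
Variables (XD YD CD : 'I_n -> endo D).
Hypotheses (mD : forall tau, {morph m tau : u v / u + v})
  (mZ : forall tau c v, m tau (c *: v) = c *: m tau v)
  (m_ext : forall f g : endo D,
    (forall tau v, tau \in P -> f (m tau v) = g (m tau v)) -> f = g).
Local Notation str tau p := ((tau^-1)%g p).
Hypotheses (Tm : forall (k : 'I_n.-1) tau v, T k (m tau v) =
     m tau (xi (str tau (lo k)) (str tau (hi k)) v) +
     m (pmul (s_ k) tau) (om (str tau (lo k)) (str tau (hi k)) *: v)).
Hypotheses (XDm : forall p tau v, XD p (m tau v) = m tau (X (str tau p) v))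
  (YDm : forall p tau v, YD p (m tau v) = m tau (Y (str tau p) v))
  (CDm : forall p tau v, CD p (m tau v) = m tau (C (str tau p) v)).
Hypotheses (aP : forall tau (k : 'I_n.-1), tau \in P ->
    a (str tau (lo k)) != a (str tau (hi k)))
  (oP : forall tau (k : 'I_n.-1), tau \in P -> pmul (s_ k) tau \notin P ->
    om2 (a (str tau (lo k))) (a (str tau (hi k))) = 0)
  (bP : forall tau (k l : 'I_n.-1), l = k.+1 :> nat -> tau \in P ->
    let i := str tau (lo k) in let j := str tau (hi k) in let h := str tau (hi l) in
    a i = a h -> forall v, braid_defect a i j h *: N i h v = 0).

Lemma str_pmul (tau : 'S_n) (k : 'I_n.-1) p : str (pmul (s_ k) tau) p = str tau (s_ k p).
Proof. by rewrite /pmul invMg permM tpermV. Qed.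

Lemma s_lo (k : 'I_n.-1) : s_ k (lo k) = hi k. Proof. exact: tpermL. Qed.
Lemma s_hi (k : 'I_n.-1) : s_ k (hi k) = lo k. Proof. exact: tpermR. Qed.
Lemma s_D (k : 'I_n.-1) p : p != lo k -> p != hi k -> s_ k p = p.
Proof. by move=> h1 h2; apply: tpermD; rewrite eq_sym. Qed.
Lemma pmul_ss (k : 'I_n.-1) (tau : 'S_n) : pmul (s_ k) (pmul (s_ k) tau) = tau.
Proof. by rewrite /pmul -mulgA tperm2 mulg1. Qed.

Lemma mN (tau : 'S_n) v : m tau (- v) = - m tau v.
Proof. by rewrite -scaleN1r mZ scaleN1r. Qed.
Lemma mB (tau : 'S_n) u v : m tau (u - v) = m tau u - m tau v.
Proof. by rewrite mD mN. Qed.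

Lemma str_neq (tau : 'S_n) p r : p != r -> str tau p != str tau r.
Proof. by move=> pr; rewrite (inj_eq perm_inj). Qed.

Lemma scD c (u : D) : (sc c : endo D) u = c *: u.
Proof. exact: endo_scE. Qed.

(** At tau this is [xi_sq], completed by the om^2 term; at s_k tau the two strands have traded
    places and [xi_anti] applies. *)
Lemma T_quadratic (k : 'I_n.-1) : T k ^+ 2 = sc e * T k + 1.
Proof.
apply: m_ext => tau v tP; rewrite expr2 endoDE !endoME endo1E scD.
rewrite !Tm linearD /= !Tm !str_pmul s_lo s_hi pmul_ss.
have neq := str_neq tau (lo_neq_hi k); have aneq := aP k tP.
set i := str tau (lo k) in neq aneq *; set j := str tau (hi k) in neq aneq *.
rewrite [X in _ + X]addrC addrACA -!mD scalerDr -!mZ addrAC -mD.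
congr (m _ _ + m _ _).
  rewrite (xi_sq neq aneq) (omC j i) scalerA om_sq.
  by rewrite -addrA -scalerDl subrK scale1r.
by rewrite linearZ /= -scalerDr (xi_anti neq aneq) !scalerA mulrC.
Qed.

(** The hypothesis is a product of equations, so that a single rewrite with it uses all four. *)
Lemma pmul_comm (k l : 'I_n.-1) tau :
  (s_ k (lo l) = lo l) * (s_ k (hi l) = hi l) *
   (s_ l (lo k) = lo k) * (s_ l (hi k) = hi k) ->
  pmul (s_ k) (pmul (s_ l) tau) = pmul (s_ l) (pmul (s_ k) tau).
Proof.
by move=> E; rewrite /pmul -!mulgA; congr (_ * _)%g; rewrite conjgC tpermJ !E.
Qed.

Lemma T_far (k : 'I_n.-1) (l : 'I_n.-1) : (k.+1 < l)%N || (l.+1 < k)%N -> T k * T l = T l * T k.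
Proof.
move=> kl; apply: m_ext => tau v tP; rewrite !endoME !Tm !linearD /= !Tm !str_pmul.
have [h1 h2 h3 h4] : [/\ lo l != lo k, lo l != hi k, hi l != lo k & hi l != hi k].
  by rewrite -!val_eqE /=; split; apply: contraTneq kl; lia.
have E : (s_ k (lo l) = lo l) * (s_ k (hi l) = hi l) *
   (s_ l (lo k) = lo k) * (s_ l (hi k) = hi k).
  by do !split; apply: s_D; rewrite // eq_sym.
rewrite !E -(pmul_comm tau E).
rewrite !(linearZ, mZ) /=.
have nk := str_neq tau (lo_neq_hi k); have nl := str_neq tau (lo_neq_hi l).
rewrite xi_comm ?str_neq ?lo_neq_hi //.
rewrite !addrA; congr (_ + _); last by rewrite !scalerA mulrC.
by rewrite addrAC.
Qed.

Lemma s_braid (k l : 'I_n.-1) tau : l = k.+1 :> nat ->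
  pmul (s_ k) (pmul (s_ l) (pmul (s_ k) tau)) =
  pmul (s_ l) (pmul (s_ k) (pmul (s_ l) tau)).
Proof.
move=> kl; rewrite /pmul -!mulgA; congr (_ * _)%g.
have el : lo l = hi k by apply: val_inj; rewrite /= kl.
have [h1 h2] : hi l != lo k /\ hi l != hi k by rewrite -!val_eqE /= kl; split; lia.
have t1 : (s_ k * s_ l = s_ l * tperm (lo k) (hi l))%g.
  by rewrite conjgC tpermJ -el s_lo [X in tperm X _]s_D // 1?eq_sym // el lo_neq_hi.
have t2 : (s_ l * s_ k = s_ k * tperm (lo k) (hi l))%g.
  by rewrite conjgC tpermJ el s_hi s_D.
by rewrite t1 t2 !mulgA !tperm2.
Qed.

(* Both sides expand into [m rho _] for rho in the coset of the symmetric group on three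
   strands; the components at [tau], [s_k tau], [s_l tau] are [xi_braid], [xi_YB1],
   [xi_YB2], and the other three agree termwise. *)
Lemma T_braid (k l : 'I_n.-1) : l = k.+1 :> nat -> T k * T l * T k = T l * T k * T l.
Proof.
move=> kl; apply: m_ext => tau v tP.
have el : lo l = hi k by apply: val_inj; rewrite /= kl.
have [h1 h2 h3] : [/\ lo k != hi k, lo k != hi l & hi k != hi l].
  by rewrite -!val_eqE /= kl; split; lia.
have Es : (s_ k (hi l) = hi l) * (s_ l (hi k) = hi l) * (s_ l (lo k) = lo k) *
    (s_ l (hi l) = hi k).
  by do !split; rewrite -?el ?s_lo ?s_hi //; apply: s_D; rewrite ?el // eq_sym.
rewrite !endoME !Tm !linearD /= !Tm !linearD /= !Tm !str_pmul
  !(el, s_lo, s_hi, Es) !pmul_ss (s_braid tau kl).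
have [n1 n2 n3] : [/\ _, _ & _] := And3 (str_neq tau h1) (str_neq tau h2) (str_neq tau h3).
have a1 := aP k tP; have a2 := aP l tP; rewrite el in a2.
have b1 := bP kl tP.
have o1 := @oP tau k tP; have o2 := @oP tau l tP; rewrite el in o2.
have c1 (h : pmul (s_ k) tau \in P) := aP l h.
have c2 (h : pmul (s_ l) tau \in P) := aP k h.
rewrite !str_pmul !(el, s_hi, s_lo, Es) in c1.
rewrite !str_pmul !Es in c2.
move: n1 n2 n3 a1 a2 b1 o1 o2 c1 c2.
set i := str tau _; set j := str tau _; set h := str tau _.
move=> n1 n2 n3 a1 a2 b1 o1 o2 c1 c2.
(* If s_k tau were in P, strands i and h would be neighbours there and [aP] would separate a_i from
   a_h; so s_k tau lies outside P and [oP] applies. *)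
have oz1 : a i = a h -> om2 (a i) (a j) = 0.
  by move=> e1; apply: o1; apply/negP => /c1; rewrite e1 eqxx.
have oz2 : a i = a h -> om2 (a j) (a h) = 0.
  by move=> e1; apply: o2; apply/negP => /c2; rewrite e1 eqxx.
rewrite !(linearZ, mZ) /=.
have om_z1 : a i = a h -> om i j = 0 by move=> /oz1 z; rewrite /om z (rt0 rtP).
have om_z2 : a i = a h -> om j h = 0 by move=> /oz2 z; rewrite /om z (rt0 rtP).
(* Terms are grouped by permutation: 1 and 6 lie at tau on both sides; 2 and 5 lie at s_k tau on the
   left and at s_l tau on the right. *)
rewrite [LHS](AC ((2*2)*(2*2)) ((1*6)*(2*5)*3*4*7*8)).
rewrite [RHS](AC ((2*2)*(2*2)) ((1*6)*3*(2*5)*7*4*8)) /=.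
congr (_ + _ + _ + _ + _ + _).
- rewrite !scalerA (omC j i) (omC h j) !om_sq -!mZ -!mD; congr (m _ _).
  by apply: (xi_braid n1 n2 n3 a1 a2) => e1; split; [exact: oz1|exact: oz2|exact: b1].
(* [xi_YB1] asks for a_i <> a_h; when they are equal, the common factor om is zero. *)
- rewrite -scalerDr -mD; have [/om_z1 ->|ne] := eqVneq (a i) (a h).
    by rewrite !scale0r.
  by rewrite (xi_YB1 n1 n2 n3 a1 a2 _ ne).
- rewrite -scalerDr -mD; have [/om_z2 ->|ne] := eqVneq (a i) (a h).
    by rewrite !scale0r.
  by rewrite (xi_YB2 n1 n2 n3 a1 a2 _ ne).
- by rewrite !scalerA mulrAC.
Qed.

Lemma T_X1 (k : 'I_n.-1) : T k * XD (lo k) =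
  XD (hi k) * T k - sc e * (XD (hi k) + CD (lo k) * CD (hi k) * XD (lo k)).
Proof.
apply: m_ext => tau v tP; rewrite !(endoDE, endoNE, endoME, scD, endo1E).
rewrite !(Tm, XDm, CDm) linearD /= !XDm !str_pmul s_hi -mD -mZ.
rewrite addrAC -mB (xi_X1 (str_neq tau (lo_neq_hi k)) (aP k tP)).
by congr (_ + m _ _); rewrite linearZ.
Qed.

Lemma T_X2 (k : 'I_n.-1) : T k * XD (hi k) =
  XD (lo k) * T k + sc e * ((1 - CD (lo k) * CD (hi k)) * XD (hi k)).
Proof.
apply: m_ext => tau v tP; rewrite !(endoDE, endoNE, endoME, scD, endo1E).
rewrite !(Tm, XDm, CDm) linearD /= !XDm !str_pmul s_lo -mB -mZ.
rewrite addrAC -mD (xi_X2 (str_neq tau (lo_neq_hi k)) (aP k tP)).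
by congr (_ + m _ _); rewrite linearZ.
Qed.

Lemma T_Xfar (k : 'I_n.-1) p : p != lo k -> p != hi k -> T k * XD p = XD p * T k.
Proof.
move=> h1 h2; apply: m_ext => tau v tP; rewrite !endoME !(Tm, XDm) linearD /=.
rewrite !XDm !str_pmul s_D //.
by rewrite xi_Xfar ?str_neq ?lo_neq_hi //; congr (_ + m _ _); rewrite linearZ.
Qed.

Lemma T_C1 (k : 'I_n.-1) : T k * CD (lo k) = CD (hi k) * T k.
Proof.
apply: m_ext => tau v tP; rewrite !endoME !(Tm, CDm) linearD /=.
rewrite !CDm !str_pmul s_hi.
by rewrite (xi_C1 (str_neq tau (lo_neq_hi k))); congr (_ + m _ _); rewrite linearZ.
Qed.

Lemma T_C2 (k : 'I_n.-1) : T k * CD (hi k) = CD (lo k) * T k - sc e * (CD (lo k) - CD (hi k)).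
Proof.
apply: m_ext => tau v tP; rewrite !(endoDE, endoNE, endoME, scD, endo1E).
rewrite !(Tm, CDm) linearD /= !CDm !str_pmul s_lo -mB -mZ.
rewrite addrAC -mB (xi_C2 (str_neq tau (lo_neq_hi k)) (aP k tP)).
by congr (_ + m _ _); rewrite linearZ.
Qed.

Lemma T_Cfar (k : 'I_n.-1) p : p != lo k -> p != hi k -> T k * CD p = CD p * T k.
Proof.
move=> h1 h2; apply: m_ext => tau v tP; rewrite !endoME !(Tm, CDm) linearD /=.
rewrite !CDm !str_pmul s_D //.
by rewrite xi_Cfar ?str_neq ?lo_neq_hi //; congr (_ + m _ _); rewrite linearZ.
Qed.

Lemma T_relH (f g : endo D) : (forall f g, relA XD YD CD f g -> f = g) ->
  relH e T XD YD CD f g -> f = g.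
Proof.
move=> hA [f' g' /hA//|k|k l kl|k l kl|k|k|k p h1 h2|k|k|k p h1 h2].
- exact: T_quadratic.
- exact: T_far.
- exact: T_braid.
- exact: T_X1.
- exact: T_X2.
- exact: T_Xfar.
- exact: T_C1.
- exact: T_C2.
- exact: T_Cfar.
Qed.

End Relations.
End SeminormalForm.

(** * Boxes and standard tableaux *)

Section Shapes.
Local Open Scope nat_scope.

Lemma sumn_ge_sum (s : seq nat) k : \sum_(i < k) nth 0 s i <= sumn s.
Proof.
elim: s k => [|x s IH] [|k]; rewrite ?big_ord0 //.
  by rewrite big1 // => i _; rewrite nth_nil.
by rewrite big_ord_recl /= leq_add2l; apply: IH.
Qed.

Lemma sumn_ge_le (s : seq nat) (f : nat -> nat) k :
  (forall i, i < k -> f i <= nth 0 s i) -> \sum_(i < k) f i <= sumn s.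
Proof.
by move=> h; apply: leq_trans (sumn_ge_sum s k); apply: leq_sum => i _; apply: h.
Qed.

Lemma part_nth s i j : is_part s -> i <= j -> nth 0 s j <= nth 0 s i.
Proof.
move=> /andP[so _] ij; have [js|js] := ltnP j (size s); last by rewrite nth_default.
have tr : transitive geq by move=> x y z /= h1 h2; apply: leq_trans h2 h1.
exact: (sorted_leq_nth tr leqnn 0 so i j (leq_ltn_trans ij js) js ij).
Qed.

(** Equivalently, the right ends i + nth 0 s i of the shifted rows weakly decrease, which is what
    [inb_down] needs. *)
Lemma strict_part_nth s i j : is_strict_part s -> i <= j -> 0 < nth 0 s j ->
  nth 0 s j + (j - i) <= nth 0 s i.
Proof.
move=> /andP[so _]; elim: j => [|j IH] ij sj.
  by move: ij; rewrite leqn0 => /eqP ->; rewrite addn0.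
have js : j.+1 < size s by rewrite ltnNge; apply: contraTN sj => h; rewrite nth_default.
have tr : transitive gtn by move=> x y z /= h1 h2; apply: ltn_trans h2 h1.
have h := sorted_ltn_nth tr 0 so j j.+1 (ltnW js) js (leqnn _).
rewrite /= in h; have [->|nij] := eqVneq i j.+1; first by rewrite subnn addn0.
have ij' : i <= j by move: ij; rewrite leq_eqVlt (negPf nij).
have := IH ij' (leq_ltn_trans (leq0n _) h); lia.
Qed.

Lemma sumn_ge_two (s : seq nat) i j : i < j -> nth 0 s i + nth 0 s j <= sumn s.
Proof.
move=> ij; apply: leq_trans (sumn_ge_sum s j.+1).
rewrite big_ord_recr /= leq_add2r.
by rewrite (bigD1 (Ordinal ij)) //= leq_addr.
Qed.

(** The first row up to column j and the first column up to row i lie in the diagram and share one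
    box. *)
Lemma part_hook s i j : is_part s -> j < nth 0 s i -> (i + j < sumn s).
Proof.
move=> ps h; pose f k := if k == 0 then j.+1 else 1.
have := @sumn_ge_le s f i.+1; rewrite big_ord_recl /=.
rewrite (eq_bigr (fun=> 1)) // sum_nat_const card_ord muln1 addSnnS addnC => -> //.
move=> k ki; rewrite /f; have := @part_nth s k i ps ki; have := part_nth ps (leq0n i).
by case: k ki => [|k] ki /=; lia.
Qed.

(* The three bounds count a hook through both boxes, the two rows, and the two columns. *)
Lemma part_incomp s i j i' j' : is_part s -> i < i' -> j' < j ->
  j < nth 0 s i -> j' < nth 0 s i' ->
  [/\ j + i' < sumn s, j + j' + 2 <= sumn s & i + i' + 2 <= sumn s].
Proof.
move=> ps ii jj h h'; have s0 := part_nth ps (leq0n i).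
split; last first.
- pose f k := if k <= i then 2 else 1.
  have := @sumn_ge_le s f i'.+1.
  rewrite (_ : \sum_(k < i'.+1) f k = i'.+1 + i.+1).
    move=> hs; have : i'.+1 + i.+1 <= sumn s; last by lia.
    apply: hs => k ki; rewrite /f; have := part_nth ps (ki : k <= i').
    by case: (leqP k i) => [ki'|ki'] p1; [have := part_nth ps ki'|]; lia.
  rewrite (eq_bigr (fun k : 'I_i'.+1 => 1 + (k <= i))); last by move=> k _; rewrite /f; case: leqP.
  rewrite big_split /= sum_nat_const card_ord muln1; congr addn.
  rewrite -(subnKC (ltnW ii : i.+1 <= i'.+1)) big_split_ord /=.
  rewrite [X in _ + X]big1 ?addn0 => [|k _]; last by rewrite leqNgt ltnS leq_addr.
  by rewrite (eq_bigr (fun=> 1)) ?sum_nat_const ?card_ord ?muln1 // => k _; rewrite -ltnS ltn_ord.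
- by have := sumn_ge_two s ii; lia.
pose f k := if k == 0 then j.+1 else 1.
have := @sumn_ge_le s f i'.+1; rewrite big_ord_recl /=.
rewrite (eq_bigr (fun=> 1)) // sum_nat_const card_ord muln1 addSn => -> //.
move=> k ki; rewrite /f; have := @part_nth s k i' ps ki.
by case: k ki => [|k] ki /=; lia.
Qed.

Lemma nth_le_sumn (s : seq nat) i : (nth 0 s i <= sumn s)%N.
Proof.
have := sumn_ge_sum s i.+1; rewrite big_ord_recr /=; apply: leq_trans.
by rewrite leq_addl.
Qed.

End Shapes.

(** * Boxes of a multipartition and their relative positions *)

Section Boxes.
Local Open Scope nat_scope.
Variables (b : cyc) (m n : nat) (lam : mpart b m n).
Local Notation label := (label b m).
Local Notation box := (box b m).
Implicit Types (x y : box) (c : label).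

Lemma mem_labels c : c \in labels b m.
Proof.
by rewrite mem_cat; case: c => k; apply/orP; [left|right]; apply: map_f; rewrite mem_enum.
Qed.

Lemma uniq_labels : uniq (labels b m).
Proof.
have i1 : injective (@inl 'I_(nstrict b) 'I_m) by move=> ? ? [].
have i2 : injective (@inr 'I_(nstrict b) 'I_m) by move=> ? ? [].
rewrite cat_uniq (map_inj_uniq i1) (map_inj_uniq i2) !enum_uniq andbT /=.
by apply/hasPn => c /mapP[k _ ->]; apply/negP => /mapP[k' _].
Qed.

(* In a shifted component [row_start c i = i], so [inb] bounds the column from below too. *)
Definition inb x := (row_start x.2 x.1.1 <= x.1.2) &&
  (x.1.2 < row_start x.2 x.1.1 + nth 0 (lam x.2) x.1.1).

Lemma mem_boxes x : (x \in boxes lam) = inb x.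
Proof.
case: x => [[i j] c]; rewrite /inb /=; apply/flatten_mapP/idP => [[c' _] /flatten_mapP[i' _]|h].
  by case/mapP => j'; rewrite mem_iota => h [-> -> ->].
exists c; first exact: mem_labels.
apply/flatten_mapP; exists i.
  rewrite mem_iota add0n /= ltnNge; apply: contraTN h => h.
  by rewrite nth_default // addn0; lia.
by apply/mapP; exists j => //; rewrite mem_iota.
Qed.

Lemma lam_part (k : 'I_m) : is_part (lam (inr k)).
Proof. by have /and3P[_ /forallP h _] := mpart_ok lam. Qed.
Lemma lam_strict (k : 'I_(nstrict b)) : is_strict_part (lam (inl k)).
Proof. by have /and3P[/forallP h _ _] := mpart_ok lam. Qed.
Lemma lam_sum : \sum_(c <- labels b m) sumn (lam c) = n.
Proof. by have /and3P[_ _ /eqP h] := mpart_ok lam. Qed.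

Lemma sumn_le c : sumn (lam c) <= n.
Proof. by rewrite -{2}lam_sum (big_rem c) ?mem_labels //= leq_addr. Qed.

Lemma sumn_le2 c c' : c != c' -> sumn (lam c) + sumn (lam c') <= n.
Proof.
move=> cc; rewrite -{3}lam_sum (big_rem c) ?mem_labels //= leq_add2l.
rewrite (big_rem c') /= ?leq_addr // rem_filter ?uniq_labels // mem_filter /=.
by rewrite eq_sym cc mem_labels.
Qed.

(** The last hypothesis keeps the box from falling left of the diagonal in a shifted component. *)
Lemma inb_down i j i' j' c : inb (i', j', c) -> i <= i' -> j <= j' ->
  row_start c i <= j -> inb (i, j, c).
Proof.
rewrite /inb /= => /andP[h1 h2] ii jj -> /=; case: c h1 h2 => k /= h1 h2.
  have h : 0 < nth 0 (lam (inl k)) i' by lia.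
  by have := strict_part_nth (lam_strict k) ii h; lia.
by have := part_nth (lam_part k) ii; lia.
Qed.

Definition ple x y := [&& x.2 == y.2, x.1.1 <= y.1.1 & x.1.2 <= y.1.2].
(** One box strictly north-east of the other, the only way in which two boxes of one component
    escape [ple]. *)
Definition incomp x y :=
  (x.2 == y.2) && ((x.1.1 < y.1.1) && (y.1.2 < x.1.2) || (y.1.1 < x.1.1) && (x.1.2 < y.1.2)).
Definition rowadj x y := [&& x.2 == y.2, x.1.1 == y.1.1 & y.1.2 == x.1.2.+1].
Definition coladj x y := [&& x.2 == y.2, y.1.1 == x.1.1.+1 & x.1.2 == y.1.2].

Variant cmp_spec x y : Prop :=
| CmpComp of x.2 != y.2
| CmpIncomp of incomp x y
| CmpLe of ple x y
| CmpGe of ple y x.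

Lemma cmpP x y : cmp_spec x y.
Proof.
have [e|ne] := eqVneq x.2 y.2; last exact: CmpComp.
have : [|| incomp x y, ple x y | ple y x].
  by rewrite /incomp /ple e eqxx /=; lia.
by case/or3P; [exact: CmpIncomp | exact: CmpLe | exact: CmpGe].
Qed.

End Boxes.

Section Content.
Variables (b : cyc) (m n : nat) (lam : mpart b m n).
Local Notation label := (label b m).
Implicit Types x : box b m.

Lemma inb_strict i j k : inb lam (i, j, inl k) ->
  (i <= j)%N /\ (j - i < nth 0 (lam (inl k)) i)%N.
Proof. by rewrite /inb /=; lia. Qed.

Definition content x : int := x.1.2%:Z - x.1.1%:Z.

Lemma inb_content i j c : inb lam (i, j, c) ->
  (`|content (i, j, c)| < sumn (lam c))%N.
Proof.
case: c => k h; rewrite /content /=.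
  have [h1 h2] := inb_strict h; have := nth_le_sumn (lam (inl k)) i; lia.
have := part_hook (lam_part lam k) (i := i) (j := j).
by move: h; rewrite /inb /= add0n => -> /(_ isT); lia.
Qed.

Lemma strict_content i j k : inb lam (i, j, inl k) -> 0 <= content (i, j, inl k : label).
Proof. by move=> /inb_strict[]; rewrite /content /=; lia. Qed.

End Content.

(** * Standard tableaux and exchanges of consecutive entries *)

Section Standard.
Local Open Scope nat_scope.
Variables (b : cyc) (m n : nat) (lam : mpart b m n).
Local Notation box := (box b m).
Implicit Types (x y : box) (t u : tableau b m n).

Lemma inbP x : reflect (x \in boxes lam) (inb lam x).
Proof. by rewrite mem_boxes; apply: idP. Qed.

Section One.
Variable t : tableau b m n.
Hypothesis st : is_std lam t.

Lemma std_inj : injective t. Proof. by case: st. Qed.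

Lemma std_inb k : inb lam (t k).
Proof. by case: st => _ h _; rewrite -mem_boxes; apply/h; exists k. Qed.

Lemma std_ex x : inb lam x -> exists k, t k = x.
Proof. by case: st => _ h _; rewrite -mem_boxes => /h. Qed.

Lemma std_row k l : (t k).2 = (t l).2 -> (t k).1.1 = (t l).1.1 ->
  (t k).1.2 < (t l).1.2 -> k < l.
Proof. by case: st => _ _ h h1 h2 h3; apply: h => //; left. Qed.

Lemma std_col k l : (t k).2 = (t l).2 -> (t k).1.2 = (t l).1.2 ->
  (t k).1.1 < (t l).1.1 -> k < l.
Proof. by case: st => _ _ h h1 h2 h3; apply: h => //; right. Qed.

(** The corner (i, j') carries an entry strictly in between. The other corner (i', j) may lie left
    of the diagonal of a shifted component. *)
Lemma std_diag k l : (t k).2 = (t l).2 -> (t k).1.1 < (t l).1.1 ->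
  (t k).1.2 < (t l).1.2 -> k.+1 < l.
Proof.
move=> hc hi hj; have hk := std_inb k; have hl := std_inb l.
case ek: (t k) hc hi hj hk => [[i j] c] /=; case el: (t l) hl => [[i' j'] c'] /= hl ec ii jj hk.
subst c'; have [|p ep] := std_ex (x := (i, j', c)).
  by apply: (inb_down hl (ltnW ii) (leqnn _) _); move: hk; rewrite /inb /=; lia.
have h1 : k < p by apply: std_row; rewrite ek ep.
have h2 : p < l by apply: std_col; rewrite el ep.
exact: leq_ltn_trans h1 h2.
Qed.

Lemma std_lt k l : ple (t k) (t l) -> k != l -> k < l.
Proof.
move=> /and3P[/eqP hc]; rewrite leq_eqVlt => /orP[/eqP hi|hi];
  rewrite leq_eqVlt => /orP[/eqP hj|hj] kl.
- case/eqP: kl; apply: std_inj; move: hc hi hj.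
  by case: (t k) (t l) => [[? ?] ?] [[? ?] ?] /= -> -> ->.
- exact: std_row.
- exact: std_col.
- exact: ltnW (std_diag hc hi hj).
Qed.

Variable k : 'I_n.-1.
Let x := t (lo k).
Let y := t (hi k).

Lemma std_between p : lo k < p -> p < hi k -> False.
Proof. by move=> /= h1 h2; lia. Qed.

(** Two comparable boxes that are not adjacent have a third one between them, whose entry would lie
    strictly between two consecutive integers. *)
Lemma std_consec : [\/ x.2 != y.2, incomp x y, rowadj x y | coladj x y].
Proof.
have hx := std_inb (lo k); have hy := std_inb (hi k).
have hlt := @std_lt (hi k) (lo k).
have hd := @std_diag (lo k) (hi k).
have nxy : t (lo k) <> t (hi k) by move/std_inj/eqP; rewrite (negPf (lo_neq_hi k)).
have hb p : ((t (lo k)).2 = (t p).2 -> (t p).2 = (t (hi k)).2 ->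
   (t (lo k)).1.1 = (t p).1.1 /\ (t p).1.1 = (t (hi k)).1.1 ->
   (t (lo k)).1.2 < (t p).1.2 -> (t p).1.2 < (t (hi k)).1.2 -> False) /\
   ((t (lo k)).2 = (t p).2 -> (t p).2 = (t (hi k)).2 ->
   (t (lo k)).1.2 = (t p).1.2 /\ (t p).1.2 = (t (hi k)).1.2 ->
   (t (lo k)).1.1 < (t p).1.1 -> (t p).1.1 < (t (hi k)).1.1 -> False).
  split=> e1 e2 [e3 e4] l1 l2; apply: (@std_between p).
  - exact: std_row. - exact: std_row. - exact: std_col. - exact: std_col.
rewrite /x /y; move: hx hy hlt hd nxy hb.
case: (t (lo k)) => [[i j] c]; case: (t (hi k)) => [[i' j'] c'] /= hx hy hlt hd nxy hb.
case: (cmpP (i, j, c) (i', j', c')) => [h|h|/and3P[/eqP /= ec li lj]|h].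
- by constructor 1.
- by constructor 2.
- subst c'; have [ei|ni] := eqVneq i i'.
    subst i'; constructor 3; rewrite /rowadj /= !eqxx /=; apply/eqP; apply: contrapT => nj.
    have jj : j <> j' by move=> ej; apply: nxy; rewrite ej.
    have [|p ep] := std_ex (x := (i, j.+1, c)).
      by apply: (inb_down hy (leqnn _) _ _); move: hx; rewrite /inb /=; lia.
    by have [h1 _] := hb p; rewrite ep /= in h1; apply: h1 => //; lia.
  have ii : i < i' by lia.
  have ej : j = j' by have := hd erefl ii; lia.
  subst j'; constructor 4; rewrite /coladj /= !eqxx /= andbT; apply/eqP; apply: contrapT => ni'.
  have [|p ep] := std_ex (x := (i.+1, j, c)).
    apply: (inb_down hy _ (leqnn _) _) => //.
    by move: hx hy; rewrite /inb /=; case: (c) => ? /=; lia.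
  by have [_ h1] := hb p; rewrite ep /= in h1; apply: h1 => //; lia.
have : hi k < lo k by apply: hlt; rewrite // eq_sym lo_neq_hi.
by rewrite /=; lia.
Qed.

Definition comparable_adj := rowadj x y || coladj x y.

(** The exchange can only upset the order between the two boxes themselves, and by [std_consec]
    these share neither row nor column. *)
Lemma std_swap : ~~ comparable_adj -> is_std lam (pact (s_ k) t).
Proof.
move=> nadj; have hxy : x.2 = y.2 -> x.1.1 <> y.1.1 /\ x.1.2 <> y.1.2.
  move: nadj; rewrite /comparable_adj negb_or => /andP[n1 n2] ec.
  case: std_consec => [/eqP//||h|h]; [|by rewrite h in n1|by rewrite h in n2].
  by rewrite /incomp; lia.
have s_V p : ((s_ k)^-1)%g p = s_ k p by rewrite tpermV.
split.
- by apply: inj_comp (std_inj) _; apply: perm_inj.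
- move=> z; split=> [/inbP/std_ex[p <-]|[p <-]]; last exact/inbP/std_inb.
  by exists (s_ k p); rewrite /pact s_V tpermK.
move=> p r; rewrite /pact !s_V => ec h.
have : s_ k p < s_ k r by case: st => _ _; apply.
case: (tpermP (lo k) (hi k) p) ec h => [->|->|/eqP p1 /eqP p2];
case: (tpermP (lo k) (hi k) r) => [->|->|/eqP r1 /eqP r2] ec h //=; try lia.
- by move: (hxy ec) h; rewrite -/x -/y; lia.
all: move=> lt; try (move: (p1) (p2)); try move: (r1) (r2); rewrite -?val_eqE /=; lia.
Qed.

End One.

(** The corner of a component precedes all its other boxes; it exists in a shifted component too,
    whose row 0 starts in column 0. *)
Lemma std_first t (n_gt0 : 0 < n) : is_std lam t ->
  exists c, t (Ordinal n_gt0) = (0, 0, c).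
Proof.
move=> st; exists (t (Ordinal n_gt0)).2; have h := std_inb st (Ordinal n_gt0).
have [|p ep] := std_ex st (x := (0, 0, (t (Ordinal n_gt0)).2)).
  move: h; case: (t _) => [[i j] c] /= h.
  by apply: (inb_down h (leq0n _) (leq0n _)); case: c {h}.
rewrite -ep; congr t; apply/eqP; rewrite eq_sym; apply: contraT => np.
have := @std_lt t st p (Ordinal n_gt0); rewrite /ple ep eqxx !leq0n /= => /(_ isT np).
by rewrite ltn0.
Qed.

Lemma pairwise_flatten_map (T S : eqType) (R : rel T) (r : rel S) (f : S -> seq T) s :
  pairwise r s -> (forall a, pairwise R (f a)) ->
  (forall a c, r a c -> allrel R (f a) (f c)) -> pairwise R (flatten [seq f a | a <- s]).
Proof.
move=> + hf hr; elim: s => //= a s IH /andP[/allP ha /IH hs].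
rewrite pairwise_cat hf hs !andbT; apply/allrelP => x y xa /flatten_mapP[c cs yc].
exact: (allrelP (hr _ _ (ha _ cs))).
Qed.

(** Boxes of different components are left unrelated, as in standardness. *)
Definition reading (x y : box) :=
  (x.2 == y.2) ==> ((x.1.1 < y.1.1) || (x.1.1 == y.1.1) && (x.1.2 < y.1.2)).

Lemma boxes_reading : pairwise reading (boxes lam).
Proof.
have iota_pw i l : pairwise ltn (iota i l).
  by rewrite -sorted_pairwise ?iota_ltn_sorted //; apply: ltn_trans.
apply: (pairwise_flatten_map (r := [rel c c' | c != c'])).
- by rewrite -uniq_pairwise uniq_labels.
- move=> c; apply: pairwise_flatten_map (iota_pw _ _) _ _ => [i|i i' /= ii].
    rewrite pairwise_map; apply: sub_pairwise (iota_pw _ _) => j j' /= jj.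
    by rewrite /reading /= !eqxx jj orbT.
  by apply/allrelP => _ _ /mapP[j _ ->] /mapP[j' _ ->]; rewrite /reading /= ii eqxx.
move=> c c' /= cc; apply/allrelP => x y /flatten_mapP[i _ /mapP[j _ ->]].
by move=> /flatten_mapP[i' _ /mapP[j' _ ->]]; rewrite /reading /= (negPf cc).
Qed.

Lemma t_lam_nth x0 k : t_lam lam k = nth x0 (boxes lam) k.
Proof. by rewrite /t_lam (tnth_nth x0). Qed.

Lemma t_lam_std : is_std lam (t_lam lam).
Proof.
have rd (k l : 'I_n) : k < l -> reading (t_lam lam k) (t_lam lam l).
  move=> kl; have nE := t_lam_nth (t_lam lam k).
  have := boxes_reading => /(pairwiseP (t_lam lam k)) h.
  rewrite (nE l) [X in reading X _](nE k).
  by apply: h => //; rewrite inE size_boxes /= ltn_ord.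
have inj : injective (t_lam lam).
  move=> k l e; apply: val_inj; apply/eqP.
  have ir x : reading x x = false by rewrite /reading eqxx !ltnn eqxx.
  by case: (ltngtP k l) => // /rd; rewrite e ir.
split=> // [x|k l ec h].
  split=> [xb|[k <-]].
    have xs : index x (boxes lam) < n by rewrite -[X in _ < X](size_boxes lam) index_mem.
    by exists (Ordinal xs); rewrite (t_lam_nth x) nth_index.
  by rewrite (t_lam_nth (t_lam lam k)) mem_nth // size_boxes.
case: (ltngtP k l) => // [/rd|e].
  by rewrite /reading ec eqxx /=; lia.
by have ekl : k = l by [apply: val_inj]; move: h; rewrite ekl; lia.
Qed.

Lemma in_P_std tau : in_P lam tau -> is_std lam (pact tau (t_lam lam)).
Proof.
have eqt (f g : tableau b m n) : f =1 g -> is_std lam f -> is_std lam g.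
  by move=> /funext ->.
elim=> [|sigma i _ _ h].
  by apply: eqt t_lam_std => k; rewrite /pact invg1 perm1.
by apply: eqt h => k; rewrite /pact /pmul invMg permM.
Qed.

Lemma P_std tau : tau \in P_set lam -> is_std lam (pact tau (t_lam lam)).
Proof. by rewrite inE => /asboolP /in_P_std. Qed.

Lemma pact_pmul tau i : pact (pmul (s_ i) tau) (t_lam lam) = pact (s_ i) (pact tau (t_lam lam)).
Proof. by apply: funext => k; rewrite /pact /pmul invMg permM. Qed.

Lemma P_swap tau i : tau \in P_set lam ->
  is_std lam (pact (s_ i) (pact tau (t_lam lam))) -> pmul (s_ i) tau \in P_set lam.
Proof. by rewrite !inE => /asboolP h hs; apply/asboolP/in_PS. Qed.

End Standard.

Lemma mem_zrange (a c t : int) : (t \in zrange a c) = (a <= t <= c).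
Proof.
rewrite /zrange; case: ifP => ac; last by rewrite in_nil; lia.
apply/mapP/idP => [[k]|/andP[h1 h2]]; first by rewrite mem_iota => h ->; lia.
by exists `|t - a|%N; rewrite ?mem_iota; lia.
Qed.

(** * Separation of residues *)

Section Residues.
Variables (K : fieldType) (two_neq0 : 2 != 0 :> K).
Variables (q : K) (q_neq0 : q != 0) (q_sum : q + q^-1 != 0).

(** The values agree when q x and q y are equal or inverse: their difference is proportional to (x -
    y)(q^2 x y - 1). *)
Lemma qfun_eq x y : x != 0 -> y != 0 -> qfun q x = qfun q y ->
  x = y \/ x * y * q ^ 2 = 1.
Proof.
move=> x0 y0; rewrite /qfun => /(mulIf (invr_neq0 q_sum)) /(mulfI two_neq0) e.
have : (x - y) * (x * y * q ^ 2 - 1) = 0.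
  transitivity (q * x * y * ((q * x + (q * x)^-1) - (q * y + (q * y)^-1))).
    by field; rewrite q_neq0 x0 y0.
  by rewrite e subrr mulr0.
move/eqP; rewrite mulf_eq0 !subr_eq0 => /orP[/eqP ->|/eqP ->]; by [left|right].
Qed.

Variables (b : cyc) (m n : nat) (Q : 'I_m -> K).
Hypothesis Q_neq0 : forall i, Q i != 0.
Hypothesis P_neq0 : Ppoly n q Q b != 0.

Let Rne : Rpoly n q Q != 0.
Proof. by move: P_neq0; rewrite /Ppoly; case: b; rewrite mulf_eq0 negb_or => /andP[]. Qed.

Lemma q_pow_nat t : (0 < t <= n)%N -> q ^+ (2 * t) != 1.
Proof.
move=> ht; have ht' : t \in index_iota 1 n.+1 by rewrite mem_index_iota ltnS.
move: P_neq0; rewrite /Ppoly; case: b; rewrite mulf_eq0 negb_or => /andP[];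
  rewrite prodf_seq_neq0 => /allP/(_ _ ht') /= h _; move: h.
- by rewrite subr_eq0.
- by rewrite mulf_eq0 negb_or subr_eq0 => /andP[].
- by rewrite mulf_eq0 negb_or subr_eq0 => /andP[].
Qed.

Lemma q_pow_natN t : b <> cyc0 -> (0 < t <= n)%N -> q ^+ (2 * t) != -1.
Proof.
move=> nb ht; have ht' : t \in index_iota 1 n.+1 by rewrite mem_index_iota ltnS.
move: nb P_neq0; rewrite /Ppoly; case: b => // _; rewrite mulf_eq0 negb_or => /andP[];
  rewrite prodf_seq_neq0 => /allP/(_ _ ht') /= h _; move: h;
  by rewrite mulf_eq0 negb_or => /andP[_]; rewrite addr_eq0.
Qed.

Lemma q_pow (t : int) : t != 0 -> - n%:Z <= t <= n%:Z -> q ^ (2 * t) != 1.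
Proof.
case: t => k; rewrite ?NegzE => k0 hk.
  by apply: (@q_pow_nat k); lia.
by rewrite mulrN -invr_expz invr_eq1; apply: (@q_pow_nat k.+1); lia.
Qed.

Lemma q_powN (t : int) : b <> cyc0 -> t != 0 -> - n%:Z <= t <= n%:Z -> q ^ (2 * t) != -1.
Proof.
case: t => k; rewrite ?NegzE => nb k0 hk.
  by apply: (@q_pow_natN k) => //; lia.
rewrite mulrN -invr_expz (can2_eq (@invrK K) (@invrK K)) invrN1.
by apply: (@q_pow_natN k.+1) => //; lia.
Qed.

Lemma Q_sq k (t : int) : 3 - n%:Z <= t <= n%:Z - 1 -> Q k ^+ 2 != q ^ (- 2 * t).
Proof.
move=> ht; move: Rne; rewrite /Rpoly mulf_eq0 negb_or => /andP[/prodf_neq0/(_ k isT) + _].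
rewrite mulf_eq0 negb_or => /andP[]; rewrite prodf_seq_neq0 => /allP/(_ t) + _.
by rewrite mem_zrange ht /= subr_eq0; apply.
Qed.

Lemma Q_sq4 k (t : int) : 1 - n%:Z <= t <= n%:Z -> Q k ^+ 2 != q ^ (- 4 * t).
Proof.
move=> ht; move: Rne; rewrite /Rpoly mulf_eq0 negb_or => /andP[/prodf_neq0/(_ k isT) + _].
rewrite mulf_eq0 negb_or => /andP[_]; rewrite prodf_seq_neq0 => /allP/(_ t) +.
by rewrite mem_zrange ht /= subr_eq0; apply.
Qed.

Lemma Q_pair (k k' : 'I_m) (t : int) : k != k' -> 1 - n%:Z <= t <= n%:Z - 1 ->
  Q k != Q k' * q ^ (- 2 * t) /\ Q k * Q k' != q ^ (- 2 * (t + 1)).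
Proof.
have aux (i i' : 'I_m) (u : int) : (i < i')%N -> 1 - n%:Z <= u <= n%:Z - 1 ->
    Q i != Q i' * q ^ (- 2 * u) /\ Q i * Q i' != q ^ (- 2 * (u + 1)).
  move=> ii hu; move: Rne; rewrite /Rpoly mulf_eq0 negb_or => /andP[_ /prodf_neq0/(_ i isT)].
  move=> /prodf_neq0/(_ i' ii); rewrite prodf_seq_neq0 => /allP/(_ u).
  by rewrite mem_zrange hu /= mulf_eq0 negb_or !subr_eq0 => /(_ isT)/andP[].
move=> kk ht; case: (ltngtP k k') => [lt|gt|e].
- exact: aux.
(* The factors are indexed by ordered pairs; in the opposite order the first one is used at -t, the
   range of t being symmetric. *)
- have [_ h2] := aux _ _ t gt ht; have [|h1 _] := aux _ _ (- t) gt; first by lia.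
  split; last by rewrite mulrC.
  apply: contraNneq h1 => ->; rewrite -mulrA -expfzDr //.
  by rewrite (_ : _ + _ = 0) ?expr0z ?mulr1 //; lia.
by case/eqP: kk; apply: val_inj.
Qed.

Variable lam : mpart b m n.
Local Notation label := (label b m).
Local Notation box := (box b m).
Implicit Types (x y : box).
Local Notation rs := (box_res q Q).

Lemma rsE x : rs x = Q_label Q x.2 * q ^ (2 * content x). Proof. by []. Qed.

Lemma Q_label_sq (k : 'I_(nstrict b)) : @Q_label b m K Q (inl k) ^+ 2 = 1.
Proof.
by rewrite /Q_label; case: (b) k => k; rewrite ?expr1n //; case: ifP;
  rewrite ?sqrrN expr1n.
Qed.

Lemma Q_label_neq0 (c : label) : Q_label Q c != 0.
Proof.
case: c => k; last exact: Q_neq0.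
by rewrite -sqrf_eq0 Q_label_sq oner_eq0.
Qed.

Lemma rs_neq0 x : rs x != 0.
Proof. by rewrite mulf_neq0 ?Q_label_neq0 ?expfz_neq0. Qed.

Lemma rs_eq x y : qfun q (rs x) = qfun q (rs y) ->
  Q_label Q x.2 = Q_label Q y.2 * q ^ (2 * (content y - content x)) \/
  Q_label Q x.2 * Q_label Q y.2 = q ^ (- 2 * (content x + content y + 1)).
Proof.
have qz (z : int) : q ^ z != 0 by rewrite expfz_neq0.
move=> /(qfun_eq (rs_neq0 x) (rs_neq0 y))[]; rewrite !rsE => e; [left|right].
  apply: (mulIf (qz (2 * content x))); rewrite e -mulrA -expfzDr //.
  by congr (_ * q ^ _); lia.
move: e; set u := content x; set v := content y => e.
apply: (mulIf (qz (2 * (u + v + 1)))); rewrite -expfzDr //.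
have -> : -2 * (u + v + 1) + 2 * (u + v + 1) = 0 by lia.
have -> : 2 * (u + v + 1) = 2 * u + 2 * v + 2 by lia.
rewrite expr0z -[RHS]e !expfzDr //.
by move: (q ^ (2 * u)) (q ^ (2 * v)) (q ^ 2) => A B' C'; ring.
Qed.

Lemma nstrict_cyc (k : 'I_(nstrict b)) : b <> cyc0.
Proof. by case: (b) k => // -[]. Qed.

Lemma Q_label_ne (k k' : 'I_(nstrict b)) : k != k' ->
  @Q_label b m K Q (inl k) = - @Q_label b m K Q (inl k').
Proof.
rewrite /Q_label; case: (b) k k' => [[]//|k k'|]; first by rewrite !ord1 eqxx.
by case=> [[|[|k]] hk] // [[|[|k']] hk'] //= _; rewrite opprK.
Qed.

Lemma q4 (t : int) : b <> cyc0 -> t != 0 -> - n%:Z <= t <= n%:Z -> q ^ (4 * t) != 1.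
Proof.
move=> nb t0 ht; rewrite (_ : 4 * t = (2 * t) * 2); last by lia.
rewrite -exprz_exp -[_ ^ 2]/(_ ^+ 2) sqrf_eq1 negb_or q_pow //.
exact: q_powN.
Qed.

Lemma sq_exp (z : int) : (q ^ z) ^+ 2 = q ^ (2 * z).
Proof. by rewrite -[_ ^+ 2]/(_ ^ 2) exprz_exp mulrC. Qed.

Local Notation Ql c := (@Q_label b m K Q c).

(** The conclusion of [rs_eq] in terms of labels and contents, which leaves only integer bounds on
    the contents to be checked. *)
Definition coincide (c c' : label) (u v : int) : Prop :=
  Ql c = Ql c' * q ^ (2 * (v - u)) \/ Ql c * Ql c' = q ^ (- 2 * (u + v + 1)).

(** The labels are 1 and -1, so either alternative makes a power of q^2 equal to -1; the zeroth
    power is excluded by the characteristic. *)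
Lemma coincide_ss k k' (u v : int) : k != k' -> 0 <= u -> 0 <= v -> u + v + 2 <= n%:Z ->
  ~ coincide (inl k) (inl k') u v.
Proof.
move=> kk u0 v0 uv; have nb := nstrict_cyc k; have h0 := Q_label_neq0 (inl k').
rewrite /coincide (Q_label_ne kk) => -[]e.
  have : q ^ (2 * (v - u)) = -1 by apply: (mulfI h0); rewrite -e mulrN1.
  have [->|dd] := eqVneq u v.
    rewrite subrr mulr0 expr0z => /eqP; rewrite -addr_eq0 -mulr2n.
    by rewrite (negPf two_neq0).
  by apply/eqP/q_powN => //; lia.
have : q ^ (2 * (- (u + v + 1))) = -1.
  by rewrite mulrN -mulNr -e mulNr -expr2 Q_label_sq.
by apply/eqP/q_powN => //; lia.
Qed.

(** Squaring removes the sign of the shifted label and leaves Q_k'^2 = q^(-4t), with t = v - u or t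
    = u + v + 1. *)
Lemma coincide_so k k' (u v : int) : 0 <= u -> `|u| + `|v| + 2 <= n%:Z ->
  ~ coincide (inl k) (inr k') u v.
Proof.
move=> u0 uv [] e; have e2 := congr1 (fun z => z ^+ 2) e.
  have /eqP[] := @Q_sq4 k' (v - u) ltac:(lia).
  move: e2; rewrite /= Q_label_sq exprMn sq_exp => e2.
  apply: (mulIf (expfz_neq0 (2 * (2 * (v - u))) q_neq0)).
  rewrite -e2 -expfzDr //; have -> : - 4 * (v - u) + 2 * (2 * (v - u)) = 0 by lia.
  by rewrite expr0z.
have /eqP[] := @Q_sq4 k' (u + v + 1) ltac:(lia).
move: e2; rewrite /= exprMn Q_label_sq sq_exp mul1r => ->.
by congr (q ^ _); lia.
Qed.

Lemma coincide_oo k k' (u v : int) : k != k' -> `|u| + `|v| + 2 <= n%:Z ->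
  ~ coincide (inr k) (inr k') u v.
Proof.
move=> kk uv [] e.
  have /eqP[] := (@Q_pair k k' (u - v) kk ltac:(lia)).1.
  by rewrite [LHS]e; congr (_ * q ^ _); lia.
have /eqP[] := (@Q_pair k k' (u + v) kk ltac:(lia)).2.
by rewrite [LHS]e; congr (q ^ _); lia.
Qed.

Lemma sep_comp x y : inb lam x -> inb lam y -> x.2 != y.2 ->
  qfun q (rs x) <> qfun q (rs y).
Proof.
case: x y => [[i j] c] [[i' j'] c'] hx hy /= cc /rs_eq.
rewrite -/(coincide _ _ _ _) /=.
(* Each content is smaller in absolute value than the size of its component, and the two sizes add
   up to at most n. *)
have lx := inb_content hx; have ly := inb_content hy; have ss := sumn_le2 lam cc.
case: c c' cc hx hy lx ly ss => k [] k' cc hx hy lx ly ss.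
- have d0 := strict_content hx; have d0' := strict_content hy.
  by apply: coincide_ss => //; move: lx ly ss d0 d0'; lia.
- by have d0 := strict_content hx; apply: coincide_so => //; lia.
- have d0 := strict_content hy => h.
  apply: (@coincide_so k' k (content (i', j', inl k' : label))
    (content (i, j, inr k : label))) => //; first by lia.
  case: h => e; [left|right]; last by rewrite mulrC e; congr (q ^ _); lia.
  rewrite e -mulrA -expfzDr // (_ : _ + _ = 0) ?expr0z ?mulr1 //; lia.
- by apply: coincide_oo => //; lia.
Qed.

(** For contents differing by 1, u + v + 1 is twice the larger one and may exceed n; the equation is
    then q^(4t) = 1 up to sign of t, with 0 < t < n, which the factors q^(2t) - 1 and q^(2t) + 1
    together exclude. *)
Lemma coincide_same_s k (u v : int) : u != v -> 0 <= u -> 0 <= v ->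
  u + v + 2 <= n%:Z \/ (u = v + 1 \/ v = u + 1) /\ u < n%:Z /\ v < n%:Z ->
  ~ coincide (inl k) (inl k) u v.
Proof.
move=> uv u0 v0 h [] e; have nb := nstrict_cyc k.
  have : q ^ (2 * (v - u)) = 1 by apply: (mulfI (Q_label_neq0 (inl k))); rewrite -e mulr1.
  by apply/eqP/q_pow; lia.
move: e; rewrite -expr2 Q_label_sq => e.
case: h => [h|[h [h1 h2]]].
  have : q ^ (2 * (- (u + v + 1))) = 1 by rewrite mulrN -mulNr -e.
  by apply/eqP/q_pow; lia.
case: h => h.
  have : q ^ (4 * - u) = 1 by rewrite [RHS]e; congr (q ^ _); lia.
  by apply/eqP/q4 => //; lia.
have : q ^ (4 * - v) = 1 by rewrite [RHS]e; congr (q ^ _); lia.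
by apply/eqP/q4 => //; lia.
Qed.

(** Two families of factors enter: contents differing by 1 again give u + v + 1 = 2 max(u, v) and
    are covered by Q_k^2 <> q^(-4t); otherwise Q_k^2 <> q^(-2t) applies, with t = u + v + 1 in its
    range. *)
Lemma coincide_same_o k (u v : int) : u != v -> - n%:Z <= v - u <= n%:Z ->
  3 - n%:Z <= u + v + 1 <= n%:Z - 1 \/
  (u = v + 1 \/ v = u + 1) /\ `|u| < n%:Z /\ `|v| < n%:Z ->
  ~ coincide (inr k) (inr k) u v.
Proof.
move=> uv duv h [] e.
  have : q ^ (2 * (v - u)) = 1 by apply: (mulfI (Q_label_neq0 (inr k))); rewrite -e mulr1.
  by apply/eqP/q_pow; lia.
move: e; rewrite -expr2 /= => e.
case: h => [h|[h [h1 h2]]].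
  by have /eqP[] := @Q_sq k (u + v + 1) h.
case: h => h.
  have /eqP[] := @Q_sq4 k u ltac:(lia).
  by rewrite [LHS]e; congr (q ^ _); lia.
have /eqP[] := @Q_sq4 k v ltac:(lia).
by rewrite [LHS]e; congr (q ^ _); lia.
Qed.

Lemma sep_incomp_aux i j i' j' c : inb lam (i, j, c) -> inb lam (i', j', c) ->
  (i < i')%N -> (j' < j)%N -> qfun q (rs (i, j, c)) <> qfun q (rs (i', j', c)).
Proof.
move=> hx hy ii jj /rs_eq; rewrite -/(coincide _ _ _ _) /=.
have ss := sumn_le lam c; case: c hx hy ss => k hx hy ss.
  have [h1 h2] := inb_strict hx; have [h3 h4] := inb_strict hy.
  have h5 := sumn_ge_two (lam (inl k)) ii.
  by apply: coincide_same_s; rewrite /content /=; try left; lia.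
move: hx hy; rewrite /inb /= !add0n => h1 h2.
have [h3 h4 h5] := part_incomp (lam_part lam k) ii jj h1 h2.
by apply: coincide_same_o; rewrite /content /=; try left; lia.
Qed.

Lemma sep_incomp x y : inb lam x -> inb lam y -> incomp x y ->
  qfun q (rs x) <> qfun q (rs y).
Proof.
case: x y => [[i j] c] [[i' j'] c'] hx hy /andP[/eqP /= ec]; subst c'.
by case/orP=> /andP[h1 h2]; [|apply/nesym]; apply: sep_incomp_aux.
Qed.

Lemma sep_adj x y : inb lam x -> inb lam y -> rowadj x y || coladj x y ->
  qfun q (rs x) <> qfun q (rs y).
Proof.
case: x y => [[i j] c] [[i' j'] c'] hx hy adj.
have ec : c = c' by move: adj; rewrite /rowadj /coladj /=; case: eqP.
subst c'; move: adj; rewrite /rowadj /coladj /= eqxx /= => adj /rs_eq.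
rewrite -/(coincide _ _ _ _) /=.
have lx := inb_content hx; have ly := inb_content hy; have ss := sumn_le lam c.
case: c hx hy lx ly ss => k hx hy lx ly ss.
  have d0 := strict_content hx; have d0' := strict_content hy.
  by apply: coincide_same_s; move: lx ly d0 d0'; rewrite /content /=; try right; lia.
by apply: coincide_same_o; move: lx ly; rewrite /content /=; try right; lia.
Qed.

End Residues.

(** * Residues along standard tableaux *)

Section TableauResidues.
Variables (K : fieldType) (two_neq0 : 2 != 0 :> K).
Variables (q : K) (q_neq0 : q != 0) (q_sum : q + q^-1 != 0).
Variables (b : cyc) (m n : nat) (Q : 'I_m -> K).
Hypothesis Q_neq0 : forall i, Q i != 0.
Hypothesis P_neq0 : Ppoly n q Q b != 0.
Variable lam : mpart b m n.
Implicit Types (t u : tableau b m n) (k l : 'I_n.-1).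

Local Notation rs := (box_res q Q).
Local Notation qres t k := (qfun q (rs (t k))).
Local Notation eps := (q - q^-1).

Let sepc := sep_comp two_neq0 q_neq0 q_sum Q_neq0 P_neq0.
Let sepi := sep_incomp two_neq0 q_neq0 q_sum Q_neq0 P_neq0.
Let sepa := sep_adj two_neq0 q_neq0 q_sum Q_neq0 P_neq0.

Let s0 : q ^+ 2 + 1 != 0.
Proof.
apply: contraNneq q_sum => h; apply/eqP/(mulfI q_neq0).
by rewrite mulr0 mulrDr divff // -expr2 h.
Qed.

Lemma qres_neq t k : is_std lam t -> qres t (lo k) != qres t (hi k).
Proof.
move=> st; apply/eqP; have hx := std_inb st (lo k); have hy := std_inb st (hi k).
case: (std_consec st k) => h.
- exact: sepc hx hy h.
- exact: sepi hx hy h.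
- by apply: (sepa hx hy); rewrite h.
- by apply: (sepa hx hy); rewrite h orbT.
Qed.

Lemma rs_rowadj (x y : box b m) : rowadj x y -> rs y = rs x * q ^ 2.
Proof.
case: x y => [[i j] c] [[i' j'] c'] /and3P[/eqP /= <- /eqP /= <- /eqP /= ->].
by rewrite /box_res /= -mulrA -expfzDr //; congr (_ * q ^ _); lia.
Qed.

Lemma rs_coladj (x y : box b m) : coladj x y -> rs x = rs y * q ^ 2.
Proof.
case: x y => [[i j] c] [[i' j'] c'] /and3P[/eqP /= <- /eqP /= -> /eqP /= ->].
by rewrite /box_res /= -mulrA -expfzDr //; congr (_ * q ^ _); lia.
Qed.

(** For residues in ratio q^2, as for adjacent boxes, eps^2 (a a' - 4) equals (a - a')^2. *)
Lemma om2_zero z : z != 0 -> qfun q z != qfun q (z * q ^ 2) ->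
  om2 eps (qfun q z) (qfun q (z * q ^ 2)) = 0.
Proof.
move=> z0 ne; have d0 : qfun q z - qfun q (z * q ^ 2) != 0 by rewrite subr_eq0.
have key : (qfun q z - qfun q (z * q ^ 2)) ^+ 2 = eps ^+ 2 * (qfun q z * qfun q (z * q ^ 2) - 4).
  rewrite /qfun -[q ^ 2]/(q ^+ 2); field; rewrite ?q_neq0 ?z0 ?s0 //.
by rewrite /om2 mulrA -key mulfV ?subrr // expf_neq0.
Qed.

Lemma om2C (f x y : K) : om2 f x y = om2 f y x.
Proof. by rewrite /om2 mulrC [x * y]mulrC -[y - x]opprB sqrrN [in RHS]mulrC. Qed.

Lemma om2_adj t k : is_std lam t -> comparable_adj t k ->
  om2 eps (qres t (lo k)) (qres t (hi k)) = 0.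
Proof.
move=> st; have ne := qres_neq k st; have r0 := rs_neq0 q_neq0 (b := b) Q_neq0.
case/orP => [/rs_rowadj|/rs_coladj] h; move: ne; rewrite h => ne.
  exact: om2_zero.
by rewrite om2C; apply: om2_zero; rewrite // eq_sym.
Qed.

Definition defect x y z : K := y ^+ 3 - x * y * z + 4 * (x + z) - 8 * y.

Lemma defect_zero z : z != 0 ->
  defect (qfun q z) (qfun q (z * q ^ 2)) (qfun q (z * q ^ 2 * q ^ 2)) = 0.
Proof.
move=> z0.
by rewrite /defect /qfun -[q ^ 2]/(q ^+ 2); field; rewrite ?q_neq0 ?z0 ?s0.
Qed.

Lemma qfun_unit s : s ^+ 2 = 1 -> qfun q s = 2 * s.
Proof.
move=> s2; have si : s^-1 = s.
  have sn0 : s != 0 by rewrite -sqrf_eq0 s2 oner_eq0.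
  by apply: (mulfI sn0); rewrite divff // -expr2 s2.
by rewrite /qfun invfM si -mulrDl mulrA mulrAC mulfK.
Qed.

Lemma defectC x y z : defect x y z = defect z y x.
Proof. by rewrite /defect; ring. Qed.

Lemma lo_eq_hi k l : l = k.+1 :> nat -> lo l = hi k.
Proof. by move=> kl; apply: val_inj; rewrite /= kl. Qed.

Lemma s_V k p : ((s_ k)^-1)%g p = s_ k p.
Proof. by rewrite tpermV. Qed.

(** If one of the two exchanges gave a standard tableau, the outer boxes would carry consecutive
    entries there, and [qres_neq] would separate them. *)
Lemma braid_adj t k l : l = k.+1 :> nat -> is_std lam t ->
  qres t (lo k) = qres t (hi l) -> comparable_adj t k /\ comparable_adj t l.
Proof.
move=> kl st ea; have el := lo_eq_hi kl.
have [h1 h2 h3] : [/\ lo k != hi k, lo k != hi l & hi k != hi l].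
  by rewrite -!val_eqE /= kl; split; lia.
split; apply: contraT => /(std_swap st) st'.
  have := qres_neq l st'; rewrite /pact !s_V el s_hi.
  by rewrite s_D 1?eq_sym // ea eqxx.
have := qres_neq k st'; rewrite /pact !s_V -el s_lo.
by rewrite s_D // ?el // ea eqxx.
Qed.

Lemma braid_cond t k l : l = k.+1 :> nat -> is_std lam t ->
  qres t (lo k) = qres t (hi l) ->
  defect (qres t (lo k)) (qres t (hi k)) (qres t (hi l)) = 0 \/
  exists2 s, s ^+ 2 = 1 & qres t (lo k) = 2 * s.
Proof.
move=> kl st ea; have [ak al] := braid_adj kl st ea; have el := lo_eq_hi kl.
have r0 (x : box b m) : rs x != 0 by apply: rs_neq0.
have hz := std_inb st (hi l); have hx := std_inb st (lo k).
have mid (p : 'I_n) : (lo k < p)%N -> (p < hi l)%N -> p = hi k :> nat by rewrite /= kl; lia.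
move: ak al; rewrite /comparable_adj el => /orP[]xy /orP[]yz.
- left; rewrite (rs_rowadj yz) (rs_rowadj xy).
  exact: defect_zero.
(* Right, then down: the box below the first is absent, hence left of the diagonal, and the first
   box lies on the diagonal, with residue 1 or -1. *)
- right; case ex: (t (lo k)) xy hx => [[i j] c] xy hx.
  case ey: (t (hi k)) xy yz => [[i1 j1] c1] /and3P[/eqP /= ec1 /eqP /= ei1 /eqP /= ej1].
  case ez: (t (hi l)) hz => [[i2 j2] c2] hz /and3P[/eqP /= ec2 /eqP /= ei2 /eqP /= ej2].
  subst c1 i1 j1 c2 i2 j2.
  have nin : ~~ inb lam (i.+1, j, c).
    apply/negP => /(std_ex st)[p ep].
    have l1 : (lo k < p)%N by apply: (std_col st); rewrite ex ep.
    have l2 : (p < hi l)%N by apply: (std_row st); rewrite ez ep.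
    have /val_inj e3 := mid p l1 l2; move: ey; rewrite -e3 ep => -[]; lia.
  have : ~~ (row_start c i.+1 <= j)%N.
    by apply: contraNN nin => hs; apply: (inb_down hz (leqnn _) (leqnSn _) hs).
  case: c {ex ey ez hz nin} hx => // k' hx /= ji; have [ij _] := inb_strict hx.
  have -> : j = i by lia.
  exists (Q_label Q (inl k' : label b m)); first exact: Q_label_sq.
  have -> : rs (i, i, inl k') = Q_label Q (inl k' : label b m).
    by rewrite /box_res /= subrr mulr0 expr0z mulr1.
  by apply: qfun_unit; apply: Q_label_sq.
(* Down, then right: the box to the right of the first is always present, and its entry would have
   to be the middle one. *)
- case ex: (t (lo k)) xy hx => [[i j] c] xy hx.
  case ey: (t (hi k)) xy yz => [[i1 j1] c1] /and3P[/eqP /= ec1 /eqP /= ei1 /eqP /= ej1].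
  case ez: (t (hi l)) hz => [[i2 j2] c2] hz /and3P[/eqP /= ec2 /eqP /= ei2 /eqP /= ej2].
  subst c1 i1 j1 c2 i2 j2.
  have [|p ep] := std_ex st (x := (i, j.+1, c)).
    apply: (inb_down hz (leqnSn _) (leqnn _) _).
    by move: hx; rewrite /inb /=; lia.
  have l1 : (lo k < p)%N by apply: (std_row st); rewrite ex ep.
  have l2 : (p < hi l)%N by apply: (std_col st); rewrite ez ep.
  have /val_inj e3 := mid p l1 l2; move: ey; rewrite -e3 ep => -[]; lia.
left; rewrite defectC (rs_coladj xy) (rs_coladj yz).
exact: defect_zero.
Qed.

Section Separation.
Variables (t u : tableau b m n).
Hypotheses (st : is_std lam t) (su : is_std lam u).

(** At the first disagreement r, each of the boxes t r and u r has a larger entry in the other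
    tableau, so neither precedes the other and the values at r are separated. *)
Lemma std_agree (p : 'I_n) : (forall r : 'I_n, (r <= p)%N -> qres t r = qres u r) ->
  forall r : 'I_n, (r <= p)%N -> t r = u r.
Proof.
move=> h r; have [N] := ubnP (val r); elim: N r => // N IH r; rewrite ltnS => rN rp.
have agree (r' : 'I_n) : (r' < r)%N -> t r' = u r'.
  by move=> rr; apply: IH; [apply: leq_trans rN|apply: ltnW; apply: leq_trans rp].
apply: contrapT => ne; have [r1 e1] := std_ex st (std_inb su r).
have [r2 e2] := std_ex su (std_inb st r).
have l1 : (r < r1)%N.
  case: (ltngtP r r1) => // [lt|/val_inj e]; last by case: ne; rewrite -e1 e.
  by have := std_inj su (esym (etrans (esym e1) (agree _ lt)));
    move: lt => /[swap] ->; rewrite ltnn.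
have l2 : (r < r2)%N.
  case: (ltngtP r r2) => // [lt|/val_inj e]; last by case: ne; rewrite -e2 e.
  by have := std_inj st (esym (etrans (agree _ lt) e2));
    move: lt => /[swap] ->; rewrite ltnn.
have hr := h r rp; have hx := std_inb st r; have hy := std_inb su r.
case: (cmpP (t r) (u r)) => c.
- exact: (sepc hx hy c).
- exact: (sepi hx hy c).
- have : (r2 < r)%N by apply: (std_lt su); rewrite ?e2 // -val_eqE /= gtn_eqF.
  by move/(ltn_trans l2); rewrite ltnn.
have : (r1 < r)%N by apply: (std_lt st); rewrite ?e1 // -val_eqE /= gtn_eqF.
by move/(ltn_trans l1); rewrite ltnn.
Qed.

(** Suppose the boxes of k and k + 1 in t are adjacent. Then u agrees with t below k, and u k has
    the value of t (k + 1) without being that box, since its neighbour t k must come first. The two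
    boxes are thus comparable, and either order contradicts standardness or [qres_neq]. *)
Lemma swap_std k : (forall p, qres t (s_ k p) = qres u p) -> is_std lam (pact (s_ k) t).
Proof.
move=> h; have [/(std_swap st)//|] := boolP (~~ comparable_adj t k).
rewrite negbK => adj; exfalso.
have agree (r : 'I_n) : (r < lo k)%N -> t r = u r.
  (* [std_agree] is applied up to k - 1, hence the separate case k = 0. *)
  rewrite /=; case: (posnP k) => [->//|k0] rk.
  have pk : (k.-1 < n)%N by apply: leq_ltn_trans (ltn_ord (lo k)); apply: leq_pred.
  apply: (@std_agree (Ordinal pk)) => [r' /= r'k|] /=; last by move: rk; lia.
  by rewrite -h s_D // -val_eqE /=; move: r'k k0 => /=; lia.
have ple_t : ple (t (lo k)) (t (hi k)).
  case/orP: adj; rewrite /rowadj /coladj /ple => /and3P[-> /=]; lia.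
have hu : qres u (lo k) = qres t (hi k) by rewrite -h s_lo.
have hc := std_inb su (lo k); have hb' := std_inb st (hi k).
have [r' er'] := std_ex su hb'; have [r er] := std_ex st hc.
have ge_r : (lo k <= r)%N.
  rewrite leqNgt; apply/negP => lt; have /(std_inj su) e := etrans (esym (agree _ lt)) er.
  by move: lt; rewrite e ltnn.
have ge_r' : (lo k <= r')%N.
  rewrite leqNgt; apply/negP => lt; have /(std_inj st) e := etrans (agree _ lt) er'.
  by move: lt; rewrite e /=; lia.
have ne : u (lo k) <> t (hi k).
  move=> e; have [r0 e0] := std_ex su (std_inb st (lo k)).
  have lt0 : (r0 < lo k)%N.
    apply: (std_lt su); rewrite ?e0 ?e //.
    apply/eqP => e1; have /(std_inj st)/eqP := etrans (esym e0) (etrans (congr1 u e1) e).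
    by rewrite (negPf (lo_neq_hi k)).
  have /(std_inj st) e2 := etrans (agree _ lt0) e0.
  by move: lt0; rewrite e2 ltnn.
case: (cmpP (u (lo k)) (t (hi k))) => c.
- exact: (sepc hc hb' c hu).
- exact: (sepi hc hb' c hu).
- have lt : (r < hi k)%N.
    apply: (std_lt st); rewrite ?er //; apply/eqP => e1; apply: ne.
    by rewrite -er e1.
  have er0 : r = lo k by apply: val_inj; move: lt ge_r => /=; lia.
  have := qres_neq k st; rewrite -er0 er hu eqxx //.
have lt : (r' < lo k)%N.
  apply: (std_lt su); rewrite ?er' //; apply/eqP => e1; apply: ne.
  by rewrite -er' e1.
by move: lt ge_r'; lia.
Qed.

End Separation.

End TableauResidues.

(** * The module D(lambda) *)

Section Summands.
Variables (K : fieldType) (b : cyc) (m n : nat) (lam : mpart b m n).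
Variables (V : superVectType K).
Local Notation D := (D_space lam V).
Local Notation P := (P_set lam).
Local Notation summ := (@in_summand K b m n lam V).

Lemma summE tau v (sigma : P_index lam) :
  summ tau v sigma = if val sigma == tau then v else 0.
Proof. by rewrite ffunE. Qed.

Lemma summD tau : {morph summ tau : u v / u + v}.
Proof. by move=> u v; apply/ffunP => s; rewrite !ffunE; case: eqP; rewrite ?addr0. Qed.

Lemma summZ tau c v : summ tau (c *: v) = c *: summ tau v.
Proof. by apply/ffunP => s; rewrite !ffunE; case: eqP; rewrite ?scaler0. Qed.

Lemma summ_ext (f g : endo D) :
  (forall tau v, tau \in P -> f (summ tau v) = g (summ tau v)) -> f = g.
Proof.
move=> h; apply: endoP => u.
have -> : u = \sum_(s : P_index lam) summ (val s) (u s).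
  apply/ffunP => s; rewrite sum_ffunE (bigD1 s) //= summE eqxx big1 ?addr0 // => s' ss.
  by rewrite summE (inj_eq val_inj) eq_sym (negPf ss).
by rewrite !linear_sum; apply: eq_bigr => s _; apply: h; apply: valP.
Qed.

(* The component at [rho], which is zero for [rho] outside P(lambda). *)
Definition dext (u : D) (rho : 'S_n) : V := if insub rho is Some s then u s else 0.

Lemma dext_lin rho : linear (dext ^~ rho).
Proof.
move=> c u v; rewrite /dext; case: insubP => [s _ _|_]; first by rewrite !ffunE.
by rewrite scaler0 addr0.
Qed.

Lemma dext_summ tau v rho : dext (summ tau v) rho =
  if (rho \in P) && (rho == tau) then v else 0.
Proof.
rewrite /dext; case: insubP => [s h e|/negPf -> //].
by rewrite summE e h.
Qed.

Variables (X Y C : 'I_n -> 'End(V)) (a : 'I_n -> K) (rt : K -> K) (e : K).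
Local Notation str tau p := ((tau^-1)%g p).
Local Notation xi := (xi X Y C a e).
Local Notation om := (om rt a e).

(** Read at the target: the component at sigma receives xi from sigma and om from s_k sigma; om
    being symmetric, the strands of sigma serve for both. *)
Definition T_fun (k : 'I_n.-1) (u : D) : D :=
  [ffun s : P_index lam => xi (str (val s) (lo k)) (str (val s) (hi k)) (u s) +
     om (str (val s) (lo k)) (str (val s) (hi k)) *: dext u (pmul (s_ k) (val s))].

Fact T_fun_linear k : linear (T_fun k).
Proof.
move=> c u v; apply/ffunP => s; rewrite !ffunE dext_lin linearP /=.
by rewrite !scalerDr addrACA !scalerA; congr (_ + _ *: _ + _); rewrite mulrC.
Qed.
HB.instance Definition _ k := GRing.isLinear.Build K D D _ (T_fun k) (T_fun_linear k).

Definition T_op k : endo D := linfun (T_fun k).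

(** Valid for every tau, also outside P(lambda), where [summ tau v] is 0: by symmetry of om, the
    hypothesis kills the om term whichever side of the boundary tau is on. *)
Lemma T_summ (k : 'I_n.-1) tau v :
  (forall tau k, tau \in P -> pmul (s_ k) tau \notin P ->
     om (str tau (lo k)) (str tau (hi k)) = 0) ->
  T_op k (summ tau v) = summ tau (xi (str tau (lo k)) (str tau (hi k)) v) +
     summ (pmul (s_ k) tau) (om (str tau (lo k)) (str tau (hi k)) *: v).
Proof.
move=> o0; rewrite lfunE /=; apply/ffunP => s; rewrite !ffunE; congr (_ + _).
  by case: eqP => [->//|_]; rewrite linear0.
rewrite dext_summ.
have -> : (val s == pmul (s_ k) tau) = (pmul (s_ k) (val s) == tau).
  by apply/eqP/eqP => [->|<-]; rewrite pmul_ss.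
case: (pmul (s_ k) (val s) =P tau) => [ts|_]; last by rewrite andbF scaler0.
rewrite andbT -ts !str_pmul s_lo s_hi [in RHS]omC.
case: ifP => [//|/negbT h]; rewrite scaler0.
by rewrite o0 ?scale0r //; apply: valP.
Qed.

Hypotheses (Xh : forall i p v, homog p v -> homog p (X i v))
  (Yh : forall i p v, homog p v -> homog p (Y i v))
  (Ch : forall i p v, homog p v -> homog (~~ p) (C i v)).

Lemma N_homog i j p v : homog p v -> homog p (N X Y C i j v).
Proof.
move=> hv; have hN w : homog p w -> homog p (- w) by rewrite -scaleN1r; apply: homogZ.
have hC : homog p (C i (C j v)) by rewrite -[p]negbK; do 2!apply: Ch.
rewrite NE; apply: homogD; last by apply/hN/Yh.
by apply: homogD; [apply: homogD; [apply: Yh|apply/hN/Xh]|apply: Yh].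
Qed.

Lemma T_homog k : ahomog false (T_op k).
Proof.
move=> p u hu; rewrite lfunE => s /=; rewrite ffunE; apply: homogD.
  by rewrite xiE; apply/homogZ/N_homog/hu.
apply: homogZ; rewrite /dext; case: insub => [s'|]; [exact: hu|exact: homog0].
Qed.

End Summands.

(** * Transport of relations and scalars to endomorphisms *)

Section Transfer.
Variables (K : fieldType) (n : nat).

Lemma relA_hom (B : superalgType K) (phi : sahom (Aff K n) B) l r :
  relA (fun i => phi (Agen K (GX i))) (fun i => phi (Agen K (GV i)))
    (fun i => phi (Agen K (GC i))) l r -> l = r.
Proof.
pose aX i := Agen K (@GX n i); pose aV i := Agen K (@GV n i); pose aC i := Agen K (@GC n i).
have E u v : relA aX aV aC u v -> u = v := @Agen_rel K n u v.
case=> [i j|i|i|i|i j ij|i|i j ij]; rewrite ?expr2 -!sahomM -?(sahom1 phi) -?sahomN.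
- exact: (congr1 phi (E _ _ (relXX aX aV aC i j))).
- exact: (congr1 phi (E _ _ (relXV aX aV aC i))).
- exact: (congr1 phi (E _ _ (relVX aX aV aC i))).
- exact: (congr1 phi (E _ _ (relCC aX aV aC i))).
- exact: (congr1 phi (E _ _ (relCCN aX aV aC ij))).
- exact: (congr1 phi (E _ _ (relXC aX aV aC i))).
- exact: (congr1 phi (E _ _ (relXCj aX aV aC ij))).
Qed.

Lemma sahom_relH (A B : superalgType K) (phi : sahom A B) (e : K) (T : 'I_n.-1 -> A)
    (X Y C : 'I_n -> A) l r : relH e T X Y C l r ->
  relH e (phi \o T) (phi \o X) (phi \o Y) (phi \o C) (phi l) (phi r).
Proof.
case=> [{}l {}r h|i|i j ij|i j ij|i|i|i j h1 h2|i|i|i j h1 h2].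
- exact/relHA/sahom_relA.
- by rewrite expr2 sahomD !sahomM sahom1 sahom_sc -expr2; apply: (relTT _ (phi \o T)).
- by rewrite !sahomM; apply: (relTTj _ (phi \o T)).
- by rewrite !sahomM; apply: (relTTT _ (phi \o T)).
- by rewrite sahomB !sahomM sahomD !sahomM sahom_sc; apply: (relTX _ (phi \o T)).
- rewrite sahomD !sahomM sahomB sahom1 !sahomM sahom_sc.
  exact: (relTXS _ (phi \o T)).
- by rewrite !sahomM; apply: (relTXj _ (phi \o T)).
- by rewrite !sahomM; apply: (relTC _ (phi \o T)).
- by rewrite sahomB !sahomM sahomB sahom_sc; apply: (relTCS _ (phi \o T)).
- by rewrite !sahomM; apply: (relTCj _ (phi \o T)).
Qed.

Lemma prod_eigen (V : superVectType K) (u : V) I (r : seq I) (F : I -> endo V) (c : I -> K) :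
  (forall i, F i u = c i *: u) -> (\prod_(i <- r) F i) u = (\prod_(i <- r) c i) *: u.
Proof.
move=> h; elim: r => [|i r IH]; first by rewrite !big_nil endo1E scale1r.
by rewrite !big_cons endoME IH linearZ /= h scalerA mulrC.
Qed.

(** A nonzero vector makes the scalar chosen by [scalar_of] unique. *)
Lemma scalar_ofZ (V : superVectType K) (c : K) : (exists v : V, v != 0) ->
  scalar_of (c *: \1%VF : 'End(V)) = c.
Proof.
move=> [v v0]; have cI d : (c *: \1%VF == d *: \1%VF :> 'End(V)) -> d = c.
  move=> /eqP/lfunP/(_ v); rewrite !scale_lfunE !id_lfunE => /eqP.
  by rewrite -subr_eq0 -scalerBl scaler_eq0 (negPf v0) orbF subr_eq0 => /eqP.
rewrite /scalar_of; case: pselect => [ex|[]]; last by exists c.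
by apply: cI; apply: (xchooseP ex).
Qed.

End Transfer.

Section StrandRel.
Variables (K : fieldType) (q : K) (n : nat) (V : superVectType K) (L : smod (Aff K n) V).

Definition opX i : endo V := L (Agen K (GX i)).
Definition opV i : endo V := L (Agen K (GV i)).
Definition opC i : endo V := L (Agen K (GC i)).

Lemma strand_relP (r : 'I_n -> K) : L_spec q r L ->
  strand_rel opX opV opC (fun i => qfun q (r i)).
Proof.
move=> hL; have E (f g : endo V) v : relA opX opV opC f g -> f v = g v.
  by move=> /(@relA_hom K n _ (hom_of_smod L) _ _) ->.
split=> [i j v|i v|i v|i j v ij|i v|i j v ij|i v|i s v s1 bs].
- by have := E _ _ v (relXX opX opV opC i j); rewrite !endoME.
- by have := E _ _ v (relVX opX opV opC i); rewrite endoME endo1E.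
- by have := E _ _ v (relCC opX opV opC i); rewrite expr2 endoME endo1E.
- by have := E _ _ v (relCCN opX opV opC ij); rewrite endoNE !endoME.
- by have := E _ _ v (relXC opX opV opC i); rewrite !endoME.
- by have := E _ _ v (relXCj opX opV opC ij); rewrite !endoME.
- by have [h _] := hL i; rewrite -h actD add_lfunE.
- by have [_ h] := hL i; apply: h.
Qed.

End StrandRel.

Section Operators.
Variables (K : fieldType) (two_neq0 : 2 != 0 :> K).
Variables (rt : K -> K) (rtP : forall a : K, rt a ^+ 2 = a) (q : K).
Variables (n : nat) (V : superVectType K) (L : smod (Aff K n) V) (r : 'I_n -> K).
Hypothesis hL : L_spec q r L.
Let a i := qfun q (r i).
Let rel : strand_rel (opX L) (opV L) (opC L) a := strand_relP hL.
Let eps := q - q^-1.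

Lemma twistE (tau : 'S_n) g :
  twist tau L (Agen K g) = L (Agen K (relabel_gen (tau^-1)%g g)).
Proof. by rewrite /= /pull_act relabel_Agen. Qed.

Lemma twist_opX (tau : 'S_n) p : twist tau L (Agen K (GX p)) = opX L ((tau^-1)%g p).
Proof. exact: twistE. Qed.
Lemma twist_opV (tau : 'S_n) p : twist tau L (Agen K (GV p)) = opV L ((tau^-1)%g p).
Proof. exact: twistE. Qed.
Lemma twist_opC (tau : 'S_n) p : twist tau L (Agen K (GC p)) = opC L ((tau^-1)%g p).
Proof. exact: twistE. Qed.

Variables (tau : 'S_n) (k : 'I_n.-1).
Let i := (tau^-1)%g (lo k).
Let j := (tau^-1)%g (hi k).
Hypothesis aij : a i != a j.

Lemma Xi_op_xi : Xi_op q (twist tau L) k = xi (opX L) (opV L) (opC L) a eps i j.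
Proof.
rewrite /Xi_op !twist_opX !twist_opV !twist_opC.
exact: (Xi_formula two_neq0 rtP rel eps aij).
Qed.

Lemma Omega_om : (exists v : V, v != 0) ->
  Omega rt q (twist tau L) k = om rt a eps i j.
Proof.
move=> V0; rewrite /Omega /Omega_radicand !twist_opX !twist_opV.
have := radicand_formula two_neq0 rtP rel eps aij => ->.
by rewrite scalar_ofZ.
Qed.

End Operators.

(** * The action on generators of H_Delta(n) *)

Section SeminormalModule.
Variables (K : fieldType) (two_neq0 : 2 != 0 :> K).
Variables (rt : K -> K) (rtP : forall a : K, rt a ^+ 2 = a).
Variables (n m : nat).
Variables (q : K) (q_neq0 : q != 0) (q_sum : q + q^-1 != 0).
Variables (b : cyc) (Q : 'I_m -> K) (Q_neq0 : forall i, Q i != 0).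
Hypothesis P_neq0 : Ppoly n q Q b != 0.
Variables (lam : mpart b m n) (V : superVectType K) (L : smod (Aff K n) V).
Local Notation D := (D_space lam V).
Local Notation P := (P_set lam).
Local Notation summ := (@in_summand K b m n lam V).
Local Notation str tau p := ((tau^-1)%g p).
Let r := res q Q (t_lam lam).
Let a i := qfun q (r i).
Let eps := q - q^-1.
Hypothesis hL : L_spec q r L.
Let rel : strand_rel (opX L) (opV L) (opC L) a := strand_relP hL.

Lemma a_neq tau (k : 'I_n.-1) : tau \in P -> a (str tau (lo k)) != a (str tau (hi k)).
Proof. by move=> /P_std st; exact: (qres_neq two_neq0 q_neq0 q_sum Q_neq0 P_neq0 k st). Qed.

Lemma om2_out tau (k : 'I_n.-1) : tau \in P -> pmul (s_ k) tau \notin P ->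
  om2 eps (a (str tau (lo k))) (a (str tau (hi k))) = 0.
Proof.
move=> tP nP; have st := P_std tP.
apply: (om2_adj two_neq0 q_neq0 q_sum Q_neq0 P_neq0 st).
by apply: contraNT nP => /(std_swap st); apply: P_swap.
Qed.

Lemma om_out tau (k : 'I_n.-1) : tau \in P -> pmul (s_ k) tau \notin P ->
  om rt a eps (str tau (lo k)) (str tau (hi k)) = 0.
Proof. by move=> tP nP; rewrite /om om2_out // (rt0 rtP). Qed.

Lemma braid_out tau (k l : 'I_n.-1) : l = k.+1 :> nat -> tau \in P ->
  let i := str tau (lo k) in let j := str tau (hi k) in let h := str tau (hi l) in
  a i = a h -> forall v, braid_defect a i j h *: N (opX L) (opV L) (opC L) i h v = 0.
Proof.
move=> kl tP i j h ea v; have st := P_std tP.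
have [|d0|[s s1 as1]] := braid_cond two_neq0 q_neq0 q_sum Q_neq0 P_neq0 kl st; first exact: ea.
  by rewrite [braid_defect _ _ _ _]d0 scale0r.
by rewrite (N_unit rel _ s1) ?scaler0 -?ea.
Qed.

Definition A_act (g : genA n) : endo D := D_mod lam L (Agen K g).

Lemma A_act_summ g tau v :
  A_act g (summ tau v) = summ tau (L (Agen K (relabel_gen (tau^-1)%g g)) v).
Proof.
apply/ffunP => s; rewrite summE.
have -> : A_act g (summ tau v) s = twist (val s) L (Agen K g) (summ tau v s).
  by rewrite /A_act /D_mod lfunE ffunE.
by rewrite summE twistE; case: eqP => [->|_] //; rewrite linear0.
Qed.

Definition T_act k : endo D := T_op lam (opX L) (opV L) (opC L) a rt eps k.

Lemma T_act_summ (k : 'I_n.-1) tau v : T_act k (summ tau v) =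
  summ tau (xi (opX L) (opV L) (opC L) a eps (str tau (lo k)) (str tau (hi k)) v) +
  summ (pmul (s_ k) tau) (om rt a eps (str tau (lo k)) (str tau (hi k)) *: v).
Proof. by apply: T_summ => *; apply: om_out. Qed.

Definition gen_act (g : genH n) : endo D :=
  match g with GT k => T_act k | GA g => A_act g end.

Lemma gen_act_par g : ahomog (genH_par g) (gen_act g).
Proof.
case: g => [k|g] /=.
  apply: T_homog => i p v hv; [| |rewrite -addTb];
   rewrite -1?[X in homog X _]addFb.
  - exact: act_homog (Agen_homog K (GX i)) hv.
  - exact: act_homog (Agen_homog K (GV i)) hv.
  - exact: act_homog (Agen_homog K (GC i)) hv.
by move=> p v; apply: act_homog; apply: Agen_homog.
Qed.

Let XD i := A_act (GX i).
Let YD i := A_act (GV i).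
Let CD i := A_act (GC i).
Let XDm p tau v : XD p (summ tau v) = summ tau (opX L (str tau p) v) := A_act_summ (GX p) tau v.
Let YDm p tau v : YD p (summ tau v) = summ tau (opV L (str tau p) v) := A_act_summ (GV p) tau v.
Let CDm p tau v : CD p (summ tau v) = summ tau (opC L (str tau p) v) := A_act_summ (GC p) tau v.

Lemma gen_act_relH (f g : endo D) : relH eps T_act XD YD CD f g -> f = g.
Proof.
apply: (T_relH two_neq0 rtP rel (@summD K b m n lam V) (@summZ K b m n lam V)
  (@summ_ext K b m n lam V) T_act_summ XDm CDm a_neq om2_out braid_out).
exact: (@relA_hom K n _ (hom_of_smod (D_mod lam L))).
Qed.

End SeminormalModule.

Lemma relH_ext (K : fieldType) (A : superalgType K) n (e : K) (T T' : 'I_n.-1 -> A)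
    (X X' Y Y' C C' : 'I_n -> A) l r :
  T =1 T' -> X =1 X' -> Y =1 Y' -> C =1 C' ->
  relH e T X Y C l r -> relH e T' X' Y' C' l r.
Proof. by move=> /funext -> /funext -> /funext -> /funext ->. Qed.

(** [b] occurs in the types of [lam] and of its boxes, so the cases are offered as equations instead
    of by destructing [b]. *)
Lemma fcyc_cases (K : fieldType) n (n_gt0 : (0 < n)%N) (q : K) b m (Q : 'I_m -> K) :
  let X1 := Hgen q (GA (GX (Ordinal n_gt0))) in
  [\/ b = cyc0 /\ fcyc n_gt0 q b Q = fcyc0 n_gt0 q Q,
      b = cycs /\ fcyc n_gt0 q b Q = (X1 - 1) * fcyc0 n_gt0 q Q |
      b = cycss /\ fcyc n_gt0 q b Q = (X1 + 1) * (X1 - 1) * fcyc0 n_gt0 q Q].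
Proof. by case: b; [constructor 1|constructor 2|constructor 3]. Qed.

Lemma Q_label_cycs (K : fieldType) b m (Q : 'I_m -> K) (k : 'I_(nstrict b)) :
  b = cycs -> @Q_label b m K Q (inl k) = 1.
Proof. by case: b k. Qed.

(** * The cyclotomic relation *)

Section Cyclotomic.
Variables (K : fieldType) (two_neq0 : 2 != 0 :> K).
Variables (rt : K -> K) (rtP : forall a : K, rt a ^+ 2 = a).
Variables (n m : nat) (n_gt0 : (0 < n)%N).
Variables (q : K) (q_neq0 : q != 0) (q_sum : q + q^-1 != 0).
Variables (b : cyc) (Q : 'I_m -> K) (Q_neq0 : forall i, Q i != 0).
Hypothesis P_neq0 : Ppoly n q Q b != 0.
Variables (lam : mpart b m n) (V : superVectType K) (L : smod (Aff K n) V).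
Local Notation D := (D_space lam V).
Local Notation P := (P_set lam).
Local Notation summ := (@in_summand K b m n lam V).
Local Notation str tau p := ((tau^-1)%g p).
Let r := res q Q (t_lam lam).
Let a i := qfun q (r i).
Hypothesis hL : L_spec q r L.

Let G : genH n -> endo D := gen_act rt q Q lam L.
Let G_par g : ahomog (genH_par g) (G g) := @gen_act_par K rt n m q b Q lam V L g.

Lemma gen_act_rel f g : @relH_free K n q f g -> free_lift G_par f = free_lift G_par g.
Proof.
move=> /(sahom_relH (free_lift G_par)) h.
apply: (gen_act_relH two_neq0 rtP q_neq0 q_sum Q_neq0 P_neq0 hL).
apply: relH_ext h => i.
- exact: (free_lift_gen G_par (GT i)).
- exact: (free_lift_gen G_par (GA (GX i))).
- exact: (free_lift_gen G_par (GA (GV i))).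
- exact: (free_lift_gen G_par (GA (GC i))).
Qed.

Definition H_act : sahom (HDelta n q) (endo D) :=
  pres_lift (@relH_free_homog K n q) gen_act_rel.

Lemma H_act_gen g : H_act (Hgen q g) = G g.
Proof. exact: pres_lift_gen. Qed.

Lemma H_act_X p tau v :
  H_act (Hgen q (GA (GX p))) (summ tau v) = summ tau (opX L (str tau p) v).
Proof. by rewrite H_act_gen; apply: A_act_summ. Qed.
Lemma H_act_V p tau v :
  H_act (Hgen q (GA (GV p))) (summ tau v) = summ tau (opV L (str tau p) v).
Proof. by rewrite H_act_gen; apply: A_act_summ. Qed.

Let fst := Ordinal n_gt0.

Lemma H_act_fcyc0 tau v : H_act (fcyc0 n_gt0 q Q) (summ tau v) =
  (\prod_(i < m) (a (str tau fst) - qfun q (Q i))) *: summ tau v.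
Proof.
rewrite /fcyc0 sahom_prod; apply: prod_eigen => i.
rewrite sahomB sahomD sahom_sc endoDE endoNE endoDE H_act_X H_act_V endo_scE.
have rel := strand_relP hL.
by rewrite -!summZ -!summD -scaleN1r -summZ -summD scaleN1r (sXaY rel) -scalerBl.
Qed.

(** The entry 1 sits in the corner of some component c, so X_1 + X_1^-1 acts on z^tau by q(Q_c). An
    ordinary c annihilates a factor of [fcyc0]; for a shifted one X_1 is the scalar Q_c = 1 or -1,
    and a linear factor vanishes. *)
Lemma H_act_fcyc : H_act (fcyc n_gt0 q b Q) = 0.
Proof.
apply: summ_ext => tau v tP; rewrite endo0E.
have [c ec] := std_first n_gt0 (P_std tP).
have ac : a (str tau fst) = qfun q (@Q_label b m K Q c).
  rewrite /a /r /res; have -> : t_lam lam (str tau fst) = (0%N, 0%N, c) := ec.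
  by rewrite /box_res /= subrr mulr0 expr0z mulr1.
case: c ec ac => k ec ac; last first.
  have f0 : H_act (fcyc0 n_gt0 q Q) (summ tau v) = 0.
    by rewrite H_act_fcyc0 (bigD1 k) //= ac subrr mul0r scale0r.
  by case: (fcyc_cases n_gt0 q b Q) => -[_ ->] //; rewrite sahomM endoME f0 linear0.
have s2 := @Q_label_sq K b m Q k.
set s : K := Q_label Q _ in ac s2.
have as2 : a (str tau fst) = 2 * s by rewrite ac qfun_unit.
have Xs (w : V) : opX L (str tau fst) w = s *: w by apply: (sXa (strand_relP hL)).
have X1 w : H_act (Hgen q (GA (GX fst)) - 1) (summ tau w) = (s - 1) *: summ tau w.
  rewrite sahomB sahom1 endoDE endoNE endo1E H_act_X Xs summZ.
  by rewrite scalerBl scale1r.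
have X2 w : H_act (Hgen q (GA (GX fst)) + 1) (summ tau w) = (s + 1) *: summ tau w.
  by rewrite sahomD sahom1 endoDE endo1E H_act_X Xs summZ scalerDl scale1r.
have f0 : exists w, H_act (fcyc0 n_gt0 q Q) (summ tau v) = summ tau w.
  by rewrite H_act_fcyc0 -summZ; eexists.
have [w fw] := f0.
have s0 : (s + 1) * (s - 1) = 0 by rewrite mulrC -subr_sqr expr1n s2 subrr.
have s1 : b = cycs -> s = 1 by apply: Q_label_cycs.
case: (fcyc_cases n_gt0 q b Q) => -[eb ->].
- by case: (nstrict_cyc k).
- by rewrite sahomM endoME fw X1 s1 // subrr scale0r.
by rewrite !sahomM !endoME fw X1 linearZ /= X2 scalerA mulrC s0 scale0r.
Qed.

End Cyclotomic.

Lemma admissibleP (K : fieldType) (q : K) b m n (Q : 'I_m -> K) (lam : mpart b m n) tau i :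
  2 != 0 :> K -> q != 0 -> q + q^-1 != 0 -> (forall i, Q i != 0) -> Ppoly n q Q b != 0 ->
  tau \in P_set lam -> admissible lam q Q tau i <-> pmul (s_ i) tau \in P_set lam.
Proof.
move=> two_neq0 q0 qs Q0 P0 tP; split=> [[u su h]|sP].
  apply: P_swap => //; apply: (swap_std two_neq0 q0 qs Q0 P0 (P_std tP) su) => p.
  by rewrite -h /pact s_V.
by exists (pact (pmul (s_ i) tau) (t_lam lam)); [exact: P_std | rewrite pact_pmul].
Qed.

Theorem theorem4p5 (K : closedFieldType) (K_char : 2 \notin [pchar K])
    (rt : K -> K) (rtP : forall a : K, rt a ^+ 2 = a)
    (n m : nat) (n_gt0 : (0 < n)%N)
    (q : K) (q_neq0 : q != 0) (q_neq1 : q != 1) (q_neqN1 : q != -1)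
    (q_sum : q + q^-1 != 0)
    (b : cyc) (Q : 'I_m -> K) (Q_neq0 : forall i, Q i != 0)
    (P_neq0 : Ppoly n q Q b != 0)
    (lam : mpart b m n)
    (V : superVectType K) (L : smod (Aff K n) V)
    (LP : is_L rt q (res q Q (t_lam lam)) L) :
  exists M : smod (Hcyc n_gt0 q b Q) (D_space lam V),
    (forall a : Aff K n, M (H_to_Hcyc n_gt0 q b Q (A_to_H n q a)) = D_mod lam L a) /\
    (forall (i : 'I_n.-1) (tau : 'S_n) (z : V), tau \in P_set lam ->
       let Ti := H_to_Hcyc n_gt0 q b Q (Hgen q (GT i)) in
       (admissible lam q Q tau i ->
          M Ti (in_summand lam tau z) =
            in_summand lam tau (Xi_op q (twist tau L) i z) +
            in_summand lam (pmul (s_ i) tau)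
              (Omega rt q (twist (pmul (s_ i) tau) L) i *: z)) /\
       (~ admissible lam q Q tau i ->
          M Ti (in_summand lam tau z) =
            in_summand lam tau (Xi_op q (twist tau L) i z))).
Proof.
have two_neq0 : 2 != 0 :> K by apply: contraNneq K_char => e; rewrite inE /= e eqxx.
have [hL V0] := is_L_spec two_neq0 rtP LP.
pose hact := H_act two_neq0 rtP q_neq0 q_sum Q_neq0 P_neq0 hL.
have kill s : HomogSet (@fcyc_homog K n n_gt0 q b m Q) s -> hact s = 0.
  by move=> ->; apply: H_act_fcyc.
pose M := smod_of_hom (quot_lift kill).
have ME x : M (H_to_Hcyc n_gt0 q b Q x) = hact x by exact: (quot_lift_qpi kill x).
exists M; split=> [x|i tau z tP Ti].
  rewrite ME; pose comp : sahom (Aff K n) (endo (D_space lam V)) :=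
    @SAHom K _ _ (fun y => hact (A_to_H n q y))
     (fun y w => etrans (congr1 hact (sahomD (A_to_H n q) y w)) (sahomD hact _ _))
     (fun y w => etrans (congr1 hact (sahomM (A_to_H n q) y w)) (sahomM hact _ _))
     (fun c => etrans (congr1 hact (sahom_sc (A_to_H n q) c)) (sahom_sc hact c))
     (fun p y hy => sahom_homog hact (sahom_homog (A_to_H n q) hy)).
  apply: (Aff_ext (phi := comp) (psi := hom_of_smod (D_mod lam L))) => g.
  rewrite [LHS](congr1 hact (A_to_H_Agen q g)).
  exact: (H_act_gen two_neq0 rtP q_neq0 q_sum Q_neq0 P_neq0 hL).
have adm := admissibleP i two_neq0 q_neq0 q_sum Q_neq0 P_neq0 tP.
have a1 := a_neq two_neq0 q_neq0 q_sum Q_neq0 P_neq0 i tP.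
pose a k := qfun q (res q Q (t_lam lam) k); pose p := (tau^-1)%g.
have TE : M Ti (in_summand lam tau z) = in_summand lam tau (Xi_op q (twist tau L) i z) +
   in_summand lam (pmul (s_ i) tau) (om rt a (q - q^-1) (p (lo i)) (p (hi i)) *: z).
  rewrite /Ti ME (H_act_gen two_neq0 rtP q_neq0 q_sum Q_neq0 P_neq0 hL).
  rewrite (Xi_op_xi two_neq0 rtP hL a1).
  exact: (T_act_summ two_neq0 rtP q_neq0 q_sum Q_neq0 P_neq0).
split=> [/adm sP|nadm]; rewrite TE.
  have a2 := a_neq two_neq0 q_neq0 q_sum Q_neq0 P_neq0 i sP.
  (* The statement takes Omega on the target summand s_i tau, where the two strands are exchanged;
     om is symmetric in them. *)
  rewrite (Omega_om two_neq0 rtP hL a2 V0) !str_pmul s_lo s_hi.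
  by rewrite omC.
have -> : in_summand lam (pmul (s_ i) tau)
    (om rt a (q - q^-1) (p (lo i)) (p (hi i)) *: z) = 0 :> D_space lam V.
  rewrite (om_out two_neq0 rtP q_neq0 q_sum Q_neq0 P_neq0 tP) ?scale0r; last first.
    by apply/negP => /adm.
  by apply/ffunP => s; rewrite !ffunE if_same.
by rewrite addr0.
Qed.
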